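(* Let $(X,d,\mu)$ be a bounded space of homogeneous type, let $w$ be an integrable weight on $X$, let $1<p,s<\infty$ and let $\theta>0$. Then the Hardy--Littlewood maximal operator $M$ is bounded in $L^{p),s,\theta}_w(X)$ if and only if $w\in A_p(X)$.
   Context: Space of homogeneous type $(X,d,\mu)$: $d:X\times X\to[0,\infty)$ is a quasi-metric ($d(x,y)=0$ iff $x=y$; $d(x,y)=d(y,x)$; $d(x,y)\le\kappa(d(x,z)+d(z,y))$ for a constant $\kappa>0$), balls $B(x,r)=\{y: d(x,y)<r\}$ are measurable with positive measure, and $\mu$ is doubling: $\mu(B(x,2r))\le D_\mu\,\mu(B(x,r))$ for all $x\in X$, $r>0$. It is assumed throughout that the class of continuous functions is dense in $L^1(X)$. Bounded means that $X$ is contained in some ball. A weight is a $\mu$-a.e. positive, locally integrable function; $w(E)=\int_E w\,d\mu$. For $1<p<\infty$, $p'=p/(p-1)$, $w\in A_p(X)$ means $$\sup_B\Big(\frac1{\mu(B)}\int_B w\,d\mu\Big)\Big(\frac1{\mu(B)}\int_B w^{1-p'}d\mu\Big)^{p-1}<\infty,$$ supremum over all balls $B\subset X$. $Mg(x)=\sup_{B\ni x}\frac1{\mu(B)}\int_B|g|\,d\mu$. Weighted Lorentz space: for $1\le p,s<\infty$, $\|f\|_{L^{p,s}_w}=\Big(s\int_0^\infty\big(w\{x:|f(x)|>\tau\}\big)^{s/p}\tau^{s-1}d\tau\Big)^{1/s}$. Weighted grand Lorentz space: for $1<p<\infty$, $\theta>0$, $$\|f\|_{L^{p),s,\theta}_w}=\sup_{0<\varepsilon<p-1}\varepsilon^{\frac{\theta}{p-\varepsilon}}\|f\|_{L^{p-\varepsilon,s}_w}.$$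 *)

(* Defs.v *)
From HB Require Import structures.
From mathcomp Require Import all_boot all_order all_algebra.
From mathcomp Require Import all_classical all_reals all_analysis.

Set Implicit Arguments.
Unset Strict Implicit.
Unset Printing Implicit Defensive.

Import Order.TTheory GRing.Theory Num.Theory.
Import numFieldNormedType.Exports.

Local Open Scope classical_set_scope.
Local Open Scope ring_scope.

Section QuasiMetric.
Context {R : realType} {T : Type}.
Implicit Types d : T -> T -> R.

Record quasi_metric d : Prop := QuasiMetric {
  qm_ge0 : forall x y, 0 <= d x y ;
  qm_eq0 : forall x y, d x y = 0 <-> x = y ;
  qm_sym : forall x y, d x y = d y x ;
  qm_triangle : exists2 kappa : R, 0 < kappa &
    forall x y z, d x y <= kappa * (d x z + d z y) }.

Definition qball d (x : T) (r : R) : set T := [set y | d x y < r].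

Definition is_qball d (B : set T) : Prop :=
  exists x r, 0 < r /\ B = qball d x r.

Definition qbounded d : Prop :=
  exists x r, 0 < r /\ [set: T] `<=` qball d x r.

(* Continuity for the topology in which U is open iff every x in U is the
   centre of a ball contained in U; the balls themselves need not be open. *)
Definition qcontinuous d (g : T -> R) : Prop :=
  forall x (e : R), 0 < e ->
    exists2 r : R, 0 < r & forall y, qball d x r y -> `|g x - g y| < e.

End QuasiMetric.

Section HomogeneousType.
Context {R : realType} {disp : measure_display} {T : measurableType disp}.
Variables (mu : {measure set T -> \bar R}) (d : T -> T -> R).

Definition doubling : Prop :=
  exists D : R, forall x r, 0 < r ->
    (mu (qball d x (2 * r)) <= D%:E * mu (qball d x r))%E.

Definition continuous_dense_L1 : Prop :=
  forall f : T -> R, mu.-integrable setT (EFin \o f) ->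
  forall e : R, 0 < e ->
  exists g : T -> R, [/\ qcontinuous d g,
    mu.-integrable setT (EFin \o g) &
    (\int[mu]_x `|f x - g x|%:E < e%:E)%E].

(* Finiteness of the measure of balls is not listed separately: as soon as
   L^1 contains a nonzero element it follows on a bounded space, since a
   nonzero continuous integrable g is bounded away from 0 on some ball, and
   doubling carries finiteness from one ball to all. *)
Record homogeneous_type : Prop := HomogeneousType {
  ht_quasi_metric : quasi_metric d ;
  ht_measurable_ball : forall x r, 0 < r -> measurable (qball d x r) ;
  ht_ball_gt0 : forall x r, 0 < r -> (0 < mu (qball d x r))%E ;
  ht_doubling : doubling ;
  ht_dense : continuous_dense_L1 }.

Definition locally_integrable_on_balls (f : T -> R) : Prop :=
  forall B, is_qball d B -> mu.-integrable B (EFin \o f).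

Definition weight (w : T -> R) : Prop :=
  {ae mu, forall x, 0 < w x} /\ locally_integrable_on_balls w.

Definition average (B : set T) (f : T -> \bar R) : \bar R :=
  ((mu B)^-1 * \int[mu]_(x in B) f x)%E.

Definition conjugate_exponent (p : R) : R := p / (p - 1).

Definition Muckenhoupt (p : R) (w : T -> R) : Prop :=
  (ereal_sup [set average B (fun x => (w x)%:E) *
     average B (fun x => (w x `^ (1 - conjugate_exponent p))%:E) `^ (p - 1)
     | B in is_qball d] < +oo)%E.

Definition maximal (f : T -> R) (x : T) : \bar R :=
  ereal_sup [set average B (fun y => `|f y|%:E) | B in
    [set B | is_qball d B /\ B x]].

End HomogeneousType.

Section GrandLorentz.
Context {R : realType} {disp : measure_display} {T : measurableType disp}.
Variables (mu : {measure set T -> \bar R}) (w : T -> R).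

(* Superlevel sets of maximal functions may fail to be measurable, because
   balls of a quasi-metric need not be open. On a non-measurable E this is
   the lower integral of w over E. *)
Definition wmeasure (E : set T) : \bar R := \int[mu]_(x in E) (w x)%:E.

(* Functions are extended-real valued so that the norm applies to maximal
   functions. *)
Definition lorentz_norm (p s : R) (f : T -> \bar R) : \bar R :=
  ((s%:E * \int[lebesgue_measure]_(t in `]0%R, +oo[)
      (wmeasure [set x | t%:E < `|f x|] `^ (s / p) * (t `^ (s - 1))%:E))
    `^ s^-1)%E.

Definition grand_lorentz_norm (p s theta : R) (f : T -> \bar R) : \bar R :=
  ereal_sup [set ((e `^ (theta / (p - e)))%:E * lorentz_norm (p - e) s f)%E
             | e in `]0, p - 1[].

Definition bounded_in_grand_lorentz (p s theta : R)
    (Op : (T -> R) -> T -> \bar R) : Prop :=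
  exists C : R, forall f : T -> R, measurable_fun setT f ->
    (grand_lorentz_norm p s theta (EFin \o f) < +oo)%E ->
    (grand_lorentz_norm p s theta (Op f) <=
     C%:E * grand_lorentz_norm p s theta (EFin \o f))%E.

End GrandLorentz.

(* Main.v *)
Require Import Defs.
From HB Require Import structures.
From mathcomp Require Import all_boot all_order all_algebra.
From mathcomp Require Import all_classical all_reals all_analysis.
From mathcomp Require Import measurable_realfun ring lra.

Set Implicit Arguments.
Unset Strict Implicit.
Unset Printing Implicit Defensive.

Import Order.TTheory GRing.Theory Num.Theory.
Import numFieldNormedType.Exports.

Local Open Scope classical_set_scope.
Local Open Scope ring_scope.

(** Both implications pass through one inequality between [mu] and the weighted
    measure [nu]: for some exponent [q < p], every measurable subset [E] of a
    ball [B] satisfies [(mu E / mu B) ^ q <= K * nu E / nu B]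
    ([restricted_Muckenhoupt]). It says that the maximal operator [M] is of
    restricted weak type [(q, q)] for [nu], and, since [q < p], it is equivalent
    to the [A_p] condition. It speaks of indicators only, so it can be read off
    from norms that are known on indicators only.

    The passage from [p] to [q < p] uses, for a given set [E], the level sets
    [U_j] of [M 1_E] at the heights [1/2 * N ^ (- j)], for a large constant [N]. By
    the Vitali covering lemma each of them is, up to constants, a disjoint union
    of balls of nearly maximal radius in which [E] has density just above the
    height. A dilate of such a ball has density below the height; this makes the
    higher level set thin in the ball ([stopping_sparse]) and still present in
    the proportion that the heights predict ([stopping_rich]). If [E] is a thin
    subset of [B], the number of levels before [U_j] fills [B] is about the
    logarithm of [mu B / mu E] ([level_sequence]).

    From [A_p]: the dual weight [sg] satisfies
    [mu E ^ p <= K * nu E * sg E ^ (p - 1)] on every set and the reverse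
    inequality on balls. Hence [sg] is doubling on thick subsets of balls, and
    by sparseness [sg U_j <= theta * sg U_(j+1)] with [theta < 1]. Therefore
    [sg E / sg B] is at most a power of [mu E / mu B] ([dual_decay]), and this
    power is the gain that lowers [p] to [q] ([self_improvement]).

    From the boundedness of [M]: let [G = sum_j b ^ j * 1_(U_j)], with [b] a
    little larger than [1/N]. On [U_j] outside the higher level sets [G] is
    comparable to [b ^ j], while in the mean of [G] over a stopping ball each of
    the last [k] levels counts as much as level [j], so that [M G] exceeds a
    large multiple of [G] ([maximal_test_function]). As [M] is bounded, this is
    possible only if the norm of [G] comes from the first [k] level sets, hence
    is at most a constant times the norm of [1_E] ([test_function_norm]). But
    [M G] is at least [c * b ^ J] on [B], where [J] is the last level, and
    [b ^ J] is a power of [mu E / mu B] of exponent less than 1. Up to this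
    point any monotone quasinorm would do; the grand Lorentz norm enters
    through the fact that the norms of [1_E] and [1_B] have a ratio at most
    [(nu E / nu B) ^ (1 / p)] ([grand_indic_ratio]), the endpoint exponent [p]
    being the worst one.

    Back from the restricted condition: applied to the sets where the dual
    weight is large it gives [A_p], since [q < p] makes the sum over the heights
    converge ([restricted_implies_Muckenhoupt]). Applied to the sets where [f] is
    large inside a ball of large mean, together with the Vitali lemma, it bounds
    the distribution function of [M f] by those of the layers of [f]
    ([maximal_distribution_le]). Interpolation then bounds [M] on the Lorentz
    spaces of exponent [p - e], uniformly for small [e] ([maximal_lorentz]); the
    exponents that are not close to [p] are dominated by these because the
    measure [nu] is finite ([restricted_implies_bounded]).

    Superlevel sets of [M f] may be nonmeasurable, so their weighted measure is
    an inner measure, of which only the monotonicity is used; subadditivity is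
    needed for measurable functions alone. The density of the continuous
    functions makes the measure of the space finite ([homogeneous_finite]) and
    replaces Lebesgue's differentiation theorem ([density_points_null]). *)

(** * Finite measures with real values *)

Section FiniteMeasure.
Context {R : realType} {disp : measure_display} {T : measurableType disp}.
Implicit Types (nu : {measure set T -> \bar R}) (A B E : set T).

Definition fmeas nu E : R := fine (nu E).

Definition finite_total nu := (nu setT < +oo)%E.

Lemma finite_total_lt nu E : finite_total nu -> measurable E -> (nu E < +oo)%E.
Proof.
by move=> fnu mE; apply: le_lt_trans fnu; apply: le_measure; rewrite ?inE.
Qed.

Lemma fmeasE nu E : finite_total nu -> measurable E -> nu E = (fmeas nu E)%:E.
Proof.
by move=> fnu mE; rewrite /fmeas fineK// ge0_fin_numE// finite_total_lt.
Qed.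

Lemma fmeas_ge0 nu E : 0 <= fmeas nu E.
Proof. exact: fine_ge0. Qed.

Lemma le_fmeas nu A B : finite_total nu -> measurable A -> measurable B ->
  A `<=` B -> fmeas nu A <= fmeas nu B.
Proof.
move=> fnu mA mB AB; rewrite -lee_fin -!fmeasE//.
by apply: le_measure; rewrite ?inE.
Qed.

Lemma fmeas_gt0 nu E : finite_total nu -> measurable E -> (0 < nu E)%E ->
  0 < fmeas nu E.
Proof. by move=> fnu mE; rewrite fmeasE// lte_fin. Qed.

Lemma fmeasDI nu A B : finite_total nu -> measurable A -> measurable B ->
  fmeas nu A = fmeas nu (A `&` B) + fmeas nu (A `\` B).
Proof.
move=> fnu mA mB; have mI := measurableI _ _ mA mB.
have mD := measurableD mA mB.
by apply: EFin_inj; rewrite EFinD -!fmeasE// addeC -measureDI.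
Qed.

(** This is how the disjointness of a family of balls is exploited: an
    inequality between the enlarged balls [G i] and the balls [F i] that they
    come from passes to the union. *)
Lemma le_measure_bigcup nu nu' E (D : set nat) (F G : nat -> set T) (c : R) :
  0 <= c -> measurable E ->
  (forall i, D i -> measurable (F i)) -> (forall i, D i -> measurable (G i)) ->
  trivIset D F ->
  (forall i, D i -> (nu' (G i) <= c%:E * nu (E `&` F i))%E) ->
  (nu' (\bigcup_(i in D) G i) <= c%:E * nu E)%E.
Proof.
move=> c0 mE mF mG tF le.
have mG' i : measurable (if i \in D then G i else set0).
  by case: ifPn => // /set_mem; exact: mG.
rewrite bigcup_mkcond.
apply: le_trans (generalized_Boole_inequality nu' mG' (bigcup_measurable _)) _.
  by [].
have mEF : measurable (\bigcup_(i in D) (E `&` F i)).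
  by apply: bigcup_measurable => i Di; apply: measurableI => //; exact: mF.
apply: (@le_trans _ _ (c%:E * nu (\bigcup_(i in D) (E `&` F i)))%E); last first.
  apply: lee_wpmul2l; first by rewrite lee_fin.
  by apply: le_measure; rewrite ?inE//; apply: bigcup_sub => i _ x [].
rewrite measure_bigcup; last 2 first.
- by move=> i Di; apply: measurableI => //; exact: mF.
- by apply: trivIset_setIl.
rewrite -nneseriesZl// [leRHS]eseries_mkcond.
apply: lee_nneseries => // i _.
by case: ifPn => [/set_mem Di|_]; [exact: le|rewrite measure0].
Qed.

Lemma le_fmeas_bigcup nu nu' E (D : set nat) (F G : nat -> set T) (c : R) :
  finite_total nu -> finite_total nu' -> 0 <= c -> measurable E ->
  (forall i, D i -> measurable (F i)) -> (forall i, D i -> measurable (G i)) ->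
  trivIset D F ->
  (forall i, D i -> fmeas nu' (G i) <= c * fmeas nu (E `&` F i)) ->
  fmeas nu' (\bigcup_(i in D) G i) <= c * fmeas nu E.
Proof.
move=> fnu fnu' c0 mE mF mG tF le.
have mU : measurable (\bigcup_(i in D) G i) by exact: bigcup_measurable.
rewrite -lee_fin -fmeasE// EFinM -fmeasE//.
apply: (le_measure_bigcup c0 mE mF mG tF) => i Di.
have mEF := measurableI _ _ mE (mF i Di).
by rewrite !fmeasE//; [rewrite -EFinM lee_fin; exact: le|exact: mG].
Qed.

End FiniteMeasure.

Section Density.
Context {R : realType} {disp : measure_display} {T : measurableType disp}.
Variables (mu : {measure set T -> \bar R}) (h : T -> R).
Hypothesis mh : measurable_fun setT h.

Definition density_measure of measurable_fun setT h :=
  fun E => (\int[mu]_(x in E) `|(h x)%:E|)%E.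

Let nu := density_measure mh.

Let mh' E : measurable E -> measurable_fun E (fun x => `|(h x)%:E|%E).
Proof.
move=> mE; apply: measurableT_comp => //; apply/measurable_EFinP.
exact: measurable_funTS.
Qed.

Let nu0 : nu set0 = 0%E. Proof. by rewrite /nu /density_measure integral_set0. Qed.

Let nu_ge0 E : (0 <= nu E)%E. Proof. by apply: integral_ge0 => x _; exact: abse_ge0. Qed.

Let nu_sigma_additive : semi_sigma_additive nu.
Proof.
move=> F mF tF mU.
rewrite /nu /density_measure ge0_integral_bigcup//; last first.
- exact: mh' mU.
apply: is_cvg_nneseries => n _ _; exact: nu_ge0.
Qed.

HB.instance Definition _ := isMeasure.Build _ _ _ (density_measure mh)
  nu0 nu_ge0 nu_sigma_additive.

Lemma density_measure_dominated E : measurable E -> mu E = 0%E ->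
  density_measure mh E = 0%E.
Proof.
move=> mE E0; apply: null_set_integral => //.
exact: mh'.
Qed.

Lemma density_measure_ge E (c : R) : measurable E -> 0 <= c ->
  (forall x, E x -> c <= `|h x|) -> (c%:E * mu E <= density_measure mh E)%E.
Proof.
move=> mE c0 hc; rewrite -integral_cst//; apply: ge0_le_integral => //.
exact: mh'.
Qed.

Lemma density_measure_le E (c : R) : measurable E -> 0 <= c ->
  (forall x, E x -> `|h x| <= c) -> (density_measure mh E <= c%:E * mu E)%E.
Proof.
move=> mE c0 hc; rewrite -integral_cst//; apply: ge0_le_integral => //.
exact: mh'.
Qed.

Lemma density_measure_eq0 E : {ae mu, forall x, h x != 0} -> measurable E ->
  density_measure mh E = 0%E -> mu E = 0%E.
Proof.
move=> [N [mN N0 hN]] mE nuE.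
have mh'E := mh' mE.
have : ae_eq mu E (fun x => `|h x|%:E) (cst 0%E).
  by apply/ae_eq_integral_abs => //=; under eq_integral do rewrite normr_id.
move=> [M [mM M0 hM]].
apply/eqP; rewrite -measure_le0.
have <- : mu (N `|` M) = 0%E by rewrite null_set_setU.
apply: le_measure; rewrite ?inE//; first exact: measurableU.
move=> x Ex; have [hx|hx] := eqVneq (h x) 0.
  by left; apply: hN => /= /eqP; exact.
by right; apply: hM => /= /(_ Ex) -[] /eqP; rewrite normr_eq0 (negbTE hx).
Qed.

End Density.

(** * Geometry of bounded spaces of homogeneous type *)

Section Geometry.
Context {R : realType} {disp : measure_display} {T : measurableType disp}.
Variables (mu : {measure set T -> \bar R}) (d : T -> T -> R).
Implicit Types (x y : T) (r : R).

(** The quasi-triangle inequality and the doubling condition enter the proof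
    through one dilation factor [L], chosen once for all so large that
    [L]-dilates of balls engulf the comparable balls that they meet. *)
Record dilation_structure (L A Delta : R) : Prop := DilationStructure {
  ds_refl : forall x : T, d x x = 0 ;
  ds_L : 2 <= L ;
  ds_A : 1 <= A ;
  ds_Delta : 0 < Delta ;
  ds_measurable : forall (x : T) (r : R), 0 < r -> measurable (qball d x r) ;
  ds_gt0 : forall (x : T) (r : R), 0 < r -> (0 < mu (qball d x r))%E ;
  ds_finite : finite_total mu ;
  ds_engulf : forall (x y : T) (r r' : R), 0 < r -> 0 < r' ->
    qball d x r `&` qball d y r' !=set0 -> r <= 2 * r' ->
    qball d x r `<=` qball d y (L * r') ;
  ds_doubling : forall (x : T) (r : R), 0 < r ->
    fmeas mu (qball d x (L * r)) <= A * fmeas mu (qball d x r) ;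
  ds_diameter : forall (x : T) (r : R), Delta <= r -> qball d x r = setT }.

Lemma doubling_pow (D : R) n x r : 0 <= D ->
  (forall x r, 0 < r -> (mu (qball d x (2 * r)) <= D%:E * mu (qball d x r))%E) ->
  0 < r -> (mu (qball d x (2 ^+ n * r)) <= (D ^+ n)%:E * mu (qball d x r))%E.
Proof.
move=> D0 dbl r0; elim: n => [|n IH]; first by rewrite !expr0 mul1r mul1e.
rewrite exprS -mulrA; apply: le_trans (dbl _ _ _) _.
  by rewrite mulr_gt0// exprn_gt0.
by rewrite exprS EFinM -muleA lee_wpmul2l// lee_fin.
Qed.

Lemma pow2_ge (x : R) : exists n, x <= 2 ^+ n.
Proof.
by exists (Num.bound x); apply/ltW/upper_nthrootP.
Qed.

(** Density of the continuous functions forces the measure of the space to be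
    finite: a continuous integrable function close to [w] is not zero, hence
    is bounded below on some ball, and that ball has finite measure. *)
Lemma homogeneous_finite (D : R) x0 (R0 : R) (w : T -> R) :
  homogeneous_type mu d -> 0 <= D ->
  (forall x r, 0 < r -> (mu (qball d x (2 * r)) <= D%:E * mu (qball d x r))%E) ->
  0 < R0 -> (forall x y, d x y < R0) ->
  mu.-integrable setT (EFin \o w) -> {ae mu, forall x, 0 < w x} ->
  qball d x0 R0 = setT -> finite_total mu.
Proof.
move=> [_ mB B0 _ dense] D0 dbl R00 diam iw w0 bT.
have mw : measurable_fun setT w by apply/measurable_EFinP; exact: measurable_int iw.
pose e := fine (\int[mu]_x `|(w x)%:E|)%E.
have efin : (\int[mu]_x `|(w x)%:E|)%E = e%:E.
  rewrite /e fineK// ge0_fin_numE; first by case/integrableP: iw.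
  by apply: integral_ge0 => x _; exact: abse_ge0.
have e0 : 0 < e.
  rewrite lt0r; apply/andP; split; last first.
    by rewrite /e fine_ge0//; apply: integral_ge0 => x _; exact: abse_ge0.
  apply/eqP => ee; have := B0 x0 R0 R00; rewrite bT.
  rewrite (@density_measure_eq0 _ _ _ mu w mw setT) ?ltxx//.
    by apply: filterS w0 => x wx; rewrite gt_eqF.
  by rewrite /density_measure efin ee.
have [g [cg ig hg]] := dense w iw e e0.
have mg : measurable_fun setT g by apply/measurable_EFinP; exact: measurable_int ig.
have mag : measurable_fun setT (fun x => `|(g x)%:E|%E).
  by apply: measurableT_comp => //; exact/measurable_EFinP.
have [x gx] : exists x, g x != 0.
  apply/not_existsP => g0.
  suff : (e%:E < e%:E)%E by rewrite ltxx.
  rewrite -{1}efin [ltLHS](_ : _ = \int[mu]_x `|w x - g x|%:E)%E//.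
  apply: eq_integral => x _ /=.
  by have /negP/negPn/eqP -> := g0 x; rewrite subr0.
have gx0 : 0 < `|g x| / 2 by rewrite divr_gt0// normr_gt0.
have [r r0 hr] := cg x _ gx0.
have Bfin : (mu (qball d x r) < +oo)%E.
  have le1 : ((`|g x| / 2)%:E * mu (qball d x r) <= \int[mu]_y `|(g y)%:E|)%E.
    rewrite -integral_cst; last exact: mB.
    apply: (@le_trans _ _ (\int[mu]_(y in qball d x r) `|(g y)%:E|)%E).
      apply: ge0_le_integral => //.
      - exact: mB.
      - by move=> y _; rewrite /= lee_fin ltW.
      - exact: measurable_funTS mag.
      - move=> y By; rewrite /= lee_fin; have := hr y By.
        have : `|g x| <= `|g x - g y| + `|g y|.
          by rewrite -{1}(subrK (g y) (g x)); exact: ler_normD.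
        by move=> *; lra.
    by apply: ge0_subset_integral => //; exact: mB.
  have lt1 : ((`|g x| / 2)%:E * mu (qball d x r) < +oo)%E.
    by apply: le_lt_trans le1 _; case/integrableP: ig.
  rewrite ltey; apply/negP => /eqP Bo; move: lt1.
  by rewrite Bo gt0_muley ?ltxx// lte_fin.
have [n hn] := pow2_ge (R0 / r).
have XE : qball d x (2 ^+ n * r) = setT.
  apply/seteqP; split=> // y _; rewrite /qball/=.
  by apply: lt_le_trans (diam x y) _; rewrite -ler_pdivrMr.
rewrite /finite_total -XE; apply: le_lt_trans (doubling_pow n x D0 dbl r0) _.
rewrite lte_mul_pinfty//; rewrite lee_fin; exact: exprn_ge0.
Qed.

Lemma homogeneous_dilation (w : T -> R) :
  homogeneous_type mu d -> qbounded d ->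
  mu.-integrable setT (EFin \o w) -> {ae mu, forall x, 0 < w x} ->
  exists L A Delta, dilation_structure L A Delta.
Proof.
move=> hX [x0 [R0 [R00 bX]]] iw w0; have [[d0 dE dC [k0 k00 k0P]] mB B0 dbl dense] := hX.
pose k := Num.max k0 1.
have k1 : 1 <= k by rewrite le_max lexx orbT.
have kP x y z : d x y <= k * (d x z + d z y).
  apply: le_trans (k0P x y z) _; rewrite ler_wpM2r ?addr_ge0//.
  by rewrite le_max lexx.
have [D0 D0P] := dbl; pose D := Num.max D0 1.
have D1 : 1 <= D by rewrite le_max lexx orbT.
have DP x r : 0 < r -> (mu (qball d x (2 * r)) <= D%:E * mu (qball d x r))%E.
  move=> r0; apply: le_trans (D0P x r r0) _; apply: lee_wpmul2r => //.
  by rewrite lee_fin le_max lexx.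
pose Delta := k * (R0 + R0).
have diam x y : d x y < Delta.
  apply: le_lt_trans (kP x y x0) _; rewrite ltr_pM2l; last lra.
  by rewrite dC; apply: ltrD; apply: bX.
have Delta0 : 0 < Delta by rewrite mulr_gt0//; lra.
have BT x r : Delta <= r -> qball d x r = setT.
  by move=> rD; apply/seteqP; split=> // y _; exact: lt_le_trans rD.
have fmu : finite_total mu.
  apply: (@homogeneous_finite D x0 Delta w hX) => //; last exact: BT.
  by lra.
have [n hn] := pow2_ge (5 * k ^+ 2).
have k2 : 1 <= k ^+ 2 by rewrite exprn_ege1.
exists (2 ^+ n), (D ^+ n), Delta; split => //.
- by move=> x; apply/dE.
- by lra.
- by rewrite exprn_ege1.
- move=> x y r r' r0 r'0 [z [xz yz]] rr u xu; rewrite /qball/= in xz yz xu *.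
  apply: (@lt_le_trans _ _ (5 * k ^+ 2 * r')); last by rewrite ler_pM2r.
  apply: le_lt_trans (kP y u z) _.
  have h1 : d z u < k * (2 * r).
    apply: le_lt_trans (kP z u x) _; rewrite ltr_pM2l; last lra.
    by rewrite (dC z); lra.
  have h2 : k * (d y z + d z u) < k * (r' + k * (4 * r')).
    rewrite ltr_pM2l; last lra.
    by apply: ltrD => //; apply: lt_le_trans h1 _; rewrite ler_pM2l; lra.
  apply: lt_le_trans h2 _; rewrite mulrDr mulrA -expr2.
  have : k * r' <= k ^+ 2 * r' by rewrite ler_pM2r// expr2 ler_peMl//; lra.
  by move=> ?; lra.
- move=> x r r0; have mLB : measurable (qball d x (2 ^+ n * r)).
    by apply: mB; rewrite mulr_gt0// exprn_gt0.
  rewrite -lee_fin EFinM -!fmeasE//; last exact: mB.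
  by apply: doubling_pow => //; lra.
Qed.

End Geometry.

(** * Vitali covering and density points *)

Section Vitali.
Context {R : realType} {disp : measure_display} {T : measurableType disp}.
Variables (mu : {measure set T -> \bar R}) (d : T -> T -> R) (L A Delta : R).
Variable x0 : T.
Implicit Types (x y : T) (r t e : R).
Hypothesis H : dilation_structure mu d L A Delta.

Local Notation ball := (qball d).
Local Notation m := (fmeas mu).

Lemma ds_L0 : 0 < L.
Proof. by have := ds_L H; lra. Qed.

Lemma ds_A0 : 0 < A.
Proof. by have := ds_A H; lra. Qed.

Lemma ball_center x r : 0 < r -> ball x r x.
Proof. by move=> r0; rewrite /qball/= (ds_refl H). Qed.

Lemma le_ball x r r' : r <= r' -> ball x r `<=` ball x r'.
Proof. by move=> rr y; rewrite /qball/= => /lt_le_trans; apply. Qed.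

Lemma ball_dilate x r : 0 < r -> ball x r `<=` ball x (L * r).
Proof. by move=> r0; apply: le_ball; have := ds_L H => ?; nra. Qed.

Lemma measurable_dilate x r : 0 < r -> measurable (ball x (L * r)).
Proof. by move=> r0; apply: (ds_measurable H); rewrite mulr_gt0// ds_L0. Qed.

Lemma ball_gt0 x r : 0 < r -> 0 < m (ball x r).
Proof.
move=> r0; apply: fmeas_gt0; [exact: ds_finite H|exact: (ds_measurable H)|].
exact: (ds_gt0 H).
Qed.

Lemma dilate_pow x r n : 0 < r -> m (ball x (L ^+ n * r)) <= A ^+ n * m (ball x r).
Proof.
move=> r0; elim: n => [|n IH]; first by rewrite !expr0 !mul1r.
rewrite exprS -mulrA; apply: le_trans (ds_doubling H _ _) _.
  by rewrite mulr_gt0// exprn_gt0// ds_L0.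
by rewrite exprS -mulrA ler_pM2l// ds_A0.
Qed.

Lemma ball_lower_bound r : 0 < r ->
  exists2 c, 0 < c & forall x r', r <= r' -> c <= m (ball x r').
Proof.
move=> r0; have [n hn] := pow2_ge (Delta / r).
have An0 : 0 < A ^+ n by rewrite exprn_gt0// ds_A0.
exists (m setT / A ^+ n).
  by rewrite divr_gt0// -(ds_diameter H x0 (lexx Delta)) ball_gt0// (ds_Delta H).
move=> x r' rr'.
rewrite ler_pdivrMr// mulrC.
have r'0 : 0 < r' by exact: lt_le_trans rr'.
apply: le_trans (dilate_pow x n r'0).
rewrite (@ds_diameter _ _ _ _ _ _ _ _ H x (L ^+ n * r')) //.
rewrite -(@ler_pM2r _ r^-1) ?invr_gt0//.
apply: le_trans hn _; apply: (@le_trans _ _ (L ^+ n)).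
  by apply: lerXn2r; rewrite ?nnegrE//; have := ds_L H; lra.
by rewrite -mulrA ler_peMr ?exprn_ge0 ?(ltW ds_L0)// ler_pdivlMr// mul1r.
Qed.

(** Greedy selection: each selected ball is disjoint from the previous ones
    and its radius is at least half of every radius still available. The radii
    of infinitely many disjoint balls cannot stay bounded below, since the
    space has finite measure; so every ball of the family meets a selected one
    of at least half its radius, and is engulfed by its dilate. *)
Lemma vitali_covering (P : T -> R -> Prop) :
  (forall x r, P x r -> 0 < r <= Delta) ->
  exists (c : nat -> T) (rho : nat -> R) (D : set nat),
    [/\ forall i, D i -> P (c i) (rho i),
        trivIset D (fun i => ball (c i) (rho i)) &
        forall x r, P x r ->
          exists2 i, D i & ball x r `<=` ball (c i) (L * rho i)].
Proof.
move=> P0.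
pose avail (l : seq (T * R)) (b : T * R) := P b.1 b.2 /\
  forall c, c \in l -> ball b.1 b.2 `&` ball c.1 c.2 = set0.
have /choice[pick pickP] l : exists o : option (T * R),
    if o is Some b then avail l b /\ forall b', avail l b' -> b'.2 <= 2 * b.2
    else forall b, ~ avail l b.
  have [[b0 b0P]|no] := pselect (exists b, avail l b); last first.
    by exists None => b bl; apply: no; exists b.
  pose S := [set b.2 | b in avail l].
  have S0 : S !=set0 by exists b0.2, b0.
  have SD : has_sup S by split=> //; exists Delta => _ [b [/P0/andP[]] _ ? _ <-].
  have b00 : 0 < b0.2 by have [/P0/andP[]] := b0P.
  have bS b : avail l b -> b.2 <= sup S by move=> bl; apply: sup_upper_bound => //; exists b.
  have S2 : 0 < sup S / 2 by have := bS _ b0P; lra.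
  have [_ [b bl <-] hb] := sup_adherent S2 SD.
  by exists (Some b); split=> // b' /bS; lra.
pose sel n := iter n (fun l => if pick l is Some b then b :: l else l) [::].
pose D := [set n | pick (sel n)].
pose b n := odflt (x0, 0) (pick (sel n)).
have Dav n b' : avail (sel n) b' -> D n.
  by have := pickP (sel n); rewrite /D/=; case: (pick (sel n)) => //= h /h.
have bE n : D n -> pick (sel n) = Some (b n) by rewrite /D/= /b; case: (pick _).
have selS n : D n -> sel n.+1 = b n :: sel n by move=> /bE e; rewrite /sel iterS -/(sel n) e.
have sub n k : (n <= k)%N -> {subset sel n <= sel k}.
  elim: k => [|k IH]; first by rewrite leqn0 => /eqP ->.
  rewrite leq_eqVlt ltnS => /predU1P[->//|nk c cn].
  rewrite /sel iterS -/(sel k); case: (pick _) => [b'|]; last exact: IH.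
  by rewrite inE; apply/orP; right; exact: IH.
have bavail n : D n -> avail (sel n) (b n).
  by move=> /bE e; have := pickP (sel n); rewrite e => -[].
have bmax n b' : D n -> avail (sel n) b' -> b'.2 <= 2 * (b n).2.
  by move=> /bE e; have := pickP (sel n); rewrite e => -[_]; exact.
have disj : trivIset D (fun i => ball (b i).1 (b i).2).
  apply/trivIsetP => i j.
  wlog ij : i j / (i < j)%N => [hw Di Dj ij|].
    have [lij|lji|e] := ltngtP i j; [exact: hw| |by rewrite e eqxx in ij].
    by rewrite setIC; apply: hw => //; rewrite eq_sym.
  move=> Di Dj _; rewrite setIC; have [_] := bavail j Dj; apply.
  by apply: (sub i.+1 j ij); rewrite selS// inE eqxx.
exists (fun n => (b n).1), (fun n => (b n).2), D; split => //.
  by move=> i Di; have [] := bavail i Di.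
move=> x r Pxr; have /andP[r0 _] := P0 _ _ Pxr.
have [nall|[n nav]] : (forall n, avail (sel n) (x, r)) \/
    exists n, ~ avail (sel n) (x, r).
- by have [|/existsNP] := pselect (forall n, avail (sel n) (x, r)); [left|right].
- exfalso.
  have DT n : D n by exact: Dav (nall n).
  have r2 : 0 < r / 2 by lra.
  have [c c0 hc] := ball_lower_bound r2.
  have bc n : c <= m (ball (b n).1 (b n).2).
    by apply: hc; have := bmax n _ (DT n) (nall n); rewrite /=; lra.
  have b0 n : 0 < (b n).2.
    by have [/P0/andP[]] := bavail n (DT n).
  have mb n : measurable (ball (b n).1 (b n).2) by exact: (ds_measurable H).
  have key n : n%:R * c <= m setT.
    rewrite -lee_fin -fmeasE//; last exact: (ds_finite H).
    apply: (@le_trans _ _ (mu (\bigcup_i ball (b i).1 (b i).2))); last first.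
      by apply: le_measure; rewrite ?inE//; exact: bigcup_measurable.
    rewrite measure_bigcup//; last first.
      by apply: sub_trivIset disj => k _; exact: DT.
    apply: le_trans (nneseries_lim_ge n _); last by [].
    apply: (@le_trans _ _ (\sum_(0 <= k < n) c%:E)%E).
      by rewrite sumEFin sumr_const_nat subn0 mulr_natl.
    rewrite [leRHS](eq_bigl xpredT); last by move=> k; rewrite in_setT.
    by apply: lee_sum => k _; rewrite fmeasE ?lee_fin//; exact: (ds_finite H).
  have : m setT / c < (Num.bound (m setT / c))%:R.
    by apply: archi_boundP; rewrite divr_ge0 ?fmeas_ge0// ltW.
  by rewrite ltr_pdivrMr// ltNge key.
- have : exists n, ~~ `[< avail (sel n) (x, r) >] by exists n; apply/asboolPn.
  move=> /ex_minnP[[|k] /asboolPn nk kmin].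
    by exfalso; apply: nk; split.
  have kav : avail (sel k) (x, r).
    by apply/asboolP/negPn/negP => /kmin; rewrite ltnn.
  have Dk : D k by exact: Dav kav.
  have meet : ball x r `&` ball (b k).1 (b k).2 !=set0.
    apply/set0P/eqP => e; apply: nk; split=> // c.
    by rewrite selS// inE => /predU1P[->//|]; have [_] := kav; exact.
  exists k => //; apply: (ds_engulf H) => //.
    by have [/P0/andP[]] := bavail k Dk.
  exact: (bmax k _ Dk kav).
Qed.

End Vitali.

Section DensityPoints.
Context {R : realType} {disp : measure_display} {T : measurableType disp}.
Variables (mu : {measure set T -> \bar R}) (d : T -> T -> R) (L A Delta : R).
Variable x0 : T.
Implicit Types (x y : T) (r t e : R).
Hypothesis H : dilation_structure mu d L A Delta.

Local Notation ball := (qball d).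
Local Notation m := (fmeas mu).

(** The part of Lebesgue's differentiation theorem that is needed. Let [g] be
    continuous and close to the indicator of [E] in mean. At a point of [Z]
    where [g] is near 1, half of a small ball lies outside [E] where [g] is
    still near 1, so the mean of the difference over this ball is at least
    some constant; such balls, as well as the points where [g] is not near 1,
    fill little measure. *)
Lemma density_points_null (E Z : set T) :
  continuous_dense_L1 mu d -> measurable E -> measurable Z -> Z `<=` E ->
  (forall x r, Z x -> 0 < r -> m (E `&` ball x r) <= 2^-1 * m (ball x r)) ->
  m Z = 0.
Proof.
move=> dense mE mZ ZE sparse; have fmu := ds_finite H; have A0 := ds_A0 H.
suff small e : 0 < e -> m Z <= (4 + 4 * A) * e.
  apply/eqP; rewrite eq_le fmeas_ge0 andbT; apply/ler_addgt0Pl => e e0.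
  rewrite addr0; have C0 : 0 < 4 + 4 * A by lra.
  rewrite [leRHS](_ : _ = (4 + 4 * A) * (e / (4 + 4 * A))).
    by apply: small; rewrite divr_gt0.
  by field; rewrite gt_eqF.
move=> e0.
have iE : mu.-integrable setT (EFin \o (\1_E : T -> R)).
  apply/integrableP; split; first exact/measurable_EFinP.
  rewrite (eq_integral (fun x => (\1_E x)%:E)); last first.
    by move=> x _ /=; rewrite ger0_norm.
  by rewrite integral_indic// setIT finite_total_lt.
have [g [cg ig hg]] := dense _ iE e e0.
have mg : measurable_fun setT g by apply/measurable_EFinP; exact: measurable_int ig.
have mh : measurable_fun setT (fun x => \1_E x - g x) by exact: measurable_funB.
pose nu := density_measure mu mh.
have nue : (nu setT < e%:E)%E by [].
have fnu : finite_total nu by apply: lt_trans nue _; rewrite ltry.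
have nue' : fmeas nu setT <= e by rewrite -lee_fin -fmeasE// ltW.
pose V := [set x | 4^-1 <= `|\1_E x - g x|].
have mV : measurable V.
  rewrite (_ : V = (fun x => `|\1_E x - g x|) @^-1` `[4^-1, +oo[).
    by rewrite -[X in measurable X]setTI; apply: measurableT_comp.
  by apply/seteqP; split=> x; rewrite /V/= in_itv/= andbT.
have mVe : m V <= 4 * e.
  have : 4^-1 * m V <= fmeas nu V.
    by rewrite -lee_fin EFinM -!fmeasE//; exact: density_measure_ge.
  have : fmeas nu V <= fmeas nu setT by apply: le_fmeas.
  by move=> ? ?; lra.
pose P x r := [/\ 0 < r <= Delta & m (ball x r) <= 4 * fmeas nu (ball x r)].
have [|c [rho [D [PD tD cD]]]] := vitali_covering x0 H (P := P); first by move=> x r [].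
have rho0 i : D i -> 0 < rho i by move=> /PD[/andP[]].
pose G := \bigcup_(i in D) ball (c i) (L * rho i).
have mG : measurable G.
  by apply: bigcup_measurable => i Di; apply: (measurable_dilate H); exact: rho0.
have mGe : m G <= 4 * A * fmeas nu setT.
  apply: (@le_fmeas_bigcup _ _ _ _ _ _ _ (fun i => ball (c i) (rho i))) => //.
  - by lra.
  - by move=> i Di; apply: (ds_measurable H); exact: rho0.
  - by move=> i Di; apply: (measurable_dilate H); exact: rho0.
  - move=> i Di; rewrite setTI; have [_ h] := PD i Di.
    apply: le_trans (ds_doubling H _ (rho0 i Di)) _.
    by rewrite (mulrC 4) -mulrA ler_pM2l.
have ZG : Z `\` V `<=` G.
  move=> x [Zx] /negP; rewrite -ltNge => hx.
  have [|r r0 hr] := cg x 8^-1; first by [].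
  have rD0 : 0 < Num.min r Delta by rewrite lt_min r0 (ds_Delta H).
  pose q := Num.min r Delta.
  have mB : measurable (ball x q) by exact: (ds_measurable H).
  have mBE : measurable (ball x q `\` E) by exact: measurableD.
  have [|i Di sub] := cD x q; last by exists i => //; apply: sub; exact: (ball_center H).
  split; first by rewrite rD0 ge_min lexx orbT.
  have h1 : 2^-1 * m (ball x q) <= m (ball x q `\` E).
    by have := sparse x q Zx rD0; have := fmeasDI fmu mB mE; rewrite (setIC E); lra.
  have h2 : 2^-1 * m (ball x q `\` E) <= fmeas nu (ball x q `\` E).
    rewrite -lee_fin EFinM -!fmeasE//; apply: density_measure_ge => // y [By Ey].
    have := hr y (lt_le_trans By _); rewrite ge_min lexx => /(_ isT).
    move: hx; rewrite !indicE (mem_set (ZE x Zx)) memNset//= sub0r normrN => h3 h4.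
    have := ler_norm (1 - g x); have := ler_norm (g x - g y); have := ler_norm (g y).
    by lra.
  have := le_fmeas fnu mBE mB (@subDsetl _ _ _).
  by have := h1; have := h2; lra.
have mZV := measurableD mZ mV; have mIV := measurableI _ _ mZ mV.
have := fmeasDI fmu mZ mV.
have := le_fmeas fmu mIV mV (@subIsetr _ _ _).
have := le_fmeas fmu mZV mG ZG.
have : 4 * A * fmeas nu setT <= 4 * A * e by rewrite ler_pM2l//; lra.
by move=> ? ? ? ->; lra.
Qed.

End DensityPoints.

(** * Level sets of the density of a set in balls *)

Section LevelSets.
Context {R : realType} {disp : measure_display} {T : measurableType disp}.
Variables (mu : {measure set T -> \bar R}) (d : T -> T -> R) (L A Delta : R).
Variable x0 : T.
Hypothesis H : dilation_structure mu d L A Delta.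
Hypothesis dense : continuous_dense_L1 mu d.
Implicit Types (x y : T) (r t rho : R) (E W : set T).

Local Notation ball := (qball d).
Local Notation m := (fmeas mu).

Definition denser E t x r := t * m (ball x r) < m (E `&` ball x r).

(** Up to the factor [L], [r] is the largest radius of a ball around [x] in
    which the density of [E] exceeds [t]. *)
Definition stopping E t x r :=
  [/\ 0 < r, denser E t x r & forall r', L * r <= r' -> ~ denser E t x r'].

Record ball_family :=
  BallFamily { centre : nat -> T ; radius : nat -> R ; index : set nat }.

Implicit Types F : ball_family.

Definition family_ball F i := ball (centre F i) (radius F i).

Definition dilated_ball F i := ball (centre F i) (L * radius F i).

Definition dilated_union F := \bigcup_(i in index F) dilated_ball F i.

(** The union of the dilated balls of a level family is, up to constants,
    the set where the maximal function of the indicator of [E] exceeds [t]. *)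
Definition level_family E t F :=
  [/\ forall i, index F i -> stopping E t (centre F i) (radius F i),
      trivIset (index F) (family_ball F) &
      forall x r, 0 < r -> denser E t x r -> dilated_union F x].

Let fmu := ds_finite H.
Let A0 := ds_A0 H.
Let L0 := ds_L0 H.

Let mB x r : 0 < r -> measurable (ball x r).
Proof. exact: (ds_measurable H). Qed.

Let mLB x r : 0 < r -> measurable (ball x (L * r)).
Proof. exact: (measurable_dilate H). Qed.

Let mLLB x r : 0 < r -> measurable (ball x (L * (L * r))).
Proof. by move=> r0; apply: mLB; rewrite mulr_gt0. Qed.

Lemma dilate2 x r : 0 < r -> m (ball x (L * (L * r))) <= A ^+ 2 * m (ball x r).
Proof. by move=> r0; have := dilate_pow H x 2 r0; rewrite expr2 mulrA. Qed.

(** Two balls of the same radius whose dilates meet have comparable measures. *)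
Lemma dilate3 x y r : 0 < r -> ball x (L * r) `&` ball y (L * r) !=set0 ->
  m (ball y (L * (L * r))) <= A ^+ 3 * m (ball x r).
Proof.
move=> r0 meet; have Lr0 : 0 < L * r by rewrite mulr_gt0.
apply: le_trans (ds_doubling H _ Lr0) _.
rewrite exprS -mulrA ler_pM2l//; apply: le_trans (dilate2 x r0).
apply: le_fmeas => //; [exact: mLB|exact: mLLB|].
by apply: (ds_engulf H) => //; [rewrite setIC|lra].
Qed.

Lemma denser_radius E t x r : m E <= t * m setT -> denser E t x r -> r < Delta.
Proof.
move=> Et; rewrite /denser; case: (ltP r Delta) => // rD.
by rewrite (ds_diameter H x rD) setIT ltNge Et.
Qed.

Lemma stopping_exists E t x r : m E <= t * m setT -> 0 < r -> denser E t x r ->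
  exists rho, stopping E t x rho.
Proof.
move=> Et r0 hr; pose S := [set r' | 0 < r' /\ denser E t x r'].
have SD : has_sup S.
  split; first by exists r.
  by exists Delta => r' [_ /(denser_radius Et)/ltW].
have rS r' : S r' -> r' <= sup S by move=> ?; exact: sup_upper_bound.
have S2 : 0 < sup S / 2 by have := rS r (conj r0 hr); lra.
have [rho [rho0 hrho] ltrho] := sup_adherent S2 SD.
exists rho; split => // r' rr' hr'.
have := rS r' (conj _ hr'); have := ds_L H; have L2 := ds_L H.
have : 2 * rho <= L * rho by rewrite ler_pM2r.
move=> h1 _ h2; have : r' <= sup S by apply: h2; lra.
by lra.
Qed.

Lemma level_family_exists E t : m E <= t * m setT ->
  exists F, level_family E t F.
Proof.
move=> Et; have [|c [rho [D [DP tD DU]]]] := vitali_covering x0 H (P := stopping E t).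
  by move=> x r [r0 /(denser_radius Et)/ltW -> _]; rewrite r0.
exists (BallFamily c rho D); split => // x r r0 /(stopping_exists Et r0)[s sP].
have [i Di sub] := DU x s sP; exists i => //; apply: sub.
by apply: (ball_center H); have [] := sP.
Qed.

Lemma level_family_gt0 E t F i : level_family E t F -> index F i -> 0 < radius F i.
Proof. by move=> [h _ _] /h[]. Qed.

Lemma measurable_dilated_bigcup E t F (K : set nat) : level_family E t F ->
  K `<=` index F -> measurable (\bigcup_(i in K) dilated_ball F i).
Proof.
move=> lF KF; apply: bigcup_measurable => i Ki; apply: mLB.
by apply: level_family_gt0 lF _; exact: KF.
Qed.

Lemma measurable_dilated_union E t F : level_family E t F ->
  measurable (dilated_union F).
Proof. by move=> lF; exact: measurable_dilated_bigcup lF _. Qed.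

(** Weak type (1,1) estimate for the maximal function, localized to [W]. *)
Lemma level_weak_type E t F (K : set nat) W : measurable E -> measurable W -> 0 < t ->
  level_family E t F -> K `<=` index F ->
  (forall i, K i -> family_ball F i `<=` W) ->
  t * m (\bigcup_(i in K) dilated_ball F i) <= A * m (E `&` W).
Proof.
move=> mE mW t0 lF KF KW; have [sF tF _] := lF.
have r0 i : K i -> 0 < radius F i by move=> /KF; exact: (level_family_gt0 lF).
rewrite -ler_pdivlMl// mulrCA mulrA.
apply: (@le_fmeas_bigcup _ _ _ _ _ _ _ (family_ball F)) => //.
- by rewrite divr_ge0 ?ltW.
- exact: measurableI.
- by move=> i Ki; apply: mB; exact: r0.
- by move=> i Ki; apply: mLB; exact: r0.
- exact: sub_trivIset tF.
move=> i Ki; apply: le_trans (ds_doubling H _ (r0 i Ki)) _.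
rewrite -setIA (_ : W `&` _ = family_ball F i); last exact/setIidPr/KW.
by rewrite -mulrA ler_pM2l// ler_pdivlMl//; have [_ /ltW] := sF i (KF i Ki).
Qed.

(** Reverse weak type estimate: by maximality the density of [E] is at most [t]
    in the dilate of a stopping ball. *)
Lemma level_reverse_weak_type E t F (K : set nat) W : measurable E -> measurable W -> 0 < t ->
  level_family E t F -> K `<=` index F ->
  (forall i, K i -> family_ball F i `<=` W) ->
  m (E `&` \bigcup_(i in K) dilated_ball F i) <= A * t * m W.
Proof.
move=> mE mW t0 lF KF KW; have [sF tF _] := lF.
have r0 i : K i -> 0 < radius F i by move=> /KF; exact: (level_family_gt0 lF).
rewrite setI_bigcupr.
apply: (@le_fmeas_bigcup _ _ _ _ _ _ _ (family_ball F)) => //.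
- by rewrite mulr_ge0 ?ltW.
- by move=> i Ki; apply: mB; exact: r0.
- by move=> i Ki; apply: measurableI => //; apply: mLB; exact: r0.
- exact: sub_trivIset tF.
move=> i Ki; rewrite (_ : W `&` _ = family_ball F i); last exact/setIidPr/KW.
have [_ _ /(_ _ (lexx _))/negP] := sF i (KF i Ki).
rewrite -leNgt => /le_trans; apply.
by rewrite (mulrC A) -mulrA ler_pM2l//; apply: (ds_doubling H); exact: r0.
Qed.

Lemma level_covers E t F : measurable E -> t <= 2^-1 -> level_family E t F ->
  m (E `\` dilated_union F) = 0.
Proof.
move=> mE t2 lF; have mU := measurable_dilated_union lF.
apply: (@density_points_null _ _ _ _ _ _ _ _ x0 H E) => //.
- exact: measurableD.
- move=> x r [Ex nU] r0; have [_ _ lU] := lF.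
  apply: (@le_trans _ _ (t * m (ball x r))); last by rewrite ler_wpM2r ?fmeas_ge0.
  by rewrite leNgt; apply/negP => /(lU _ _ r0).
Qed.

(** Enlarging a stopping ball so as to centre it at a point of its dilate costs
    a factor [A ^ 3] in density. *)
Lemma level_nested E t t' F F' : measurable E -> 0 < t -> A ^+ 3 * t <= t' ->
  level_family E t F -> level_family E t' F' ->
  dilated_union F' `<=` dilated_union F.
Proof.
move=> mE t0 tt' [_ _ lU] lF' y [i Di yi]; have [sF' _ _] := lF'.
have r0 := level_family_gt0 lF' Di; have [_ dn _] := sF' i Di.
set r := radius F' i in r0 dn yi; set x := centre F' i in dn yi.
have Lr0 : 0 < L * r by rewrite mulr_gt0.
have meet : ball x (L * r) `&` ball y (L * r) !=set0.
  by exists y; split => //; exact: (ball_center H).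
apply: (lU y (L * (L * r))); first by rewrite mulr_gt0.
apply: (@le_lt_trans _ _ (t' * m (ball x r))).
  apply: (@le_trans _ _ (A ^+ 3 * t * m (ball x r))).
    by rewrite (mulrC _ t) -mulrA ler_pM2l//; exact: dilate3.
  by rewrite ler_wpM2r ?fmeas_ge0.
apply: lt_le_trans dn _; apply: le_fmeas => //.
- by apply: measurableI => //; exact: mB.
- by apply: measurableI => //; exact: mLLB.
apply: setIS; apply: (subset_trans (ball_dilate H r0)).
by apply: (ds_engulf H) => //; lra.
Qed.

(** A stopping ball at a much higher level whose dilate meets a stopping ball
    at level [t] cannot be larger: otherwise it would make [E] too dense in a
    dilate of the latter. *)
Lemma stopping_radius E t t' x x' rho rho' : measurable E -> 0 < t ->
  A ^+ 3 * t <= t' -> stopping E t x rho -> stopping E t' x' rho' ->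
  ball x' (L * rho') `&` ball x rho !=set0 -> rho' <= rho.
Proof.
move=> mE t0 tt' [r0 _ st] [r'0 dn _] [z [zx' zx]].
rewrite leNgt; apply/negP => lt.
have Lr0 : 0 < L * rho' by rewrite mulr_gt0.
have L2 := ds_L H.
have meet : ball x' (L * rho') `&` ball x (L * rho') !=set0.
  exists z; split => //; apply: le_ball zx.
  by apply: le_trans (ltW lt) _; rewrite ler_peMl//; lra.
have [] := st (L * (L * rho')).
  by rewrite ler_pM2l//; apply: le_trans (ltW lt) _; rewrite ler_peMl//; lra.
apply: (@le_lt_trans _ _ (t' * m (ball x' rho'))).
  apply: (@le_trans _ _ (A ^+ 3 * t * m (ball x' rho'))).
    by rewrite (mulrC _ t) -mulrA ler_pM2l//; exact: dilate3.
  by rewrite ler_wpM2r ?fmeas_ge0.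
apply: lt_le_trans dn _; apply: le_fmeas => //.
- by apply: measurableI => //; exact: mB.
- by apply: measurableI => //; exact: mLLB.
apply: setIS; apply: (subset_trans (ball_dilate H r'0)).
by apply: (ds_engulf H) => //; lra.
Qed.

Lemma stopping_engulf E t t' F' x rho i : measurable E -> 0 < t ->
  A ^+ 3 * t <= t' -> stopping E t x rho -> level_family E t' F' ->
  index F' i -> dilated_ball F' i `&` ball x rho !=set0 ->
  dilated_ball F' i `<=` ball x (L * (L * rho)).
Proof.
move=> mE t0 tt' st lF' Di meet; have [sF' _ _] := lF'.
have r0 := level_family_gt0 lF' Di; have [rho0 _ _] := st.
have le := stopping_radius mE t0 tt' st (sF' i Di) meet.
apply: (ds_engulf H); rewrite ?mulr_gt0//.
  by have [z [z1 z2]] := meet; exists z; split => //; exact: (ball_dilate H).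
have : L * radius F' i <= L * rho by rewrite ler_pM2l.
have : 0 < L * rho by rewrite mulr_gt0.
by lra.
Qed.

(** The stopping balls of level [t'] near the given ball stay inside a dilate
    of it, where the density of [E] is at most [t], much less than [t']: by the
    weak type estimate they fill little of it. *)
Lemma stopping_sparse E t t' F' x rho : measurable E -> 0 < t ->
  2 * A ^+ 3 * t <= t' -> stopping E t x rho -> level_family E t' F' ->
  m (dilated_union F' `&` ball x rho) <= 2^-1 * m (ball x rho).
Proof.
move=> mE t0 tt' st lF'; have [rho0 _ nd] := st.
have A30 : 0 < A ^+ 3 by rewrite exprn_gt0.
have A3t : 0 < A ^+ 3 * t by rewrite mulr_gt0.
have tt'1 : A ^+ 3 * t <= t' by move: tt'; rewrite -mulrA; lra.
have t'0 : 0 < t' by lra.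
pose K := [set i | index F' i /\ dilated_ball F' i `&` ball x rho !=set0].
have KF : K `<=` index F' by move=> i [].
have mK := measurable_dilated_bigcup lF' KF.
apply: (@le_trans _ _ (m (\bigcup_(i in K) dilated_ball F' i))).
  apply: le_fmeas => //.
    by apply: measurableI; [exact: measurable_dilated_union lF'|exact: mB].
  by move=> y [[i Di yi] yx]; exists i => //; split => //; exists y.
have := @level_weak_type E t' F' K _ mE (mLLB x rho0) t'0 lF' KF _.
have h i : K i -> family_ball F' i `<=` ball x (L * (L * rho)).
  move=> [Di meet]; apply: subset_trans (stopping_engulf mE t0 tt'1 st lF' Di meet).
  by apply: (ball_dilate H); exact: level_family_gt0 lF' Di.
move=> /(_ h) h1.
have h2 : m (E `&` ball x (L * (L * rho))) <= t * (A ^+ 2 * m (ball x rho)).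
  apply: (@le_trans _ _ (t * m (ball x (L * (L * rho))))); last first.
    by rewrite ler_pM2l//; exact: dilate2.
  rewrite leNgt; apply/negP/nd; rewrite ler_pM2l// ler_peMl ?(ltW rho0)//.
  by have := ds_L H; lra.
rewrite -(@ler_pM2l _ t')//; apply: le_trans h1 _.
apply: (@le_trans _ _ (A * (t * (A ^+ 2 * m (ball x rho))))); first by rewrite ler_pM2l.
have -> : A * (t * (A ^+ 2 * m (ball x rho))) = A ^+ 3 * t * m (ball x rho) by ring.
rewrite mulrA ler_wpM2r ?fmeas_ge0//; move: tt'; rewrite -mulrA; lra.
Qed.

(** Almost all the points of [E] lie in the higher level set, and [E] has
    density at most [t'] in the dilates of its balls; so the higher level set has at least the
    measure that carrying the mass of [E] requires. *)
Lemma stopping_rich E t t' F' x rho : measurable E -> 0 < t ->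
  A ^+ 3 * t <= t' -> t' <= 2^-1 -> stopping E t x rho -> level_family E t' F' ->
  t * m (ball x rho) <= A * t' * m (dilated_union F' `&` ball x (L * (L * rho))).
Proof.
move=> mE t0 tt' t'2 st lF'; have [rho0 dn nd] := st.
have A30 : 0 < A ^+ 3 by rewrite exprn_gt0.
have t'0 : 0 < t' by apply: lt_le_trans tt'; rewrite mulr_gt0.
pose K := [set i | index F' i /\ dilated_ball F' i `&` ball x rho !=set0].
have KF : K `<=` index F' by move=> i [].
have mK := measurable_dilated_bigcup lF' KF.
have mU := measurable_dilated_union lF'.
have mEB : measurable (E `&` ball x rho) by apply: measurableI => //; exact: mB.
have mW : measurable (dilated_union F' `&` ball x (L * (L * rho))).
  by apply: measurableI => //; exact: mLLB.
apply: le_trans (ltW dn) _; rewrite (fmeasDI fmu mEB mU).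
have -> : m ((E `&` ball x rho) `\` dilated_union F') = 0.
  apply/eqP; rewrite eq_le fmeas_ge0 andbT -(level_covers mE t'2 lF').
  by apply: le_fmeas => //; [exact: measurableD|exact: measurableD|apply: setSD].
rewrite addr0.
apply: (@le_trans _ _ (m (E `&` \bigcup_(i in K) dilated_ball F' i))).
  apply: le_fmeas => //; [exact: measurableI|exact: measurableI|].
  move=> y [[Ey yx] [i Di yi]]; split => //; exists i => //; split => //.
  by exists y.
apply: level_reverse_weak_type => // i [Di meet].
have sub : family_ball F' i `<=` dilated_ball F' i.
  by apply: (ball_dilate H); exact: level_family_gt0 lF' Di.
rewrite subsetI; split; first by move=> y yi; exists i => //; exact: sub.
exact: subset_trans (stopping_engulf mE t0 tt' st lF' Di meet).
Qed.

Lemma level_rich E t F : measurable E -> 0 < t -> t <= 2^-1 ->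
  level_family E t F -> m E <= A * t * m (dilated_union F).
Proof.
move=> mE t0 t2 lF; have mU := measurable_dilated_union lF.
rewrite (fmeasDI fmu mE mU) (level_covers mE t2 lF) addr0.
apply: (level_reverse_weak_type mE mU t0 lF) => // i Di; apply: subset_trans (bigcup_sup Di).
by apply: (ball_dilate H); exact: level_family_gt0 lF Di.
Qed.

(** Above the mean density of [E] in a ball that contains it, stopping balls
    are smaller than that ball. *)
Lemma level_localized E t F x r : measurable E -> 0 < t -> 0 < r ->
  E `<=` ball x r -> A * m E <= t * m (ball x r) -> level_family E t F ->
  dilated_union F `<=` ball x (L * (L * r)).
Proof.
move=> mE t0 r0 Ex dn lF y [i Di yi]; have [sF _ _] := lF.
have rho0 := level_family_gt0 lF Di; have [_ dni _] := sF i Di.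
set rho := radius F i in rho0 dni yi *; set c := centre F i in dni yi *.
have [z [Ez zc]] : E `&` ball c rho !=set0.
  apply/set0P/eqP => e0; move: dni; rewrite /denser e0 /fmeas measure0/= ltNge.
  by rewrite mulr_ge0 ?fine_ge0 ?(ltW t0).
have le : rho <= r.
  rewrite leNgt; apply/negP => lt.
  have sub : ball x r `<=` ball c (L * rho).
    by apply: (ds_engulf H) => //; [exists z; split => //; exact: Ex|lra].
  have h1 := le_fmeas fmu (mB x r0) (mLB c rho0) sub.
  have h2 := ds_doubling H c rho0.
  have h3 : m (E `&` ball c rho) <= m E.
    by apply: le_fmeas => //; apply: measurableI => //; exact: mB.
  have h4 : A * (t * m (ball c rho)) < A * m E.
    by rewrite ltr_pM2l//; exact: lt_le_trans h3.
  have h5 : t * m (ball x r) <= t * (A * m (ball c rho)).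
    by rewrite ler_pM2l//; lra.
  by move: h4 h5; rewrite (mulrCA t); lra.
have := @ds_engulf _ _ _ _ _ _ _ _ H c x (L * rho) (L * r).
apply => //; rewrite ?mulr_gt0//.
- by exists z; split; [exact: (ball_dilate H)|apply: (ball_dilate H) => //; exact: Ex].
- have : L * rho <= L * r by rewrite ler_pM2l.
  have : 0 < L * r by rewrite mulr_gt0.
  by lra.
Qed.

End LevelSets.

(** * From the Muckenhoupt condition to a restricted condition with smaller exponent *)

Section RealPowers.
Context {R : realType}.
Implicit Types a b r x y : R.

Lemma le_powR2 r x y : 0 <= r -> 0 <= x -> x <= y -> x `^ r <= y `^ r.
Proof.
by move=> r0 x0 xy; apply: ge0_ler_powR => //; rewrite nnegrE// (le_trans x0).
Qed.

Lemma le_powR_inv r x y : 0 < r -> 0 <= x -> 0 <= y -> x `^ r <= y ->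
  x <= y `^ r^-1.
Proof.
move=> r0 x0 y0 /(le_powR2 (r := r^-1)); rewrite invr_ge0 (ltW r0) => /(_ isT).
by rewrite powR_ge0 -powRrM divff ?gt_eqF// powRr1//; exact.
Qed.

Lemma exp_eq_powR b x : 0 < b -> b != 1 -> 0 < x -> x = b `^ (ln x / ln b).
Proof.
move=> b0 b1 x0; have lb : ln b != 0 by rewrite ln_eq0.
by rewrite /powR gt_eqF// divfK// lnK.
Qed.

Lemma exprn_bracket (b y : R) : 0 < b < 1 -> 0 < y <= 1 ->
  exists J, y <= b ^+ J < y / b.
Proof.
move=> /andP[b0 b1] /andP[y0 y1].
have [n hn] : exists n, b ^+ n < y.
  have [n hn] : exists n, b ^+ n <= y / 2.
    exists (Num.bound (ln (y / 2) / ln b)).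
    have lb : ln b < 0 by rewrite ln_lt0// b0.
    have y2 : 0 < y / 2 by lra.
    rewrite -ler_ln ?posrE ?exprn_gt0// lnXn// -[leLHS]mulr_natl.
    rewrite -ler_ndivrMr//; apply: ltW; exact: unstable.ltr_bound.
  by exists n; lra.
have ex : exists n, b ^+ n < y by exists n.
case: (ex_minnP ex) => -[|k] hk kmin; first by move: hk; rewrite expr0; lra.
exists k; apply/andP; split.
  by rewrite leNgt; apply/negP => /kmin; rewrite ltnn.
by rewrite ltr_pdivlMr// -exprSr.
Qed.

End RealPowers.

Section RestrictedCondition.
Context {R : realType} {disp : measure_display} {T : measurableType disp}.
Variables (mu nu : {measure set T -> \bar R}) (d : T -> T -> R).
Implicit Types (x : T) (r q : R) (E : set T).

(** The inequality that characterizes the weights for which the maximal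
    operator is of restricted weak type [(q, q)]. *)
Definition restricted_Muckenhoupt q :=
  exists2 K, 0 < K & forall x r E, 0 < r -> measurable E -> E `<=` qball d x r ->
    (fmeas mu E / fmeas mu (qball d x r)) `^ q * fmeas nu (qball d x r)
      <= K * fmeas nu E.

End RestrictedCondition.

Section SelfImprovement.
Context {R : realType} {disp : measure_display} {T : measurableType disp}.
Variables (mu : {measure set T -> \bar R}) (d : T -> T -> R) (L A Delta : R).
Variable x0 : T.
Hypothesis H : dilation_structure mu d L A Delta.
Hypothesis dense : continuous_dense_L1 mu d.
Implicit Types (x y : T) (r t rho q : R) (E W : set T).

Local Notation ball := (qball d).
Local Notation m := (fmeas mu).
Local Notation family := (@ball_family R disp T).

Let fmu := ds_finite H.
Let A0 := ds_A0 H.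
Let L0 := ds_L0 H.

Lemma density_range E x r : 0 < r -> measurable E -> E `<=` ball x r ->
  0 <= m E / m (ball x r) <= 1.
Proof.
move=> r0 mE Ex; have B0 := ball_gt0 H x r0.
rewrite divr_ge0 ?fmeas_ge0//= ler_pdivrMr// mul1r.
by apply: le_fmeas => //; exact: (ds_measurable H).
Qed.

Lemma restricted_Muckenhoupt_le (nu : {measure set T -> \bar R}) q q' :
  0 < q -> q <= q' ->
  restricted_Muckenhoupt mu nu d q -> restricted_Muckenhoupt mu nu d q'.
Proof.
move=> q0 qq' [K K0 KP]; exists K => // x r E r0 mE Ex.
apply: le_trans (KP x r E r0 mE Ex); rewrite ler_wpM2r ?fmeas_ge0//.
have /andP[] := density_range r0 mE Ex.
rewrite le_eqVlt => /predU1P[<- _|a0 a1].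
  by rewrite !powR0// gt_eqF//; lra.
by apply: ger_powR => //; rewrite a0.
Qed.

(** Comparing balls of neighbouring levels costs [A ^ 3] ([level_nested]); the
    factor 4 leaves enough to make each level set fill at most half of the balls
    of the next one, and makes the ratio large in any case. *)
Definition level_ratio := 4 * A ^+ 3.

Definition level j := 2^-1 * level_ratio^-1 ^+ j.

Lemma level_ratio_ge4 : 4 <= level_ratio.
Proof.
have : 1 <= A ^+ 3 by apply: exprn_ege1; exact: (ds_A H).
by rewrite /level_ratio; lra.
Qed.

Lemma level_ratioV : 0 < level_ratio^-1 < 1.
Proof. by have := level_ratio_ge4 => ?; rewrite invr_gt0 invf_lt1; lra. Qed.

Lemma level_gt0 j : 0 < level j.
Proof. by rewrite mulr_gt0// exprn_gt0//; have /andP[] := level_ratioV. Qed.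

Lemma level_le_half j : level j <= 2^-1.
Proof.
rewrite /level ler_piMr// exprn_ile1//; have := level_ratioV; lra.
Qed.

Lemma levelD i j : level_ratio ^+ j * level (i + j) = level i.
Proof.
have N0 : level_ratio ^+ j != 0.
  by rewrite expf_neq0// gt_eqF//; have := level_ratio_ge4; lra.
by rewrite /level exprD (exprVn _ j); field.
Qed.

Lemma level_mono i j : (i <= j)%N -> level j <= level i.
Proof.
move=> ij; rewrite ler_pM2l// ler_wiXn2l//; have := level_ratioV; lra.
Qed.

Lemma level_lt i j : (i < j)%N -> 2 * A ^+ 3 * level j <= level i.
Proof.
move=> ij; rewrite -(subnKC ij) addSnnS -[leRHS](levelD _ (j - i.+1).+1).
have l0 := level_gt0 (i + (j - i.+1).+1).
rewrite ler_pM2r//.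
have N4 := level_ratio_ge4.
apply: (@le_trans _ _ level_ratio).
  have : 0 < A ^+ 3 by exact: exprn_gt0.
  by rewrite /level_ratio; lra.
by rewrite exprS ler_peMr// ?exprn_ege1//; lra.
Qed.

(** For a set that is thin in a ball the number of levels above its density is
    about the logarithm of the reciprocal of this density; by
    [level_localized] all these level sets stay in a dilate of the ball. *)
Lemma level_sequence E x r : 0 < r -> measurable E -> E `<=` ball x r ->
  0 < m E -> 2 * A * (m E / m (ball x r)) <= 1 ->
  exists (J : nat) (F : nat -> ball_family),
  [/\ 2 * A * (m E / m (ball x r)) <= level_ratio^-1 ^+ J,
      level_ratio^-1 ^+ J < level_ratio * (2 * A * (m E / m (ball x r))),
      forall j, (j <= J)%N -> level_family mu d L E (level j) (F j) &
      forall j, (j <= J)%N -> dilated_union d L (F j) `<=` ball x (L * (L * r))].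
Proof.
move=> r0 mE Ex mE0 thin.
have B0 := ball_gt0 H x r0; set a := m E / m (ball x r) in thin *.
have a0 : 0 < a by rewrite divr_gt0.
have Aa : 0 < 2 * A * a <= 1 by rewrite thin mulr_gt0// mulr_gt0.
have [J /andP[J1 J2]] := exprn_bracket level_ratioV Aa.
have lev j : (j <= J)%N -> A * m E <= level j * m (ball x r).
  move=> /level_mono h; apply: (@le_trans _ _ (level J * m (ball x r))); last first.
    by rewrite ler_pM2r.
  rewrite -ler_pdivrMr// -mulrA -/a /level; move: J1; rewrite -mulrA; lra.
have /choice[F FP] : forall j, exists F, (j <= J)%N -> level_family mu d L E (level j) F.
  move=> j; have [/lev h|jJ] := leqP j J; last first.
    by exists (BallFamily (fun=> x0) (fun=> 0) set0).
  have [|F FP] := @level_family_exists _ _ _ mu d L A Delta x0 H E (level j).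
  - apply: (@le_trans _ _ (A * m E)); first by rewrite ler_peMl ?fmeas_ge0// (ds_A H).
    apply: le_trans h _; rewrite ler_pM2l ?level_gt0//; apply: le_fmeas => //.
    exact: (ds_measurable H).
  - by exists F.
exists J, F; split => //.
- by move: J2; rewrite invrK mulrC.
- move=> j jJ; apply: (level_localized H mE (level_gt0 j)) => //.
    exact: lev.
  exact: FP.
Qed.

Variables (nu sg : {measure set T -> \bar R}) (p K1 K2 : R).
Hypotheses (fnu : finite_total nu) (fsg : finite_total sg).
Hypotheses (p1 : 1 < p) (K10 : 0 < K1) (K20 : 0 < K2).
Hypothesis sg_dominated : forall E, measurable E -> mu E = 0%E -> sg E = 0%E.
Hypothesis holder : forall E, measurable E ->
  m E `^ p <= K1 * fmeas nu E * fmeas sg E `^ (p - 1).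
Hypothesis Ap : forall x r, 0 < r ->
  fmeas nu (ball x r) * fmeas sg (ball x r) `^ (p - 1) <= K2 * m (ball x r) `^ p.

Let p10 : 0 < p - 1. Proof. by rewrite subr_gt0. Qed.

Let p0 : 0 < p. Proof. exact: lt_trans ltr01 p1. Qed.

Local Notation n := (fmeas nu).
Local Notation s := (fmeas sg).

Lemma dual_pair_gt0 x r : 0 < r -> 0 < n (ball x r) /\ 0 < s (ball x r).
Proof.
move=> r0; have B0 := ball_gt0 H x r0.
have mB : measurable (ball x r) by exact: (ds_measurable H).
have h : 0 < K1 * n (ball x r) * s (ball x r) `^ (p - 1).
  exact: lt_le_trans (powR_gt0 p B0) (holder mB).
split; rewrite lt0r fmeas_ge0 andbT; apply/eqP => e0; move: h; rewrite e0.
  by rewrite mulr0 mul0r ltxx.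
by rewrite powR0 ?mulr0 ?ltxx// gt_eqF.
Qed.

Lemma dual_pair_ratio E x r : 0 < r -> measurable E -> E `<=` ball x r ->
  (m E / m (ball x r)) `^ p * n (ball x r) <=
  K1 * K2 * n E * (s E / s (ball x r)) `^ (p - 1).
Proof.
move=> r0 mE Ex; have B0 := ball_gt0 H x r0; have [nB sB] := dual_pair_gt0 x r0.
have sBp := powR_gt0 (p - 1) sB; have mBp := powR_gt0 p B0.
rewrite !powRM ?invr_ge0 ?fmeas_ge0// -!powR_inv1 ?fmeas_ge0//.
rewrite -!powRrM !mulN1r !powRN.
rewrite mulrA ler_pdivlMr// mulrAC -mulrA -[leLHS]mulrA mulrCA ler_pdivrMl//.
apply: (@le_trans _ _ (K1 * n E * s E `^ (p - 1) * (K2 * m (ball x r) `^ p))).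
  apply: ler_pM; rewrite ?powR_ge0 ?mulr_ge0 ?fmeas_ge0 ?powR_ge0//.
    exact: holder.
  by rewrite mulrC; exact: Ap.
by rewrite le_eqVlt; apply/orP; left; apply/eqP; ring.
Qed.

Lemma dual_doubling (c : R) : 0 < c -> exists2 C, 1 < C & forall E x r, 0 < r ->
  measurable E -> E `<=` ball x r -> c * m (ball x r) <= m E ->
  s (ball x r) <= C * s E.
Proof.
move=> c0; pose D := (K1 * K2 / c `^ p) `^ (p - 1)^-1.
exists (Num.max D 2); first by rewrite lt_max; apply/orP; right; lra.
move=> E x r r0 mE Ex cE.
have B0 := ball_gt0 H x r0; have [nB sB] := dual_pair_gt0 x r0.
have mB : measurable (ball x r) by exact: (ds_measurable H).
have := dual_pair_ratio r0 mE Ex.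
set u := s E / s (ball x r) => h.
have u0 : 0 <= u by rewrite divr_ge0 ?fmeas_ge0.
have h1 : c `^ p <= K1 * K2 * u `^ (p - 1).
  rewrite -(ler_pM2r nB); apply: (@le_trans _ _ (K1 * K2 * n E * u `^ (p - 1))).
    apply: le_trans h; rewrite ler_pM2r//; apply: le_powR2; [exact: ltW|exact: ltW|].
    by rewrite ler_pdivlMr.
  rewrite -[leLHS]mulrA [leRHS]mulrAC -[leRHS]mulrA ler_wpM2l//.
    by rewrite mulr_ge0// ltW.
  rewrite mulrC [leRHS]mulrC ler_wpM2l ?powR_ge0//.
  exact: le_fmeas.
have uE : u * s (ball x r) = s E by rewrite /u divfK// gt_eqF.
have u0' : 0 < u.
  rewrite lt0r u0 andbT; apply/eqP => u00; move: h1.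
  by rewrite u00 powR0 ?mulr0 ?leNgt ?powR_gt0// gt_eqF.
apply: (@le_trans _ _ (D * s E)); last first.
  by rewrite ler_wpM2r ?fmeas_ge0// le_max lexx.
rewrite -uE mulrA ler_peMl ?fmeas_ge0//.
rewrite -ler_pdivrMr// mul1r; apply: le_powR_inv => //.
- by rewrite invr_ge0.
- by rewrite divr_ge0 ?powR_ge0// mulr_ge0 ?ltW.
- rewrite -(powR_inv1 u0) -powRrM mulN1r powRN ler_pdivlMr ?powR_gt0//.
  by rewrite mulrC ler_pdivrMr ?powR_gt0.
Qed.

(** Each level set occupies at most half, in the sense of [mu], of every
    selected ball of the next level; hence, up to doubling, it misses a fixed
    proportion of the [sg]-measure of the next level set. So the measures
    [sg] of the level sets grow geometrically, in a number of steps that is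
    logarithmic in the density of [E]. *)
Lemma dual_decay : exists delta C : R, [/\ 0 < delta, 0 < C &
  forall E x r, 0 < r -> measurable E -> E `<=` ball x r ->
    s E <= C * (m E / m (ball x r)) `^ delta * s (ball x r)].
Proof.
have c1 : 0 < (2 * A)^-1 by rewrite invr_gt0 mulr_gt0.
have [C C1 CP] := dual_doubling c1.
have c2 : 0 < (A ^+ 2)^-1 by rewrite invr_gt0 exprn_gt0.
have [C2 C21 C2P] := dual_doubling c2.
pose theta := 1 - C^-1.
have theta01 : 0 < theta < 1.
  have : 0 < C^-1 < 1 by rewrite invr_gt0 invf_lt1; lra.
  by rewrite /theta; lra.
have /andP[theta0 theta1] := theta01.
have N4 := level_ratio_ge4; have /andP[N0 N1] := level_ratioV.
pose delta := ln theta / ln level_ratio^-1.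
have lntheta : ln theta < 0 by apply: ln_lt0.
have lnN : ln level_ratio^-1 < 0 by apply: ln_lt0; rewrite N0.
have delta0 : 0 < delta by rewrite nmulr_rgt0// invr_lt0.
have thetaE : theta = level_ratio^-1 `^ delta by apply: exp_eq_powR => //; rewrite lt_eqF.
pose C3 := C2 * (level_ratio * (2 * A)) `^ delta.
have NA : 0 < level_ratio * (2 * A) by rewrite !mulr_gt0//; lra.
have C20 : 0 < C2 by exact: lt_trans ltr01 C21.
have C30 : 0 < C3 by rewrite mulr_gt0 ?powR_gt0.
have C0 : 0 < C by exact: lt_trans ltr01 C1.
have N1' : 1 <= level_ratio by lra.
exists delta, C3; split => //.
move=> E x r r0 mE Ex.
have B0 := ball_gt0 H x r0; have mB : measurable (ball x r) by exact: (ds_measurable H).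
have sEB : s E <= s (ball x r) by exact: le_fmeas.
set a := m E / m (ball x r).
have a0 : 0 <= a by rewrite divr_ge0 ?fmeas_ge0.
have [mE0|mE0] := eqVneq (m E) 0.
  have sE0 : s E = 0.
    have : mu E = 0%E by rewrite fmeasE// mE0.
    by move=> /(sg_dominated mE); rewrite /fmeas => ->.
  by rewrite sE0 !mulr_ge0 ?powR_ge0 ?fmeas_ge0// ltW.
have {}mE0 : 0 < m E by rewrite lt0r mE0 fmeas_ge0.
have C3a : C3 * a `^ delta = C2 * (level_ratio * (2 * A * a)) `^ delta.
  by rewrite /C3 -mulrA -powRM//; [congr (_ * _ `^ _); ring|exact: ltW].
have [thick|thin] := ltP 1 (2 * A * a).
  rewrite C3a; apply: le_trans sEB _; rewrite ler_peMl ?fmeas_ge0//.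
  rewrite mulr_ege1//; first exact: ltW.
  rewrite -[leLHS](powRr0 (level_ratio * (2 * A * a))); apply: ler_powR; last exact: ltW.
  exact: mulr_ege1 N1' (ltW thick).
have [J [F [J1 J2 lF locF]]] := level_sequence r0 mE Ex mE0 thin.
pose U j := dilated_union d L (F j).
have mU j : (j <= J)%N -> measurable (U j).
  by move=> /lF; exact: (measurable_dilated_union H).
have step j : (j < J)%N -> s (U j) <= theta * s (U j.+1).
  move=> jJ; have lj := lF j (ltnW jJ); have lj1 := lF j.+1 jJ.
  have mj := mU j (ltnW jJ); have mj1 := mU j.+1 jJ.
  have nest : U j `<=` U j.+1.
    apply: (level_nested H mE (level_gt0 j.+1) _ lj1 lj).
    apply: le_trans (level_lt (ltnSn j)); rewrite ler_pM2r ?level_gt0//.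
    by rewrite ler_peMl ?exprn_ge0 ?(ltW A0)// ler1n.
  have grow : s (U j.+1) <= C * s (U j.+1 `\` U j).
    apply: (@le_fmeas_bigcup _ _ _ _ _ _ _ (family_ball d (F j.+1))) => //.
    - by lra.
    - exact: measurableD.
    - move=> i Di; apply: (ds_measurable H); exact: level_family_gt0 lj1 Di.
    - move=> i Di; apply: (measurable_dilate H); exact: level_family_gt0 lj1 Di.
    - by case: lj1.
    move=> i Di; have rho0 := level_family_gt0 lj1 Di.
    have mQ : measurable (family_ball d (F j.+1) i) by exact: (ds_measurable H).
    have sub := ball_dilate H (x := centre (F j.+1) i) rho0.
    rewrite (_ : _ `&` _ = family_ball d (F j.+1) i `\` U j); last first.
      apply/seteqP; split => [y [[_ ?] ?]//|y [yi ?]]; split => //; split => //.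
      by exists i => //; exact: sub.
    have [sF _ _] := lj1.
    apply: CP => //; first by rewrite mulr_gt0.
      exact: measurableD.
      by apply: subset_trans sub; exact: subDsetl.
    have := stopping_sparse H mE (level_gt0 _) (level_lt (ltnSn j)) (sF i Di) lj.
    rewrite -/(U j) -/(family_ball d (F j.+1) i).
    have := fmeasDI fmu mQ mj; rewrite (setIC _ (U j)).
    have := ds_doubling H (centre (F j.+1) i) rho0.
    rewrite -/(family_ball d (F j.+1) i) => h1 h2 h3.
    rewrite ler_pdivrMl ?mulr_gt0//; apply: le_trans h1 _.
    by rewrite (mulrC 2) -mulrA ler_pM2l//; lra.
  have := fmeasDI fsg mj1 mj; rewrite (setIidr nest) => e.
  have : C^-1 * s (U j.+1) <= s (U j.+1 `\` U j) by rewrite ler_pdivrMl.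
  by rewrite /theta mulrBl mul1r; lra.
have chain j : (j <= J)%N -> s (U 0%N) <= theta ^+ j * s (U j).
  elim: j => [|j IH] jJ; first by rewrite expr0 mul1r.
  apply: le_trans (IH (ltnW jJ)) _; rewrite exprSr -mulrA.
  by rewrite ler_pM2l ?exprn_gt0//; exact: step.
have sE0 : s E <= s (U 0%N).
  have mE0U := mU 0%N (leq0n _).
  rewrite (fmeasDI fsg mE mE0U).
  have -> : s (E `\` U 0%N) = 0.
    have mD := measurableD mE mE0U.
    suff : sg (E `\` U 0%N) = 0%E by rewrite /fmeas => ->.
    apply: sg_dominated => //; rewrite fmeasE//; congr EFin.
    exact: (level_covers x0 H dense mE (level_le_half 0) (lF _ _)).
  rewrite addr0; apply: le_fmeas => //; exact: measurableI.
have LLr0 : 0 < L * (L * r) by rewrite !mulr_gt0.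
have mLL : measurable (ball x (L * (L * r))) by exact: (ds_measurable H).
have sUJ : s (U J) <= C2 * s (ball x r).
  apply: (@le_trans _ _ (s (ball x (L * (L * r))))).
    by apply: le_fmeas => //; [exact: mU|exact: locF].
  apply: C2P => //.
    by apply: subset_trans (ball_dilate H _); [exact: (ball_dilate H)|rewrite mulr_gt0].
  by rewrite ler_pdivrMl ?exprn_gt0//; exact: (dilate2 H).
apply: le_trans sE0 _; apply: le_trans (chain J (leqnn J)) _.
rewrite C3a; apply: (@le_trans _ _ (theta ^+ J * (C2 * s (ball x r)))).
  by rewrite ler_pM2l ?exprn_gt0.
rewrite mulrCA mulrA ler_wpM2r ?fmeas_ge0// ler_pM2l//.
rewrite thetaE -powR_mulrn ?powR_ge0// powRAC powR_mulrn ?(ltW N0)//.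
by apply: le_powR2; [exact: ltW|exact: exprn_ge0 (ltW N0)|exact: ltW].
Qed.

Theorem self_improvement : exists2 q, 1 < q < p & restricted_Muckenhoupt mu nu d q.
Proof.
have [delta [C [delta0 C0 dec]]] := dual_decay.
have hp := p1; pose q0 := p - delta * (p - 1).
pose q := Num.max q0 ((1 + p) / 2).
have q0p : q0 < p by rewrite /q0 ltrBlDl ltrDr mulr_gt0.
exists q.
  by rewrite lt_max gt_max q0p; apply/andP; split; [apply/orP; right|]; lra.
exists (K1 * K2 * C `^ (p - 1)); first by rewrite !mulr_gt0// powR_gt0.
move=> x r E r0 mE Ex; have [nB sB] := dual_pair_gt0 x r0.
have B0 := ball_gt0 H x r0.
have /andP[] := density_range r0 mE Ex; set a := m E / m (ball x r).
rewrite le_eqVlt => /predU1P[<- _|a0 a1].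
  rewrite powR0 ?mul0r ?mulr_ge0 ?fmeas_ge0 ?powR_ge0 ?(ltW K10) ?(ltW K20)//.
  by rewrite gt_eqF// lt_max; apply/orP; right; lra.
apply: (@le_trans _ _ (a `^ q0 * n (ball x r))).
  by rewrite ler_wpM2r ?fmeas_ge0//; apply: ger_powR; rewrite ?a0// le_max lexx.
rewrite /q0 powRB; last by apply/implyP => _; rewrite gt_eqF.
rewrite mulrAC ler_pdivrMr ?powR_gt0//.
apply: le_trans (dual_pair_ratio r0 mE Ex) _.
have h : (s E / s (ball x r)) `^ (p - 1) <= (C * a `^ delta) `^ (p - 1).
  apply: le_powR2; [lra|by rewrite divr_ge0 ?fmeas_ge0|].
  by rewrite ler_pdivrMr//; exact: dec.
have -> : K1 * K2 * C `^ (p - 1) * n E * a `^ (delta * (p - 1)) =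
   K1 * K2 * n E * (C * a `^ delta) `^ (p - 1).
  by rewrite powRM ?powR_ge0 ?(ltW C0)// -powRrM; ring.
by rewrite ler_wpM2l// !mulr_ge0 ?fmeas_ge0// ltW.
Qed.

End SelfImprovement.

(** * Lebesgue integrals on the half line and lower integrals *)

Section Scaling.
Context {R : realType}.
Variables (c : R).
Hypothesis c0 : 0 < c.

Local Notation leb := (@lebesgue_measure R).

Let phi : measurableTypeR R -> measurableTypeR R := fun x => (c * x : R).

Let mphi : measurable_fun setT phi.
Proof. exact: mulrl_measurable. Qed.

Let pm : {measure set (measurableTypeR R) -> \bar R} :=
  measure_function_pushforward__canonical__measure_function_Measure leb mphi.

Lemma lebesgue_measure_scale (E : set R) : measurable E ->
  leb E = mscale (NngNum (ltW c0)) pm E.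
Proof.
move=> mE; apply: lebesgue_measure_unique => //= _ [[a b]] _ <-.
rewrite /mscale/= /pm/= /pushforward.
have -> : phi @^-1` `]a, b] = `]a / c, b / c]%classic.
  by apply/seteqP; split => x /=; rewrite !in_itv/= /phi ltr_pdivrMr// ler_pdivlMr// ![_ * c]mulrC.
rewrite !lebesgue_measure_itv/= !lte_fin ltr_pM2r ?invr_gt0//.
case: ifPn => _; last by rewrite mule0.
by rewrite -!EFinD -EFinM mulrBr !(mulrC c) !divfK// gt_eqF.
Qed.

Lemma integral_scale (g : R -> \bar R) :
  measurable_fun (`]0, +oo[%classic : set R) g -> (forall t, 0 < t -> (0 <= g t)%E) ->
  (\int[leb]_(t in `]0%R, +oo[) g (c * t)%R =
   (c^-1)%:E * \int[leb]_(t in `]0%R, +oo[) g t)%E.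
Proof.
move=> mg g0.
have -> : (\int[leb]_(t in `]0%R, +oo[) g t =
    \int[mscale (NngNum (ltW c0)) pm]_(t in `]0%R, +oo[) g t)%E.
  by apply: eq_measure_integral => // E mE _; exact: lebesgue_measure_scale.
have g0' t : `]0, +oo[%classic t -> (0 <= g t)%E by rewrite /= in_itv/= andbT; exact: g0.
have pmE : (\int[pm]_(t in `]0%R, +oo[) g t =
    \int[leb]_(t in phi @^-1` `]0%R, +oo[) (g \o phi) t)%E.
  by apply: (ge0_integral_pushforward mphi) => // t; rewrite inE; exact: g0'.
rewrite ge0_integral_mscale//= pmE.
have -> : phi @^-1` `]0, +oo[ = `]0, +oo[%classic.
  by apply/seteqP; split => x /=; rewrite !in_itv/= /phi pmulr_rgt0.
by rewrite muleA -EFinM mulVf ?gt_eqF// mul1e.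
Qed.

End Scaling.

Section LowerIntegral.
Context {R : realType} {disp : measure_display} {T : measurableType disp}.
Variable mu : {measure set T -> \bar R}.

Import HBNNSimple.

(** Integrals of nonnegative functions are monotone without measurability:
    the integral is then a lower integral, a supremum over simple functions. *)
Lemma le_lower_integral (D : set T) (f g : T -> \bar R) :
  (forall x, D x -> (0 <= f x)%E) -> (forall x, D x -> (f x <= g x)%E) ->
  (\int[mu]_(x in D) f x <= \int[mu]_(x in D) g x)%E.
Proof.
move=> f0 fg; have g0 x : D x -> (0 <= g x)%E.
  by move=> Dx; apply: le_trans (f0 x Dx) (fg x Dx).
rewrite !ge0_integralE//; apply: le_ereal_sup => _ [h hf <-]; exists h => //= x.
apply: le_trans (hf x) _; rewrite !patchE; case: ifPn => // /set_mem Dx.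
exact: fg.
Qed.

Lemma le_lower_integral_subset (D D' : set T) (f : T -> \bar R) :
  (forall x, (0 <= f x)%E) -> D `<=` D' ->
  (\int[mu]_(x in D) f x <= \int[mu]_(x in D') f x)%E.
Proof.
move=> f0 DD'; rewrite (integral_mkcond D) (integral_mkcond D').
apply: le_lower_integral => x _; rewrite !patchE; case: ifPn => //.
  by move=> /set_mem/DD' D'x; rewrite mem_set.
by move=> _; case: ifPn.
Qed.

Variable w : T -> R.
Hypothesis mw : measurable_fun setT w.
Hypothesis w0 : {ae mu, forall x, 0 < w x}.

Local Notation nu := (density_measure mu mw).

Let mEw : measurable_fun setT (EFin \o w).
Proof. exact/measurable_EFinP. Qed.

Lemma wmeasure_pos (E : set T) :
  wmeasure mu w E = (\int[mu]_(x in E) (fun x => (w x)%:E)^\+ x)%E.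
Proof.
rewrite /wmeasure integralE.
suff -> : (\int[mu]_(x in E) ((fun x => (w x)%:E)^\- x) = 0)%E by rewrite sube0.
apply/eqP; rewrite eq_le; apply/andP; split; last first.
  by apply: integral_ge0 => x _; exact: funeneg_ge0.
have <- : (\int[mu]_x ((fun x => (w x)%:E)^\- x) = 0)%E.
  rewrite (ge0_ae_eq_integral _ (g := cst 0%E))//; first by rewrite integral0.
    exact: measurable_funeneg.
  apply: filterS w0 => x wx _ /=.
  by rewrite funenegE; apply/max_idPr; rewrite -EFinN lee_fin oppr_le0 ltW.
by apply: le_lower_integral_subset => // x; exact: funeneg_ge0.
Qed.

Lemma le_wmeasure (E F : set T) : E `<=` F ->
  (wmeasure mu w E <= wmeasure mu w F)%E.
Proof.
move=> EF; rewrite !wmeasure_pos; exact: le_lower_integral_subset.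
Qed.

Lemma wmeasureE (E : set T) : measurable E -> wmeasure mu w E = nu E.
Proof.
move=> mE; rewrite wmeasure_pos; apply: ge0_ae_eq_integral => //.
- by apply: measurable_funTS; exact: measurable_funepos.
- by apply: measurableT_comp => //; exact: measurable_funTS.
apply: filterS w0 => x wx _ /=; rewrite funeposE gtr0_norm//.
by apply/max_idPl; rewrite lee_fin ltW.
Qed.

Lemma wmeasure_ge0 (E : set T) : (0 <= wmeasure mu w E)%E.
Proof. by rewrite wmeasure_pos; apply: integral_ge0 => x _; exact: funepos_ge0. Qed.

End LowerIntegral.

(** * Weighted Lorentz and grand Lorentz norms *)

Lemma le_poweR2 {R : realType} (x y : \bar R) (r : R) : 0 <= r -> (0 <= x)%E ->
  (x <= y)%E -> (x `^ r <= y `^ r)%E.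
Proof.
move=> r0 x0 xy; apply: gt0_ler_poweR => //; rewrite in_itv/= leey andbT//.
exact: le_trans xy.
Qed.

Lemma powR_add_le {R : realType} (a b r : R) : 0 <= a -> 0 <= b -> 0 <= r ->
  (a + b) `^ r <= 2 `^ r * (a `^ r + b `^ r).
Proof.
move=> a0 b0 r0; apply: (@le_trans _ _ ((2 * Num.max a b) `^ r)).
  apply: le_powR2 => //; first exact: addr_ge0.
  by rewrite mulr_natl mulr2n; apply: lerD; rewrite le_max lexx ?orbT.
rewrite powRM ?le_max ?a0// ler_wpM2l ?powR_ge0//.
by case: (leP a b) => _; rewrite ?lerDl ?lerDr powR_ge0.
Qed.

Lemma poweR_add_le {R : realType} (x y : \bar R) (r : R) : (0 <= x)%E -> (0 <= y)%E ->
  0 <= r <= 1 -> ((x + y) `^ r <= 2%:E * (x `^ r + y `^ r))%E.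
Proof.
move=> x0 y0 /andP[r0 r1].
have p0 := poweR_ge0; have two : (2 `^ r <= 2 :> R) by apply: ler1_powR => //; lra.
wlog xy : x y x0 y0 / (x <= y)%E => [hw|].
  have [|/ltW] := leP x y; first exact: hw.
  by rewrite addeC [(x `^ r + _)%E]addeC; exact: hw.
apply: (@le_trans _ _ ((2%:E * y) `^ r)%E).
  apply: le_poweR2 => //; first by rewrite adde_ge0.
  by rewrite mule_natl mule2n; exact: leeD.
rewrite poweRM ?lee_fin// poweR_EFin.
apply: (@le_trans _ _ (2%:E * y `^ r)%E).
  by apply: lee_wpmul2r; [exact: poweR_ge0|rewrite lee_fin].
by apply: lee_wpmul2l; [rewrite lee_fin|rewrite leeDr // poweR_ge0].
Qed.

Section LorentzNorm.
Context {R : realType} {disp : measure_display} {T : measurableType disp}.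
Variables (mu : {measure set T -> \bar R}) (w : T -> R).
Hypothesis mw : measurable_fun setT w.
Hypothesis w0 : {ae mu, forall x, 0 < w x}.

Local Notation nu := (density_measure mu mw).
Local Notation leb := (@lebesgue_measure R).

Hypothesis fnu : finite_total nu.

Implicit Types (f g : T -> \bar R) (r s p e t sigma theta c : R) (E F : set T).

Definition distribution f t : R := fine (wmeasure mu w [set x | (t%:E < `|f x|)%E]).

Lemma wmeasure_fin E : wmeasure mu w E = (fine (wmeasure mu w E))%:E.
Proof.
rewrite fineK// ge0_fin_numE; last exact: (wmeasure_ge0 mw w0).
apply: (le_lt_trans (le_wmeasure mw w0 (@subsetT _ E))).
by rewrite (wmeasureE mw w0).
Qed.

Lemma distribution_ge0 f t : 0 <= distribution f t.
Proof. by apply: fine_ge0; exact: (wmeasure_ge0 mw w0). Qed.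

Lemma distribution_subset f g t t' :
  [set x | (t%:E < `|f x|)%E] `<=` [set x | (t'%:E < `|g x|)%E] ->
  distribution f t <= distribution g t'.
Proof.
by move=> sub; rewrite -lee_fin -!wmeasure_fin; exact: (le_wmeasure mw w0).
Qed.

Lemma distribution_le f t E : measurable E -> [set x | (t%:E < `|f x|)%E] `<=` E ->
  distribution f t <= fmeas nu E.
Proof.
move=> mE sub; rewrite -lee_fin /distribution -wmeasure_fin.
by apply: (le_trans (le_wmeasure mw w0 sub)); rewrite (wmeasureE mw w0)// fmeasE.
Qed.

Lemma distribution_measurable (g : T -> R) t : measurable_fun setT g ->
  distribution (EFin \o g) t = fmeas nu [set x | t < `|g x|].
Proof.
move=> mg; rewrite /distribution (wmeasureE mw w0)/=.
  by congr fine; congr (density_measure _ _ _); apply/seteqP; split => x /=; rewrite lte_fin.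
rewrite (_ : [set _ | _] = (fun x => `|g x|) @^-1` `]t, +oo[).
  by rewrite -[X in measurable X]setTI; apply: measurableT_comp.
by apply/seteqP; split => x /=; rewrite in_itv/= andbT lte_fin.
Qed.

Lemma distribution_nonincreasing f : nonincreasing_fun (distribution f).
Proof.
by move=> t t' tt'; apply: distribution_subset => x /=; apply: le_lt_trans; rewrite lee_fin.
Qed.

Definition lorentz_integral sigma s f : \bar R :=
  (\int[leb]_(t in `]0%R, +oo[) (distribution f t `^ sigma * t `^ (s - 1))%:E)%E.

Lemma lorentz_normE p s f :
  lorentz_norm mu w p s f = ((s%:E * lorentz_integral (s / p) s f) `^ s^-1)%E.
Proof.
rewrite /lorentz_norm; congr ((_ * _) `^ _)%E; apply: eq_integral => t _.
by rewrite wmeasure_fin poweR_EFin -EFinM.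
Qed.

Lemma lorentz_integrand_ge0 sigma s f t :
  (0 <= (distribution f t `^ sigma * t `^ (s - 1))%:E)%E.
Proof. by rewrite lee_fin mulr_ge0 ?powR_ge0. Qed.

Lemma lorentz_integral_ge0 sigma s f : (0 <= lorentz_integral sigma s f)%E.
Proof. by apply: integral_ge0 => t _; exact: lorentz_integrand_ge0. Qed.

Lemma measurable_lorentz_integrand sigma s f :
  measurable_fun (`]0, +oo[%classic : set R)
    (fun t => (distribution f t `^ sigma * t `^ (s - 1))%:E).
Proof.
apply/measurable_EFinP; apply: measurable_funM.
  apply: (@measurableT_comp _ _ _ _ _ _ (fun u : R => u `^ sigma)).
    exact: measurable_powR.
  by apply: nonincreasing_measurable => //; exact: distribution_nonincreasing.
by apply: measurable_funTS; exact: measurable_powR.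
Qed.

Lemma le_lorentz_integral sigma s f g : 0 <= sigma ->
  (forall t, 0 < t -> distribution f t <= distribution g t) ->
  (lorentz_integral sigma s f <= lorentz_integral sigma s g)%E.
Proof.
move=> sg0 fg; apply: le_lower_integral => t; first by move=> _; exact: lorentz_integrand_ge0.
rewrite /= in_itv/= andbT => t0; rewrite lee_fin.
apply: (ler_wpM2r (powR_ge0 _ _)).
exact: (le_powR2 sg0 (distribution_ge0 _ _) (fg t t0)).
Qed.

Lemma lorentz_integral_scale sigma s f c : 0 < c ->
  (\int[leb]_(t in `]0%R, +oo[) (distribution f (c * t)%R `^ sigma * t `^ (s - 1))%:E =
   (c `^ (- s))%:E * lorentz_integral sigma s f)%E.
Proof.
move=> c0; rewrite /lorentz_integral.
have := @integral_scale _ c c0 _ (measurable_lorentz_integrand sigma s f)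
  (fun t _ => lorentz_integrand_ge0 sigma s f t).
have -> : c `^ (- s) = c `^ (1 - s) * c^-1.
  rewrite -powR_inv1 ?(ltW c0)// -powRD; last by apply/implyP => _; rewrite gt_eqF.
  by congr (_ `^ _); ring.
rewrite EFinM -muleA => <-.
rewrite -ge0_integralZl_EFin ?powR_ge0//.
- apply: eq_integral => t; rewrite inE/= in_itv/= andbT => t0.
  rewrite -EFinM; congr EFin; rewrite powRM ?(ltW c0) ?(ltW t0)//.
  have e : c `^ (1 - s) * c `^ (s - 1) = 1.
    rewrite -powRD; last by apply/implyP => _; rewrite gt_eqF.
    by rewrite (_ : _ + _ = 0) ?powRr0//; ring.
  by rewrite [RHS]mulrCA [X in _ = _ * X]mulrA e mul1r.
- by move=> t _; exact: lorentz_integrand_ge0.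
- apply/measurable_EFinP; apply: measurable_funM; last first.
    apply: (@measurableT_comp _ _ _ _ _ _ (fun u : R => u `^ (s - 1))).
      exact: measurable_powR.
    exact: measurable_funTS.
  apply: (@measurableT_comp _ _ _ _ _ _ (fun u : R => u `^ sigma)).
    exact: measurable_powR.
  apply: nonincreasing_measurable => // t t' tt'.
  by apply: distribution_nonincreasing; rewrite ler_pM2l.
Qed.

Lemma distribution_scale f c t : 0 < c ->
  distribution (fun x => c%:E * f x)%E t = distribution f (c^-1 * t).
Proof.
move=> c0; have ac : (`|c%:E| = c%:E)%E by rewrite gee0_abs// lee_fin ltW.
by congr (fine (wmeasure _ _ _)); apply/seteqP; split => x /=;
  rewrite abseM ac (EFinM c^-1) lte_pdivrMl.
Qed.

Lemma lorentz_norm_ge0 p s f : (0 <= lorentz_norm mu w p s f)%E.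
Proof. by rewrite lorentz_normE; exact: poweR_ge0. Qed.

Lemma lorentz_norm_scale p s f c : 0 < c -> 0 < s ->
  lorentz_norm mu w p s (fun x => c%:E * f x)%E = (c%:E * lorentz_norm mu w p s f)%E.
Proof.
move=> c0 s0; rewrite !lorentz_normE.
have -> : lorentz_integral (s / p) s (fun x => c%:E * f x)%E =
    ((c `^ s)%:E * lorentz_integral (s / p) s f)%E.
  have -> : c `^ s = (c^-1) `^ (- s).
    by rewrite -(powR_inv1 (ltW c0)) -powRrM mulN1r opprK.
  have ci0 : 0 < c^-1 by rewrite invr_gt0.
  rewrite -(lorentz_integral_scale (s / p) s f ci0).
  by apply: eq_integral => t _; rewrite distribution_scale.
have l0 := lorentz_integral_ge0 (s / p) s f.
rewrite muleCA (@poweRM _ (c `^ s)%:E) ?mule_ge0 ?lee_fin ?powR_ge0 ?(ltW s0)//.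
by rewrite poweR_EFin -powRrM divff ?gt_eqF// powRr1 ?(ltW c0).
Qed.

Lemma le_lorentz_norm p s f g : 0 < p -> 0 < s ->
  (forall t, 0 < t -> distribution f t <= distribution g t) ->
  (lorentz_norm mu w p s f <= lorentz_norm mu w p s g)%E.
Proof.
move=> p0 s0 fg; rewrite !lorentz_normE.
have sE0 : (0 <= s%:E)%E by rewrite lee_fin ltW.
have sf0 := mule_ge0 sE0 (lorentz_integral_ge0 (s / p) s f).
have sp0 : 0 <= s / p by rewrite divr_ge0 ?ltW.
apply: le_poweR2; [by rewrite invr_ge0 ltW|exact: sf0|].
by apply: (lee_wpmul2l sE0); exact: le_lorentz_integral.
Qed.

(** The distribution functions of nonmeasurable functions are inner measures,
    which are not subadditive; this is why the pieces [g1] and [g2] have to be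
    measurable. *)
Lemma lorentz_norm_split p s (g g1 g2 : T -> R) : 1 < p -> 1 < s ->
  measurable_fun setT g -> measurable_fun setT g1 -> measurable_fun setT g2 ->
  (forall x, g x = g1 x \/ g x = g2 x) ->
  (lorentz_norm mu w p s (EFin \o g) <=
   4%:E * (lorentz_norm mu w p s (EFin \o g1) + lorentz_norm mu w p s (EFin \o g2)))%E.
Proof.
move=> p1 s1 mg mg1 mg2 gg; have s0 : 0 < s by lra.
have sp0 : 0 <= s / p by rewrite divr_ge0//; lra.
have mS (h : T -> R) t : measurable_fun setT h -> measurable [set x | t < `|h x|].
  move=> mh; rewrite (_ : [set _ | _] = (fun x => `|h x|) @^-1` `]t, +oo[).
    by rewrite -[X in measurable X]setTI; apply: measurableT_comp.
  by apply/seteqP; split => x /=; rewrite in_itv/= andbT.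
have dist t : distribution (EFin \o g) t <=
    distribution (EFin \o g1) t + distribution (EFin \o g2) t.
  rewrite !distribution_measurable// -lee_fin EFinD -!fmeasE//; try exact: mS.
  apply: (@le_trans _ _ (nu ([set x | t < `|g1 x|] `|` [set x | t < `|g2 x|]))).
    apply: le_measure; rewrite ?inE; [exact: mS|by apply: measurableU; exact: mS|].
    by move=> x /= h; have [<-|<-] := gg x; [left|right].
  by apply: measureU2; exact: mS.
pose I h := lorentz_integral (s / p) s (EFin \o h).
have I0 h : (0 <= I h)%E by exact: lorentz_integral_ge0.
have le1 : (I g <= (2 `^ (s / p))%:E * (I g1 + I g2))%E.
  rewrite /I /lorentz_integral -ge0_integralD//; try by move=> ? _; exact: lorentz_integrand_ge0.
  - rewrite -ge0_integralZl_EFin ?powR_ge0//.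
    + apply: le_lower_integral => t _; first exact: lorentz_integrand_ge0.
      rewrite -EFinD -EFinM lee_fin -mulrDl mulrA ler_wpM2r ?powR_ge0//.
      have d10 := distribution_ge0 (EFin \o g1) t.
      have d20 := distribution_ge0 (EFin \o g2) t.
      apply: le_trans (powR_add_le d10 d20 sp0).
      exact: (le_powR2 sp0 (distribution_ge0 _ _) (dist t)).
    + by move=> t _; rewrite -EFinD lee_fin -mulrDl mulr_ge0 ?addr_ge0 ?powR_ge0.
    + by apply: emeasurable_funD; exact: measurable_lorentz_integrand.
  - exact: measurable_lorentz_integrand.
  - exact: measurable_lorentz_integrand.
rewrite !lorentz_normE -!/(I _).
have inv0 : 0 <= s^-1 <= 1 by rewrite invr_ge0 (ltW s0)/= invf_le1//; lra.
have /andP[si0 _] := inv0.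
apply: (@le_trans _ _ (((2 `^ (s / p))%:E * (s%:E * I g1 + s%:E * I g2)) `^ s^-1)%E).
  apply: le_poweR2 => //; first by rewrite mule_ge0 ?lee_fin ?(ltW s0).
  by rewrite -ge0_muleDr// muleCA; apply: lee_wpmul2l => //; rewrite lee_fin ltW.
rewrite poweRM ?lee_fin ?powR_ge0 ?adde_ge0 ?mule_ge0 ?lee_fin ?(ltW s0)//.
have sI h : (0 <= s%:E * I h)%E by rewrite mule_ge0 ?lee_fin ?(ltW s0).
rewrite poweR_EFin -powRrM mulrAC divff ?gt_eqF// mul1r.
have two : 2 `^ p^-1 <= 2 :> R by apply: ler1_powR; [lra|rewrite invf_le1; lra].
apply: (@le_trans _ _ (2%:E * ((s%:E * I g1 + s%:E * I g2) `^ s^-1))%E).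
  by apply: lee_wpmul2r; [exact: poweR_ge0|rewrite lee_fin].
rewrite (_ : 4 = 2 * 2 :> R); last by ring.
rewrite EFinM -muleA; apply: lee_wpmul2l; first by rewrite lee_fin.
exact: poweR_add_le.
Qed.

Definition unit_lorentz s : \bar R :=
  (\int[leb]_(t in `]0%R, +oo[) ((t < 1)%R%:R * t `^ (s - 1))%:E)%E.

Lemma measurable_lt1 :
  measurable_fun (`]0, +oo[%classic : set R) (fun t : R => (t < 1)%R%:R : R).
Proof.
apply: nonincreasing_measurable => // t t' tt'.
have := @le_lt_trans _ R t' t 1 tt'.
by case: (t' < 1) => [->|_]; case: (t < 1).
Qed.

Lemma unit_lorentz_bounds s : 1 < s -> (0 < unit_lorentz s < +oo)%E.
Proof.
move=> s1; have m01 : measurable_fun (`]0, +oo[%classic : set R)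
    (fun t : R => ((t < 1)%R%:R * t `^ (s - 1))%:E).
  apply/measurable_EFinP; apply: measurable_funM.
    exact: measurable_lt1.
  by apply: measurable_funTS; exact: measurable_powR.
apply/andP; split.
  apply: (@lt_le_trans _ _ (\int[leb]_(t in `]2^-1%R, 1%R[) cst (2^-1 `^ (s - 1))%:E t)%E).
    rewrite integral_cst//= lebesgue_measure_itv/= lte_fin invf_lt1 ?ltr1n//.
    by rewrite -EFinB -EFinM lte_fin mulr_gt0 ?powR_gt0//; lra.
  apply: (@le_trans _ _ (\int[leb]_(t in `]2^-1%R, 1%R[) ((t < 1)%R%:R * t `^ (s - 1))%:E)%E).
    apply: le_lower_integral => t; rewrite /= in_itv/= => /andP[t1 t2].
      by rewrite lee_fin powR_ge0.
    by rewrite lee_fin t2 mul1r; apply: le_powR2; [lra|lra|exact: ltW].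
  apply: le_lower_integral_subset.
    by move=> t; rewrite lee_fin mulr_ge0 ?powR_ge0.
  by move=> t; rewrite /= !in_itv/= andbT => /andP[t1 t2]; lra.
apply: (@le_lt_trans _ _ (\int[leb]_(t in `]0%R, +oo[) ((t < 1)%R%:R)%:E)%E).
  apply: le_lower_integral => t; rewrite /= in_itv/= andbT => t0.
    by rewrite lee_fin mulr_ge0 ?powR_ge0.
  rewrite lee_fin; have [t1|_] := ltP t 1; last by rewrite mul0r.
  by rewrite mul1r -[leRHS](powRr0 t); apply: ger_powR; rewrite ?t0 ?(ltW t1)// subr_ge0 ltW.
apply: (@le_lt_trans _ _ (\int[leb]_(t in `]0%R, 1%R[) cst 1%:E t)%E).
  rewrite [leLHS]integral_mkcond [leRHS]integral_mkcond.
  apply: le_lower_integral => t _; rewrite !patchE !mem_setE !in_itv/= andbT.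
    by case: ifPn => //; rewrite lee_fin.
  by case: (ltP 0 t) => _ //=; case: (ltP t 1).
by rewrite integral_cst//= lebesgue_measure_itv/= lte_fin ltr01 mul1e -EFinB ltry.
Qed.

Lemma lorentz_norm_indic p s E : 0 < p -> 1 < s -> measurable E ->
  lorentz_norm mu w p s (EFin \o \1_E) =
  ((fmeas nu E `^ p^-1)%:E * (s%:E * unit_lorentz s) `^ s^-1)%E.
Proof.
move=> p0 s1 mE; have s0 : 0 < s by lra.
rewrite lorentz_normE.
have -> : lorentz_integral (s / p) s (EFin \o \1_E) =
    ((fmeas nu E `^ (s / p))%:E * unit_lorentz s)%E.
  rewrite /unit_lorentz -ge0_integralZl_EFin ?powR_ge0//.
  - apply: eq_integral => t; rewrite inE/= in_itv/= andbT => t0.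
    rewrite (distribution_measurable t (measurable_indic mE)) -EFinM mulrA.
    congr ((_ * _)%:E).
    have [t1|t1] := ltP t 1.
      rewrite mulr1; congr (fmeas _ _ `^ _); apply/seteqP; split => x /=; rewrite indicE.
        by case: (boolP (x \in E)) => [/set_mem//|_]; rewrite normr0 ltNge (ltW t0).
      by move=> Ex; rewrite mem_set// normr1.
    rewrite mulr0 (_ : [set _ | _] = set0) ?/fmeas ?measure0 ?powR0//.
      by rewrite gt_eqF// divr_gt0.
    apply/seteqP; split => // x /=; rewrite indicE => /lt_le_trans/(_ (_ : _ <= 1)).
    have h : `|(x \in E)%:R| <= 1 :> R by case: (x \in E); rewrite ?normr1 ?normr0.
    by move=> /(_ h); rewrite ltNge t1.
  - by move=> t _; rewrite lee_fin mulr_ge0 ?powR_ge0.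
  - apply/measurable_EFinP; apply: measurable_funM.
      exact: measurable_lt1.
    by apply: measurable_funTS; exact: measurable_powR.
have /andP[/ltW k0 _] := unit_lorentz_bounds s1.
rewrite muleCA (@poweRM _ (fmeas nu E `^ (s / p))%:E) ?mule_ge0 ?lee_fin ?powR_ge0 ?(ltW s0)//.
by rewrite poweR_EFin -powRrM mulrAC divff ?gt_eqF// mul1r.
Qed.

End LorentzNorm.

Section GrandLorentzNorm.
Context {R : realType} {disp : measure_display} {T : measurableType disp}.
Variables (mu : {measure set T -> \bar R}) (w : T -> R).
Hypothesis mw : measurable_fun setT w.
Hypothesis w0 : {ae mu, forall x, 0 < w x}.

Local Notation nu := (density_measure mu mw).

Hypothesis fnu : finite_total nu.

Variables (p s theta : R).
Hypotheses (p1 : 1 < p) (s1 : 1 < s) (theta0 : 0 < theta).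

Local Notation N := (grand_lorentz_norm mu w p s theta).
Local Notation dist := (distribution mu w).

Implicit Types (f g : T -> \bar R) (e t c : R) (E F : set T).

Let s0 : 0 < s. Proof. exact: lt_trans ltr01 s1. Qed.

Lemma grand_range e : `]0, p - 1[%classic e -> [/\ 0 < e, e < p - 1 & 1 < p - e].
Proof. by rewrite /= in_itv/= => /andP[e0 ep]; split => //; lra. Qed.

Lemma grand_ge f e : 0 < e -> e < p - 1 ->
  ((e `^ (theta / (p - e)))%:E * lorentz_norm mu w (p - e) s f <= N f)%E.
Proof.
by move=> e0 ep; apply: ereal_sup_ubound; exists e => //=; rewrite in_itv/= e0.
Qed.

Lemma grand_le f (M : \bar R) : (forall e, 0 < e -> e < p - 1 -> 1 < p - e ->
  ((e `^ (theta / (p - e)))%:E * lorentz_norm mu w (p - e) s f <= M)%E) ->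
  (N f <= M)%E.
Proof. by move=> h; apply: ge_ereal_sup => _ [e /grand_range[e0 ep pe] <-]; exact: h. Qed.

Lemma grand_ge0 f : (0 <= N f)%E.
Proof.
have hp := p1; have e0 : 0 < (p - 1) / 2 by lra.
apply: le_trans (grand_ge f e0 _); last by lra.
by apply: mule_ge0; [rewrite lee_fin powR_ge0|exact: (lorentz_norm_ge0 w0 fnu)].
Qed.

Lemma le_grand f g : (forall t, 0 < t -> dist f t <= dist g t) -> (N f <= N g)%E.
Proof.
move=> fg; apply: grand_le => e e0 ep pe; apply: le_trans (grand_ge g e0 ep).
apply: lee_wpmul2l; first by rewrite lee_fin powR_ge0.
by apply: (le_lorentz_norm w0 fnu) => //; exact: lt_trans pe.
Qed.

Lemma le_grand_abs f g : (forall x, `|f x| <= `|g x|)%E -> (N f <= N g)%E.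
Proof.
move=> fg; apply: le_grand => t _; apply: (distribution_subset w0 fnu) => x /=.
by move=> /lt_le_trans; apply.
Qed.

Lemma grand_scale f c : 0 < c -> N (fun x => c%:E * f x)%E = (c%:E * N f)%E.
Proof.
have le h c' : 0 < c' -> (N (fun x => c'%:E * h x)%E <= c'%:E * N h)%E.
  move=> c0; apply: grand_le => e e0 ep pe.
  rewrite (lorentz_norm_scale w0 fnu)// muleCA.
  by apply: lee_wpmul2l; [rewrite lee_fin ltW|exact: grand_ge].
move=> c0; apply/eqP; rewrite eq_le le//=.
have ci0 : 0 < c^-1 by rewrite invr_gt0.
have := le (fun x => c%:E * f x)%E c^-1 ci0.
rewrite (_ : (fun x => _) = f); first by rewrite lee_pdivlMl.
by apply/funext => x; rewrite muleA -EFinM mulVf ?mul1e// gt_eqF.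
Qed.

Lemma grand_split (g g1 g2 : T -> R) :
  measurable_fun setT g -> measurable_fun setT g1 -> measurable_fun setT g2 ->
  (forall x, g x = g1 x \/ g x = g2 x) ->
  (N (EFin \o g) <= 4%:E * (N (EFin \o g1) + N (EFin \o g2)))%E.
Proof.
move=> mg mg1 mg2 gg; apply: grand_le => e e0 ep pe.
have c0 : (0 <= (e `^ (theta / (p - e)))%:E)%E by rewrite lee_fin powR_ge0.
apply: (le_trans (lee_wpmul2l c0 (lorentz_norm_split w0 fnu pe s1 mg mg1 mg2 gg))).
rewrite muleCA; apply: lee_wpmul2l; first by rewrite lee_fin.
rewrite ge0_muleDr; [|exact: (lorentz_norm_ge0 w0 fnu)|exact: (lorentz_norm_ge0 w0 fnu)].
by apply: leeD; exact: grand_ge.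
Qed.

Let unit_fin : ((s%:E * unit_lorentz s) `^ s^-1)%E \is a fin_num /\
  (0 < (s%:E * unit_lorentz s) `^ s^-1)%E.
Proof.
have /andP[k0 ky] := unit_lorentz_bounds s1.
have sk0 : (0 < s%:E * unit_lorentz s)%E by rewrite mule_gt0 ?lte_fin.
split; last exact: poweR_gt0.
apply: fin_num_poweR; rewrite ge0_fin_numE ?(ltW sk0)//.
by rewrite lte_mul_pinfty ?lee_fin ?ltW// fin_numE.
Qed.

(** The ratio of the grand norms of the indicators of two sets is controlled
    at the endpoint exponent [p]: every exponent [p - e] gives a larger power
    of a ratio at most 1. *)
Lemma grand_indic_ratio E F : measurable E -> measurable F -> E `<=` F ->
  0 < fmeas nu F ->
  (N (EFin \o \1_E) <=
   ((fmeas nu E / fmeas nu F) `^ p^-1)%:E * N (EFin \o \1_F))%E.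
Proof.
move=> mE mF EF F0; have [ufin u0] := unit_fin.
apply: grand_le => e e0 ep pe; have pe0 : 0 < p - e by exact: lt_trans pe.
have h := grand_ge (EFin \o \1_F) e0 ep.
rewrite (lorentz_norm_indic w0 fnu pe0 s1 mF) in h.
rewrite (lorentz_norm_indic w0 fnu pe0 s1 mE).
move: ((s%:E * _) `^ s^-1)%E ufin u0 h => u ufin u0 h.
set r := fmeas nu E / fmeas nu F.
have r0 : 0 <= r by rewrite divr_ge0 ?fmeas_ge0.
have r1 : r <= 1 by rewrite ler_pdivrMr// mul1r; exact: le_fmeas.
have rp0 : (0 <= (r `^ p^-1)%:E)%E by rewrite lee_fin powR_ge0.
apply: (le_trans _ (lee_wpmul2l rp0 h)).
rewrite [leLHS]muleA [X in (_ <= _ * X)%E]muleA [leRHS]muleA (lee_pmul2r ufin u0).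
rewrite muleCA; apply: lee_wpmul2l; first by rewrite lee_fin powR_ge0.
rewrite -EFinM lee_fin.
have -> : fmeas nu E = r * fmeas nu F by rewrite /r divfK// gt_eqF.
rewrite powRM ?fmeas_ge0// ler_wpM2r ?powR_ge0//.
move: r0; rewrite le_eqVlt => /predU1P[<-|r0].
  by rewrite powR0 ?powR_ge0// gt_eqF// invr_gt0.
apply: ger_powR; first by rewrite r0.
by rewrite lef_pV2 ?posrE//; lra.
Qed.

Lemma grand_indic_gt0 E : measurable E -> 0 < fmeas nu E -> (0 < N (EFin \o \1_E))%E.
Proof.
move=> mE E0; have [ufin u0] := unit_fin; have hp := p1.
have e0 : 0 < (p - 1) / 2 by lra.
have ep : (p - 1) / 2 < p - 1 by lra.
apply: lt_le_trans (grand_ge _ e0 ep).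
rewrite (lorentz_norm_indic w0 fnu)//; last by lra.
by rewrite !mule_gt0 ?lte_fin ?powR_gt0.
Qed.

Lemma grand_weight_le e : 0 < e -> e < p - 1 -> 1 < p - e ->
  e `^ (theta / (p - e)) <= p `^ theta.
Proof.
move=> e0 ep pe; have hp := p1; apply: (@le_trans _ _ (p `^ (theta / (p - e)))).
  by apply: le_powR2; [rewrite divr_ge0 ?(ltW theta0)//; lra|exact: ltW|lra].
by apply: ler_powR; [exact: ltW|rewrite ler_pdivrMr ?ler_peMr ?(ltW theta0)//; lra].
Qed.

Lemma grand_indic_fin E : measurable E -> (N (EFin \o \1_E) < +oo)%E.
Proof.
move=> mE; have [ufin u0] := unit_fin; have hp := p1.
pose M := p `^ theta * Num.max 1 (fmeas nu E).
apply: (@le_lt_trans _ _ (M%:E * (s%:E * unit_lorentz s) `^ s^-1)%E); last first.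
  by rewrite -(fineK ufin) -EFinM ltry.
apply: grand_le => e e0 ep pe; have pe0 : 0 < p - e by exact: lt_trans pe.
rewrite (lorentz_norm_indic w0 fnu)//.
move: ((s%:E * _) `^ s^-1)%E u0 => u u0.
rewrite muleA; apply: (lee_wpmul2r (ltW u0)).
rewrite -EFinM lee_fin; apply: ler_pM; rewrite ?powR_ge0//.
  exact: grand_weight_le.
apply: (@le_trans _ _ (Num.max 1 (fmeas nu E) `^ (p - e)^-1)).
  by apply: le_powR2; rewrite ?fmeas_ge0 ?invr_ge0 ?(ltW pe0)// le_max lexx orbT.
by apply: ler1_powR; [rewrite le_max lexx|rewrite invf_le1// ltW].
Qed.

Lemma grand_bounded_fin (g : T -> R) c : 0 < c -> (forall x, `|g x| <= c) ->
  (N (EFin \o g) < +oo)%E.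
Proof.
move=> c0 gc; apply: (@le_lt_trans _ _ (c%:E * N (EFin \o \1_setT))%E); last first.
  by rewrite lte_mul_pinfty ?lee_fin ?(ltW c0) ?grand_indic_fin.
rewrite -(grand_scale (EFin \o \1_setT) c0); apply: le_grand => t t0.
apply: (distribution_subset w0 fnu) => x /= /lt_le_trans; apply.
by rewrite indicE in_setT mulr1 lee_fin (le_trans (gc x))// ler_norm.
Qed.

End GrandLorentzNorm.

(** * Boundedness of the maximal operator implies a restricted condition *)

Section Maximal.
Context {R : realType} {disp : measure_display} {T : measurableType disp}.
Variables (mu : {measure set T -> \bar R}) (d : T -> T -> R) (L A Delta : R).
Hypothesis H : dilation_structure mu d L A Delta.
Implicit Types (x y : T) (r c : R) (f : T -> R) (E : set T).

Local Notation ball := (qball d).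
Local Notation m := (fmeas mu).

Lemma average_ball x r (f : T -> \bar R) : 0 < r ->
  average mu (ball x r) f = ((m (ball x r))^-1%:E * \int[mu]_(y in ball x r) f y)%E.
Proof.
move=> r0; rewrite /average fmeasE; [|exact: ds_finite H|exact: (ds_measurable H)].
by rewrite inver gt_eqF// (ball_gt0 H).
Qed.

Lemma maximal_ge f x y r c : 0 < r -> ball x r y ->
  ((c * m (ball x r))%:E <= \int[mu]_(z in ball x r) `|f z|%:E)%E ->
  (c%:E <= maximal mu d f y)%E.
Proof.
move=> r0 yB h; have B0 := ball_gt0 H x r0.
apply: (@le_trans _ _ (average mu (ball x r) (fun z => `|f z|%:E))).
  by rewrite average_ball// lee_pdivlMl// -EFinM mulrC.
by apply: ereal_sup_ubound; exists (ball x r) => //; split => //; exists x, r.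
Qed.

Lemma maximal_ge0 f y : (0 <= maximal mu d f y)%E.
Proof.
have r0 := ds_Delta H.
apply: (@maximal_ge f y y Delta); [by []|exact: (ball_center H)|].
by rewrite mul0r; apply: integral_ge0 => z _; rewrite lee_fin.
Qed.

Lemma maximal_indic_ge E x y r c : measurable E -> 0 < r -> ball x r y ->
  c * m (ball x r) <= m (E `&` ball x r) -> (c%:E <= maximal mu d (\1_E) y)%E.
Proof.
move=> mE r0 yB h; have mB := ds_measurable H x r0.
apply: (maximal_ge r0 yB); apply: (@le_trans _ _ (mu (E `&` ball x r))).
  by rewrite (fmeasE (ds_finite H)) ?lee_fin//; exact: measurableI.
rewrite -(integral_indic mu mB mE); apply: le_lower_integral => z _.
  by rewrite lee_fin.
by rewrite lee_fin ler_norm.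
Qed.

Lemma integral_step (b : nat -> R) (U : nat -> set T) n B : measurable B ->
  (forall i, 0 <= b i) -> (forall i, measurable (U i)) ->
  (\int[mu]_(x in B) (\sum_(0 <= i < n) b i * \1_(U i) x)%:E =
   (\sum_(0 <= i < n) b i * m (U i `&` B))%:E)%E.
Proof.
move=> mB b0 mU; under eq_integral do rewrite -sumEFin.
rewrite ge0_integral_sum//; last 2 first.
- by move=> i; apply/measurable_EFinP; apply: measurable_funM.
- by move=> i x _; rewrite lee_fin mulr_ge0.
rewrite -sumEFin; apply: eq_bigr => i _; under eq_integral do rewrite EFinM.
rewrite ge0_integralZl_EFin//.
  by rewrite integral_indic// EFinM -fmeasE//; [exact: ds_finite H|exact: measurableI].
exact/measurable_EFinP.
Qed.

End Maximal.

Section GeometricSums.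
Context {R : realType}.

Lemma geometric_tail_le (b : R) j n : 0 <= b -> b <= 2^-1 ->
  \sum_(0 <= i < n | (j <= i)%N) b ^+ i <= 2 * b ^+ j.
Proof.
move=> b0 b2; suff: \sum_(0 <= i < n | (j <= i)%N) b ^+ i + 2 * b ^+ maxn n j <= 2 * b ^+ j.
  by have := exprn_ge0 (maxn n j) b0; lra.
elim: n => [|n IH]; first by rewrite big_geq// add0r max0n.
rewrite big_mkcond big_nat_recr//= -big_mkcond/=; case: leqP => jn; last first.
  by rewrite addr0; move: IH; rewrite (maxn_idPr (ltnW jn)) (maxn_idPr jn).
apply: le_trans IH; rewrite -addrA lerD2l (maxn_idPl jn) (maxn_idPl (leqW jn)) exprS.
by have := exprn_ge0 n b0; nra.
Qed.

(** The last [m] terms differ from the first omitted term by a factor at most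
    [b ^+ m = 2]. Taking [b] close to 1 makes [m] as large as desired. *)
Lemma geometric_sum_ge (b : R) m j : 1 <= b -> b ^+ m = 2 -> (m <= j)%N ->
  m%:R / 2 * b ^+ j <= \sum_(0 <= i < j) b ^+ i.
Proof.
move=> b1 bm mj; have b0 : 0 <= b by lra.
rewrite (@big_cat_nat _ _ _ (j - m)%N) ?leq_subr//=.
apply: (@le_trans _ _ (\sum_((j - m)%N <= i < j) b ^+ (j - m))); last first.
  rewrite -[leLHS]add0r; apply: lerD; first by apply: sumr_ge0 => i _; exact: exprn_ge0.
  rewrite [leLHS]big_nat [leRHS]big_nat; apply: ler_sum => i /andP[h _].
  exact: ler_weXn2l.
rewrite sumr_const_nat subKn// -[X in b ^+ X](subnK mj) exprD bm -mulr_natl.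
by have := exprn_ge0 (j - m) b0; nra.
Qed.

End GeometricSums.

Section Necessity.
Context {R : realType} {disp : measure_display} {T : measurableType disp}.
Variables (mu : {measure set T -> \bar R}) (d : T -> T -> R) (L A Delta : R).
Variable x0 : T.
Hypothesis H : dilation_structure mu d L A Delta.
Hypothesis dense : continuous_dense_L1 mu d.
Variable w : T -> R.
Hypothesis mw : measurable_fun setT w.
Hypothesis w0 : {ae mu, forall x, 0 < w x}.

Local Notation nu := (density_measure mu mw).

Hypothesis fnu : finite_total nu.

Variables (p s theta : R).
Hypotheses (p1 : 1 < p) (s1 : 1 < s) (theta0 : 0 < theta).

Local Notation N := (grand_lorentz_norm mu w p s theta).
Local Notation M := (maximal mu d).
Local Notation ball := (qball d).
Local Notation m := (fmeas mu).
Local Notation n := (fmeas nu).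

Implicit Types (x y : T) (r c b : R) (E : set T).

Variable C : R.
Hypothesis C1 : 1 <= C.
Hypothesis bounded : forall f : T -> R, measurable_fun setT f ->
  (N (EFin \o f) < +oo)%E -> (N (M f) <= C%:E * N (EFin \o f))%E.

Let A0 := ds_A0 H.
Let fmu := ds_finite H.
Let C0 : 0 < C. Proof. exact: lt_le_trans ltr01 C1. Qed.

Lemma weight_ball_gt0 x r : 0 < r -> 0 < n (ball x r).
Proof.
move=> r0; have mB := ds_measurable H x r0; apply: fmeas_gt0 => //.
rewrite lt0e measure_ge0 andbT; apply/eqP => /(density_measure_eq0 _ mB) B0.
have := ds_gt0 H x r0; rewrite B0 ?ltxx//.
by apply: filterS w0 => z wz; rewrite gt_eqF.
Qed.

Lemma indic_ratio E x r : 0 < r -> measurable E -> E `<=` ball x r ->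
  (N (EFin \o \1_E) <=
    ((n E / n (ball x r)) `^ p^-1)%:E * N (EFin \o \1_(ball x r)))%E.
Proof.
move=> r0 mE Ex; apply: grand_indic_ratio => //; first exact: (ds_measurable H).
exact: weight_ball_gt0.
Qed.

Lemma indic_ball_fin x r : 0 < r -> (N (EFin \o \1_(ball x r)) < +oo)%E.
Proof. by move=> r0; apply: grand_indic_fin => //; exact: (ds_measurable H). Qed.

Lemma bounded_indic E : measurable E ->
  (N (M (\1_E)) <= C%:E * N (EFin \o \1_E))%E.
Proof. by move=> mE; apply: bounded => //; exact: grand_indic_fin. Qed.

(** A lower bound for the maximal function of [f] on a ball, together with a
    bound for the norm of [f] by the one of the indicator of [E], gives a lower
    bound for the relative weight of [E]. *)
Lemma ratio_lower_bound (h : T -> \bar R) E x r (a D : R) :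
  0 < r -> measurable E -> E `<=` ball x r -> 0 < a -> 0 < D ->
  (forall y, ball x r y -> (a%:E <= h y)%E) ->
  (N h <= D%:E * N (EFin \o \1_E))%E ->
  a <= D * (n E / n (ball x r)) `^ p^-1.
Proof.
move=> r0 mE Ex a0 D0 ha hD.
have mB := ds_measurable H x r0.
have NB0 : (0 < N (EFin \o \1_(ball x r)))%E.
  by apply: grand_indic_gt0 => //; exact: weight_ball_gt0.
have NBf := indic_ball_fin x r0.
have NBfin : N (EFin \o \1_(ball x r)) \is a fin_num by rewrite ge0_fin_numE ?ltW.
have le1 : (a%:E * N (EFin \o \1_(ball x r)) <= N h)%E.
  rewrite -(grand_scale w0 fnu p theta s1 (EFin \o \1_(ball x r)) a0).
  apply: (le_grand_abs w0 fnu) => // y /=; rewrite indicE.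
  have [/set_mem yB|_] := boolP (y \in ball x r); last by rewrite mulr0 normr0 abse_ge0.
  by rewrite mulr1 ger0_norm ?(ltW a0)//; apply: le_trans (ha y yB) (lee_abs _).
have D0' : (0 <= D%:E)%E by rewrite lee_fin ltW.
have := le_trans le1 (le_trans hD (lee_wpmul2l D0' (indic_ratio r0 mE Ex))).
by rewrite muleA -EFinM (lee_pmul2r NBfin NB0) lee_fin.
Qed.

Section TestFunction.
Variables (E : set T) (J : nat) (F : nat -> @ball_family R disp T).
Hypothesis mE : measurable E.
Hypothesis lF : forall j, (j <= J)%N -> level_family mu d L E (level A j) (F j).

Let U j := if (j <= J)%N then dilated_union d L (F j) else set0.

Let mU j : measurable (U j).
Proof.
by rewrite /U; case: ifPn => // jJ; exact: (measurable_dilated_union H (lF jJ)).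
Qed.

Definition test_function b y := \sum_(0 <= i < J.+1) b ^+ i * \1_(U i) y.

Lemma measurable_test_function b : measurable_fun setT (test_function b).
Proof. by apply: measurable_sum => i; apply: measurable_funM. Qed.

Lemma test_function_ge0 b y : 0 <= b -> 0 <= test_function b y.
Proof. by move=> b0; apply: sumr_ge0 => i _; rewrite mulr_ge0 ?exprn_ge0. Qed.

Lemma test_function_le b y j : 0 <= b -> b <= 2^-1 ->
  (forall i, (i < j)%N -> ~ U i y) -> test_function b y <= 2 * b ^+ j.
Proof.
move=> b0 b2 nU; apply: le_trans (geometric_tail_le j J.+1 b0 b2).
rewrite [leRHS]big_mkcond; apply: ler_sum => i _.
rewrite indicE; case: leqP => ij.
  by rewrite ler_piMr ?exprn_ge0//; case: (_ \in _).
by rewrite memNset ?mulr0//; exact: nU.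
Qed.

Lemma test_function_integral b x r : 0 <= b -> 0 < r ->
  (\int[mu]_(y in ball x r) `|test_function b y|%:E =
   (\sum_(0 <= i < J.+1) b ^+ i * m (U i `&` ball x r))%:E)%E.
Proof.
move=> b0 r0; rewrite -(integral_step H _ (ds_measurable H x r0))//; last first.
  by move=> i; exact: exprn_ge0.
by apply: eq_integral => y _; rewrite ger0_norm// test_function_ge0.
Qed.

Lemma maximal_indic_level y j : U j y ->
  ((level A j / A)%:E <= M (\1_E) y)%E.
Proof.
rewrite /U; case: ifPn => // jJ [i Di yi]; have lj := lF jJ; have [sF _ _] := lj.
have rho0 := level_family_gt0 lj Di; have [_ /ltW dn _] := sF i Di.
have Lr0 : 0 < L * radius (F j) i by rewrite mulr_gt0// (ds_L0 H).
apply: (maximal_indic_ge H mE Lr0 yi).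
apply: (@le_trans _ _ (level A j * m (ball (centre (F j) i) (radius (F j) i)))).
  rewrite -mulrA ler_pM2l ?(level_gt0 H)// ler_pdivrMl//.
  exact: (ds_doubling H).
apply: le_trans dn _; apply: le_fmeas => //.
- by apply: measurableI => //; exact: (ds_measurable H).
- by apply: measurableI => //; exact: (ds_measurable H).
- by apply: setIS; exact: (ball_dilate H).
Qed.

(** The maximal function sees all the previous levels at once: each of them
    contributes to the mean over a stopping ball as much as the last one. *)
Lemma maximal_test_function b k y j : 0 < b -> 1 <= level_ratio A * b ->
  (level_ratio A * b) ^+ k = 2 -> (k <= j)%N -> U j y ->
  (((k%:R / 2 / A ^+ 3) * b ^+ j)%:E <= M (test_function b) y)%E.
Proof.
move=> b0 beta1 betak kj; rewrite {1}/U; case: ifPn => // jJ [i Di yi].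
have lj := lF jJ; have [sF _ _] := lj; have rho0 := level_family_gt0 lj Di.
set Nr := level_ratio A in beta1 betak.
have N4 := level_ratio_ge4 H; rewrite -/Nr in N4.
have L0 := ds_L0 H; have A30 : 0 < A ^+ 3 by exact: exprn_gt0.
set rho := radius (F j) i in rho0; set c := centre (F j) i.
have LLr0 : 0 < L * (L * rho) by rewrite !mulr_gt0.
have yB : ball c (L * (L * rho)) y by apply: (ball_dilate H); [rewrite mulr_gt0|exact: yi].
apply: (maximal_ge H LLr0 yB); rewrite (test_function_integral _ (ltW b0) LLr0) lee_fin.
set B := ball c (L * (L * rho)).
have Nj0 : 0 < Nr ^+ j by rewrite exprn_gt0//; lra.
have term l : (l < j)%N -> m B / (A ^+ 3 * Nr ^+ j) * (Nr * b) ^+ l <= b ^+ l * m (U l `&` B).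
  move=> lj'; have lJ : (l <= J)%N by apply: leq_trans (ltnW lj') jJ.
  have tt : A ^+ 3 * level A j <= level A l.
    have := level_lt H lj'; have : 0 < A ^+ 3 * level A j by rewrite mulr_gt0 ?(level_gt0 H).
    by rewrite -mulrA; lra.
  have := stopping_rich x0 H dense mE (level_gt0 H j) tt (level_le_half H l) (sF i Di) (lF lJ).
  rewrite -/c -/rho -/B /U lJ; set X := m (_ `&` B) => h.
  have hB : m B <= A ^+ 2 * m (ball c rho) by exact: (dilate2 H).
  have lA : level A l = Nr ^+ (j - l) * level A j.
    by have := levelD H l (j - l); rewrite subnKC ?(ltnW lj')// => <-.
  have tj0 := level_gt0 H j.
  have Nj : Nr ^+ j = Nr ^+ l * Nr ^+ (j - l) by rewrite -exprD subnKC// ltnW.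
  have hQ : m (ball c rho) <= A * Nr ^+ (j - l) * X.
    by rewrite -(ler_pM2l tj0); apply: le_trans h _; rewrite lA le_eqVlt;
      apply/orP; left; apply/eqP; ring.
  rewrite (exprMn l Nr b) (mulrC (Nr ^+ l)) [leLHS]mulrCA ler_pM2l ?exprn_gt0//.
  rewrite mulrAC ler_pdivrMr ?mulr_gt0// Nj.
  have -> : X * (A ^+ 3 * (Nr ^+ l * Nr ^+ (j - l))) = A ^+ 2 * (A * Nr ^+ (j - l) * X) * Nr ^+ l.
    by ring.
  rewrite ler_pM2r ?exprn_gt0//; last lra.
  by apply: le_trans hB _; rewrite ler_pM2l// exprn_gt0.
apply: (@le_trans _ _ (\sum_(0 <= l < j) b ^+ l * m (U l `&` B))); last first.
  rewrite [leRHS](@big_cat_nat _ _ _ j)//=; last exact: leqW.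
  by rewrite lerDl sumr_ge0// => l _; rewrite mulr_ge0 ?fmeas_ge0 ?exprn_ge0 ?(ltW b0).
apply: (@le_trans _ _ (m B / (A ^+ 3 * Nr ^+ j) * \sum_(0 <= l < j) (Nr * b) ^+ l)).
  apply: (@le_trans _ _ (m B / (A ^+ 3 * Nr ^+ j) * (k%:R / 2 * (Nr * b) ^+ j))).
    have -> : m B / (A ^+ 3 * Nr ^+ j) * (k%:R / 2 * (Nr * b) ^+ j) =
       k%:R / 2 / A ^+ 3 * b ^+ j * m B.
      by rewrite (exprMn j Nr b); field; rewrite !gt_eqF.
    by [].
  apply: ler_wpM2l; first by rewrite divr_ge0 ?fmeas_ge0// mulr_ge0 ?ltW.
  exact: geometric_sum_ge.
by rewrite mulr_sumr [leLHS]big_nat [leRHS]big_nat; apply: ler_sum => l /andP[_ lj']; exact: term.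
Qed.

(** A function that is dominated by a small multiple of its own maximal
    function, except on the first level sets, has a norm controlled by those
    level sets alone. *)
Lemma test_function_norm b k : 0 < b -> b <= 2^-1 -> 1 <= level_ratio A * b ->
  (level_ratio A * b) ^+ k = 2 -> 32 * C * A ^+ 3 <= k%:R ->
  (N (EFin \o test_function b) <=
   (16 * A * C / level A k)%:E * N (EFin \o \1_E))%E.
Proof.
move=> b0 b2 beta1 betak kbig.
have A30 : 0 < A ^+ 3 by exact: exprn_gt0.
have k0 : 0 < k%:R :> R by apply: lt_le_trans kbig; rewrite !mulr_gt0.
have lk0 := level_gt0 H k.
pose G := test_function b; pose K := k%:R / 4 / A ^+ 3.
have K0 : 0 < K by rewrite !divr_gt0.
have G0 y : 0 <= G y by apply: test_function_ge0; exact: ltW.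
have G2 y : G y <= 2.
  by have := @test_function_le b y 0 (ltW b0) b2; rewrite expr0 mulr1; apply.
have mG : measurable_fun setT G by exact: measurable_test_function.
pose V := \bigcup_(i in `I_k) U i.
have mV : measurable V by apply: bigcup_measurable.
pose G1 y := G y * \1_V y; pose Gc y := G y * \1_(~` V) y.
have mG1 : measurable_fun setT G1 by apply: measurable_funM.
have mGc : measurable_fun setT Gc.
  by apply: measurable_funM => //; apply: measurable_indic; exact: measurableC.
have NE := @grand_indic_fin _ _ _ _ _ mw w0 fnu p s theta p1 s1 theta0 E mE.
have NG : (N (EFin \o G) < +oo)%E.
  by apply: (@grand_bounded_fin _ _ _ _ _ mw w0 fnu p s theta p1 s1 theta0 _ 2) => // y;
    rewrite ger0_norm.
have NE0 : (0 <= N (EFin \o \1_E))%E by exact: (grand_ge0 w0 fnu).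
have NG0 : (0 <= N (EFin \o G))%E by exact: (grand_ge0 w0 fnu).
have D10 : 0 < 2 * A / level A k by rewrite divr_gt0// mulr_gt0.
have Ki0 : 0 < K^-1 by rewrite invr_gt0.
have le1 : (N (EFin \o G1) <= (2 * A / level A k)%:E * (C%:E * N (EFin \o \1_E)))%E.
  have D10' : (0 <= (2 * A / level A k)%:E)%E by rewrite lee_fin ltW.
  apply: le_trans (lee_wpmul2l D10' (bounded_indic mE)).
  rewrite -(grand_scale w0 fnu p theta s1 _ D10).
  apply: (le_grand_abs w0 fnu) => // y; rewrite /= /G1 indicE.
  have [/set_mem[i /= ik Uiy]|_] := boolP (y \in V); last by rewrite mulr0 normr0 abse_ge0.
  rewrite mulr1 ger0_norm//; apply: le_trans (lee_abs _).
  apply: (@le_trans _ _ 2%:E); first by rewrite lee_fin.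
  apply: (@le_trans _ _ ((2 * A / level A k)%:E * (level A i / A)%:E)%E).
    rewrite -EFinM lee_fin.
    rewrite (_ : 2 * A / level A k * (level A i / A) = 2 * (level A i / level A k)).
      by rewrite ler_pMr// ler_pdivlMr// mul1r; apply: (level_mono H); exact: ltnW.
    by field; rewrite !gt_eqF.
  by apply: lee_wpmul2l => //; exact: maximal_indic_level.
have le2 : (N (EFin \o Gc) <= (K^-1)%:E * (C%:E * N (EFin \o G)))%E.
  have K0' : (0 <= (K^-1)%:E)%E by rewrite lee_fin ltW.
  apply: le_trans (lee_wpmul2l K0' (bounded mG NG)).
  rewrite -(grand_scale w0 fnu p theta s1 _ Ki0).
  apply: (le_grand_abs w0 fnu) => // y; rewrite /= /Gc indicE.
  have [/set_mem nV|_] := boolP (y \in ~` V); last by rewrite mulr0 normr0 abse_ge0.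
  rewrite mulr1 ger0_norm//; apply: le_trans (lee_abs _).
  have [ex|nex] := pselect (exists j, `[< U j y >]); last first.
    rewrite /G /test_function big1; first by rewrite mule_ge0//; exact: (maximal_ge0 H).
    move=> i _; rewrite indicE memNset ?mulr0// => Uiy.
    by apply: nex; exists i; apply/asboolP.
  case: (ex_minnP ex) => j /asboolP Ujy jmin.
  have kj : (k <= j)%N by rewrite leqNgt; apply/negP => jk; apply: nV; exists j.
  have Gj : G y <= 2 * b ^+ j.
    apply: test_function_le; [exact: ltW|by []|move=> i ij Uiy].
    by have := jmin i; rewrite leqNgt ij => /(_ _)/negP; apply => //; apply/asboolP.
  apply: (@le_trans _ _ ((K^-1)%:E * (k%:R / 2 / A ^+ 3 * b ^+ j)%:E)%E).
    rewrite -EFinM lee_fin; apply: le_trans Gj _.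
    rewrite (_ : K^-1 * (k%:R / 2 / A ^+ 3 * b ^+ j) = 2 * b ^+ j)//.
    by rewrite /K; field; rewrite !gt_eqF.
  by apply: lee_wpmul2l => //; exact: maximal_test_function.
have split : forall y, G y = G1 y \/ G y = Gc y.
  move=> y; rewrite /G1 /Gc !indicE in_setC.
  by case: (y \in V); [left|right]; rewrite mulr1.
have := grand_split w0 fnu p theta s1 mG mG1 mGc split.
have ge1 : (0 <= N (EFin \o G1))%E by exact: (grand_ge0 w0 fnu).
have ge2 : (0 <= N (EFin \o Gc))%E by exact: (grand_ge0 w0 fnu).
have four : (0 <= 4%:E :> \bar R)%E by rewrite lee_fin.
move=> /le_trans/(_ (lee_wpmul2l four (leeD le1 le2))).
rewrite -/G => h; move: NE NG NE0 NG0 h.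
case: (N (EFin \o \1_E)) => [e| |] // _; case: (N (EFin \o G)) => [g| |] // _.
move=> e0 g0 h; rewrite lee_fin in e0; rewrite lee_fin in g0.
have {}h : g <= 4 * (2 * A / level A k * (C * e) + K^-1 * (C * g)).
  by rewrite -lee_fin !(EFinM, EFinD).
rewrite -EFinM lee_fin.
have hK : K^-1 * (C * g) <= g / 8.
  rewrite ler_pdivrMl// mulrC -subr_ge0 /K.
  rewrite (_ : _ - _ = g * (k%:R - 32 * C * A ^+ 3) / (32 * A ^+ 3)); last first.
    by field; rewrite !gt_eqF.
  by rewrite divr_ge0 ?mulr_ge0 ?subr_ge0// ltW.
rewrite (_ : 16 * A * C / level A k * e = 8 * (2 * A / level A k * (C * e))); last first.
  by field; rewrite gt_eqF.
by lra.
Qed.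

End TestFunction.

Theorem bounded_restricted_Muckenhoupt :
  exists2 q, 1 < q < p & restricted_Muckenhoupt mu nu d q.
Proof.
have hp := p1; have p0 : 0 < p by exact: lt_trans hp.
have /andP[p12a p12b] : 1 < (1 + p) / 2 < p by apply/andP; split; lra.
have N4 := level_ratio_ge4 H; have /andP[Ni0 Ni1] := level_ratioV H.
set Nr := level_ratio A in N4 Ni0 Ni1.
have A30 : 0 < A ^+ 3 by exact: exprn_gt0.
have A1 := ds_A H; have A2 : 1 <= 2 * A by lra.
pose k := (Num.bound (32 * C * A ^+ 3)).+1.
have kbig : 32 * C * A ^+ 3 <= k%:R.
  apply: (@le_trans _ _ (Num.bound (32 * C * A ^+ 3))%:R); last by rewrite ler_nat.
  by apply/ltW/archi_boundP; rewrite !mulr_ge0// ltW.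
have k0 : 0 < k%:R :> R by rewrite ltr0n.
(* A geometric sum of ratio [2 ^ (1 / k)] exceeds its next term [k / 2] times,
   which has to beat the norm of the maximal operator. That this ratio is
   larger than 1 gives [delta < 1] below, hence an exponent less than [p]. *)
pose beta : R := 2 `^ k%:R^-1.
have betak : beta ^+ k = 2.
  by rewrite -powR_mulrn ?powR_ge0// -powRrM mulVf ?powRr1// gt_eqF.
have beta1 : 1 < beta.
  rewrite ltNge; apply/negP => h; have := exprn_ile1 k (powR_ge0 _ _) h.
  by rewrite -/beta betak; lra.
have beta2 : beta <= 2.
  by apply: ler1_powR; [lra|rewrite invf_le1// ler1n].
pose b := Nr^-1 * beta.
have Nb : Nr * b = beta by rewrite /b mulVKf// gt_eqF//; lra.
have bNi : Nr^-1 < b by rewrite /b ltr_pMr.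
have b0 : 0 < b by exact: lt_trans bNi.
have b2 : b <= 2^-1 by rewrite /b ler_pdivrMl; lra.
have lnN : ln Nr^-1 < 0 by apply: ln_lt0; rewrite Ni0.
have lnb : ln b < 0 by apply: ln_lt0; rewrite b0/=; lra.
pose delta := ln b / ln Nr^-1.
have bE : b = Nr^-1 `^ delta by apply: exp_eq_powR => //; rewrite lt_eqF.
have delta0 : 0 < delta by rewrite nmulr_rgt0// invr_lt0.
have delta1 : delta < 1.
  by rewrite ltr_ndivrMr// mul1r ltr_ln ?posrE.
pose D1 := C * (16 * A * C / level A k) * (A ^+ 4 * Nr).
pose D := Num.max D1 (2 * A * C).
have lk0 := level_gt0 H k.
have D10 : 0 < C * (16 * A * C / level A k) by rewrite mulr_gt0// divr_gt0// !mulr_gt0.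
have AN0 : 0 < A ^+ 4 * Nr by rewrite mulr_gt0 ?exprn_gt0//; lra.
have AC0 : 0 < 2 * A * C by rewrite !mulr_gt0.
have D0 : 0 < D by rewrite lt_max AC0 orbT.
suff key x r E : 0 < r -> measurable E -> E `<=` ball x r -> 0 < m E ->
    (m E / m (ball x r)) `^ delta <= D * (n E / n (ball x r)) `^ p^-1.
  pose q0 := delta * p.
  have q00 : 0 < q0 by rewrite mulr_gt0.
  have q0p : q0 < p by rewrite /q0 gtr_pMl.
  exists (Num.max q0 ((1 + p) / 2)); first by rewrite lt_max gt_max q0p p12b p12a orbT.
  apply: (restricted_Muckenhoupt_le H q00); first by rewrite le_max lexx.
  exists (D `^ p); first exact: powR_gt0.
  move=> x r E r0 mE Ex; have nB := weight_ball_gt0 x r0.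
  have [mE0|mE0] := eqVneq (m E) 0.
    by rewrite mE0 mul0r powR0 ?gt_eqF// mul0r mulr_ge0 ?fmeas_ge0 ?powR_ge0.
  have {}mE0 : 0 < m E by rewrite lt0r mE0 fmeas_ge0.
  have h := key x r E r0 mE Ex mE0.
  rewrite /q0 powRrM.
  apply: (@le_trans _ _ ((D * (n E / n (ball x r)) `^ p^-1) `^ p * n (ball x r))).
    by rewrite ler_pM2r//; apply: le_powR2; rewrite ?powR_ge0 ?(ltW p0).
  have nr0 : 0 <= n E / n (ball x r) by rewrite divr_ge0 ?fmeas_ge0.
  rewrite (@powRM _ D) ?powR_ge0 ?(ltW D0)// -powRrM mulVf ?gt_eqF// powRr1//.
  by rewrite -mulrA divfK// gt_eqF.
move=> r0 mE Ex mE0; have B0 := ball_gt0 H x r0.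
set a := m E / m (ball x r); set rho := (_ / _) `^ p^-1.
have a0 : 0 < a by rewrite divr_gt0.
have rho0 : 0 <= rho by exact: powR_ge0.
have aE : m E = a * m (ball x r) by rewrite /a divfK// gt_eqF.
have /andP[_ a1] := density_range H r0 mE Ex; rewrite -/a in a1.
have [thick|thin] := ltP 1 (2 * A * a).
  apply: (@le_trans _ _ (2 * A * C * rho)); last first.
    by rewrite ler_wpM2r// /D le_max lexx orbT.
  apply: (@le_trans _ _ (2 * A * a)).
    apply: le_trans (ltW thick); rewrite -[leRHS](powRr0 a).
    by apply: ger_powR; rewrite ?a0// ltW.
  rewrite -!mulrA ler_pM2l// ler_pM2l//.
  apply: (@ratio_lower_bound (M (\1_E)) E x r a C) => //.
    by move=> y yB; apply: (maximal_indic_ge H mE r0 yB); rewrite (setIidl Ex) aE.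
  exact: bounded_indic.
have [J [F [J1 J2 lF locF]]] := level_sequence x0 H r0 mE Ex mE0 thin.
rewrite -/Nr -/a in J1 J2.
pose G := test_function J F b.
have LLr0 : 0 < L * (L * r) by rewrite !mulr_gt0 ?(ds_L0 H).
have low y : ball x r y -> ((b ^+ J / (A ^+ 4 * Nr))%:E <= M G y)%E.
  move=> yB; have yBB : ball x (L * (L * r)) y.
    by apply: (ball_dilate H); [rewrite mulr_gt0 ?(ds_L0 H)|exact: (ball_dilate H)].
  apply: (maximal_ge H LLr0 yBB); rewrite (test_function_integral lF _ (ltW b0) LLr0).
  rewrite lee_fin big_nat_recr//= leqnn (setIidl (locF J (leqnn J))).
  apply: (@le_trans _ _ (b ^+ J * m (dilated_union d L (F J)))); last first.
    by rewrite lerDr sumr_ge0// => i _; rewrite mulr_ge0 ?fmeas_ge0 ?exprn_ge0 ?(ltW b0).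
  rewrite -mulrA ler_pM2l ?exprn_gt0// ler_pdivrMl//.
  have h1 := dilate2 H x r0.
  have h2 := level_rich x0 H dense mE (level_gt0 H J) (level_le_half H J) (lF J (leqnn J)).
  set u := m (dilated_union d L (F J)) in h2 *.
  have u0 : 0 <= u by exact: fmeas_ge0.
  have tJ : level A J < Nr * A * a.
    move: J2; have -> : Nr * (2 * A * a) = 2 * (Nr * A * a) by ring.
    by rewrite /level -/Nr ltr_pdivrMl.
  have h3 : a * m (ball x r) <= a * (A ^+ 2 * Nr * u).
    rewrite -aE; apply: le_trans h2 _.
    have -> : a * (A ^+ 2 * Nr * u) = A * (Nr * A * a) * u by ring.
    by rewrite ler_wpM2r// ler_pM2l// ltW.
  apply: le_trans h1 _; rewrite -(ler_pM2l a0).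
  have -> : a * (A ^+ 4 * Nr * u) = A ^+ 2 * (a * (A ^+ 2 * Nr * u)) by ring.
  by rewrite mulrCA ler_pM2l ?exprn_gt0.
have mG : measurable_fun setT G by exact: (measurable_test_function lF).
have NG : (N (EFin \o G) < +oo)%E.
  apply: (@grand_bounded_fin _ _ _ _ _ mw w0 fnu p s theta p1 s1 theta0 _ 2) => // y.
  rewrite ger0_norm; last by apply: test_function_ge0; exact: ltW.
  by have := @test_function_le J F b y 0 (ltW b0) b2; rewrite expr0 mulr1; apply.
have bJ0 : 0 < b ^+ J / (A ^+ 4 * Nr) by rewrite divr_gt0 ?exprn_gt0.
have normG : (N (M G) <= (C * (16 * A * C / level A k))%:E * N (EFin \o \1_E))%E.
  apply: le_trans (bounded mG NG) _; rewrite EFinM -muleA.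
  apply: lee_wpmul2l; first by rewrite lee_fin ltW.
  by apply: (test_function_norm mE lF) => //; rewrite -/Nr Nb// ltW.
have h := ratio_lower_bound r0 mE Ex bJ0 D10 low normG.
rewrite ler_pdivrMr// mulrAC in h.
apply: (@le_trans _ _ (b ^+ J)); last first.
  by apply: le_trans h _; rewrite ler_wpM2r// le_max lexx.
rewrite bE -powR_mulrn ?powR_ge0// powRAC powR_mulrn ?(ltW Ni0)//.
apply: le_powR2; [exact: ltW|exact: ltW|apply: le_trans J1].
by rewrite ler_peMl ?(ltW a0).
Qed.

End Necessity.

(** * From a restricted condition with smaller exponent to the Muckenhoupt condition *)

Section Layers.
Context {R : realType} {disp : measure_display} {T : measurableType disp}.
Variable mu : {measure set T -> \bar R}.

Lemma geometric_eseries_le (a z : R) : 0 <= a -> 0 <= z < 1 ->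
  (\sum_(k <oo) (a * z ^+ k)%:E <= (a / (1 - z))%:E)%E.
Proof.
move=> a0 /andP[z0 z1].
have t0 k : (0 <= (a * z ^+ k)%:E)%E by rewrite lee_fin mulr_ge0 ?exprn_ge0.
apply: lime_le; first by apply: is_cvg_nneseries => n _ _; exact: t0.
apply: nearW => n; rewrite sumEFin lee_fin -mulr_sumr ler_wpM2l//.
suff -> : \sum_(0 <= i < n) z ^+ i = (1 - z ^+ n) / (1 - z).
  by rewrite ler_pdivrMr ?mulVf ?gt_eqF ?subr_gt0// gerBl exprn_ge0.
elim: n => [|n IH]; first by rewrite big_geq// expr0 subrr mul0r.
by rewrite big_nat_recr//= IH exprSr; field; rewrite subr_eq0 gt_eqF.
Qed.

(** A nonnegative function is at most [2 ^ (k + 1) * u] at a point where [k] is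
    the last index with [2 ^ k * u < f]; the layers contribute a geometric
    series of ratio [2 * z]. *)
Lemma layer_bound (f : T -> R) (B : set T) (u D z : R) :
  finite_total mu -> measurable_fun setT f -> measurable B ->
  (forall x, 0 <= f x) -> 0 < u -> 0 <= D -> 0 <= z < 2^-1 ->
  (forall k, fmeas mu (B `&` [set x | 2 ^+ k * u < f x]) <= D * z ^+ k) ->
  (\int[mu]_(x in B) (f x)%:E <=
   (u * fmeas mu B + 2 * u * D / (1 - 2 * z))%:E)%E.
Proof.
move=> fmu mf mB f0 u0 D0 /andP[z0 z2] hk.
pose S k := [set x | 2 ^+ k * u < f x].
have mS k : measurable (S k).
  rewrite (_ : S k = f @^-1` `]2 ^+ k * u, +oo[).
    by rewrite -[X in measurable X]setTI; exact: mf.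
  by apply/seteqP; split => x /=; rewrite in_itv/= andbT.
have a0 k : 0 <= 2 ^+ k.+1 * u by rewrite mulr_ge0 ?exprn_ge0 ?(ltW u0).
pose h k x := (2 ^+ k.+1 * u * \1_(S k) x)%:E : \bar R.
have h0 k x : (0 <= h k x)%E by rewrite lee_fin mulr_ge0.
have mh k (E : set T) : measurable_fun E (h k).
  by apply/measurable_EFinP; apply: measurable_funM.
have pt x : ((f x)%:E <= u%:E + \sum_(k <oo) h k x)%E.
  have [fu|uf] := leP (f x) u.
    by apply: (@le_trans _ _ u%:E); [rewrite lee_fin|rewrite leeDl// nneseries_ge0].
  have ex0 : exists k, 2 ^+ k * u < f x by exists 0%N; rewrite expr0 mul1r.
  have [k0 hk0] := pow2_ge (f x / u).
  have ub k : 2 ^+ k * u < f x -> (k <= k0)%N.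
    rewrite leqNgt => hlt; apply/negP => kk; move: hlt; rewrite ltNge => /negP; apply.
    move: hk0; rewrite ler_pdivrMr// => /le_trans; apply; rewrite ler_pM2r//.
    by apply: ler_weXn2l; [lra|exact: ltnW].
  case: (ex_maxnP ex0 ub) => k hkx kmax.
  apply: (@le_trans _ _ (h k x)).
    rewrite /h indicE mem_set ?mulr1//= lee_fin leNgt; apply/negP => /kmax.
    by rewrite ltnn.
  apply: (@le_trans _ _ (\sum_(k <oo) h k x)%E); last by rewrite leeDr// lee_fin ltW.
  apply: le_trans (nneseries_lim_ge k.+1 _) => //; rewrite big_nat_recr//=.
  by rewrite leeDr// sume_ge0.
apply: (@le_trans _ _ (\int[mu]_(x in B) (u%:E + \sum_(k <oo) h k x))%E).
  by apply: le_lower_integral => x _; rewrite ?lee_fin.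
rewrite ge0_integralD//; last 3 first.
- by move=> x _; rewrite lee_fin ltW.
- by move=> x _; exact: nneseries_ge0.
- by apply: ge0_emeasurable_sum => // k x _ _; exact: h0.
rewrite integral_cst// EFinD EFinM -fmeasE//; apply: leeD => //.
rewrite integral_nneseries//.
apply: (@le_trans _ _ (\sum_(k <oo) (2 * u * D * (2 * z) ^+ k)%:E)%E).
  apply: lee_nneseries => k _; first by move=> _; exact: integral_ge0.
  rewrite /h; under eq_integral do rewrite EFinM.
  rewrite ge0_integralZl_EFin//; last exact/measurable_EFinP.
  rewrite integral_indic// setIC fmeasE//; last exact: measurableI.
  rewrite -EFinM lee_fin exprMn exprS.
  have -> : 2 * u * D * (2 ^+ k * z ^+ k) = 2 * 2 ^+ k * u * (D * z ^+ k) by ring.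
  apply: ler_wpM2l; last exact: hk.
  by rewrite !mulr_ge0 ?exprn_ge0 ?(ltW u0).
by apply: geometric_eseries_le; [rewrite !mulr_ge0// ltW|lra].
Qed.

End Layers.

Section RestrictedImpliesMuckenhoupt.
Context {R : realType} {disp : measure_display} {T : measurableType disp}.
Variables (mu : {measure set T -> \bar R}) (d : T -> T -> R) (L A Delta : R).
Hypothesis H : dilation_structure mu d L A Delta.
Variable w : T -> R.
Hypothesis mw : measurable_fun setT w.
Hypothesis w0 : {ae mu, forall x, 0 < w x}.

Local Notation nu := (density_measure mu mw).

Hypothesis fnu : finite_total nu.

Variables (p q : R).
Hypotheses (q1 : 1 < q) (qp : q < p).

Local Notation ball := (qball d).
Local Notation m := (fmeas mu).
Local Notation n := (fmeas nu).

Let fmu := ds_finite H.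

(** The restricted condition with exponent [q] bounds the distribution of the
    dual weight on a ball by a power of order [(p - 1) / (q - 1)], which is
    larger than 1, so that the dual weight is integrable with the right
    bound. *)
Theorem restricted_implies_Muckenhoupt :
  restricted_Muckenhoupt mu nu d q -> Muckenhoupt mu d p w.
Proof.
move=> [K K0 KP]; have hq := q1; have hqp := qp.
have p10 : 0 < p - 1 by lra.
have q10 : 0 < q - 1 by lra.
pose z : R := 2 `^ (- ((p - 1) / (q - 1))).
have z0 : 0 < z by rewrite powR_gt0.
have z2 : z < 2^-1.
  rewrite /z powRN ltf_pV2 ?posrE ?powR_gt0// -[ltLHS]powRr1//.
  rewrite /powR gt_eqF// ltr_expR ltr_pM2r ?ln_gt0 ?ltr1n//.
  by rewrite ltr_pdivlMr//; lra.
pose K1 := K `^ (q - 1)^-1.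
have K10 : 0 < K1 by rewrite powR_gt0.
pose C1 := 1 + 2 * K1 / (1 - 2 * z).
have C10 : 0 < C1 by rewrite addr_gt0// divr_gt0 ?mulr_gt0//; lra.
apply: (@le_lt_trans _ _ (C1 `^ (p - 1))%:E); last exact: ltry.
apply: ge_ereal_sup => _ [_ [x [r [r0 ->]]] <-].
have B0 := ball_gt0 H x r0; have mB := ds_measurable H x r0.
have W0 := weight_ball_gt0 H w0 fnu x r0.
set mb := m (ball x r) in B0 *; set W := n (ball x r) in W0.
rewrite !(average_ball H)// -/mb.
have -> : (\int[mu]_(y in ball x r) (w y)%:E = W%:E)%E.
  by rewrite -[LHS]/(wmeasure mu w _) (wmeasureE mw w0 mB) (fmeasE fnu mB).
have conj : 1 - conjugate_exponent p = - (p - 1)^-1.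
  by rewrite /conjugate_exponent; field; rewrite gt_eqF.
pose sg y := w y `^ (1 - conjugate_exponent p) * \1_[set y | 0 < w y] y.
have mpos : measurable [set y | 0 < w y].
  rewrite (_ : [set _ | _] = w @^-1` `]0, +oo[).
    by rewrite -[X in measurable X]setTI; exact: mw.
  by apply/seteqP; split => y /=; rewrite in_itv/= andbT.
have mwp : measurable_fun setT (fun y => w y `^ (1 - conjugate_exponent p)).
  apply: (@measurableT_comp _ _ _ _ _ _ (fun u : R => u `^ (1 - conjugate_exponent p))).
    exact: measurable_powR.
  exact: mw.
have msg : measurable_fun setT sg by exact: measurable_funM.
have sg0 y : 0 <= sg y by rewrite mulr_ge0 ?powR_ge0.
have -> : (\int[mu]_(y in ball x r) (w y `^ (1 - conjugate_exponent p))%:E =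
           \int[mu]_(y in ball x r) (sg y)%:E)%E.
  apply: ge0_ae_eq_integral => //.
  - by apply/measurable_EFinP; exact: measurable_funTS.
  - by apply/measurable_EFinP; exact: measurable_funTS.
  - by move=> y _; rewrite lee_fin powR_ge0.
  - by move=> y _; rewrite lee_fin.
  - by apply: filterS w0 => y wy _; rewrite /sg indicE mem_set// mulr1.
pose u := (mb / W) `^ (p - 1)^-1.
have u0 : 0 < u by rewrite powR_gt0// divr_gt0.
have up : u `^ (p - 1) = mb / W.
  by rewrite -powRrM mulVf ?gt_eqF// powRr1// divr_ge0// ltW.
have key k : m (ball x r `&` [set y | 2 ^+ k * u < sg y]) <= K1 * mb * z ^+ k.
  set E := _ `&` _.
  have mE : measurable E.
    apply: measurableI => //; rewrite (_ : [set _ | _] = sg @^-1` `]2 ^+ k * u, +oo[).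
      by rewrite -[X in measurable X]setTI; exact: msg.
    by apply/seteqP; split => y /=; rewrite in_itv/= andbT.
  have v0 : 0 < 2 ^+ k * u by rewrite mulr_gt0// exprn_gt0.
  have nE : n E <= (2 ^+ k * u) `^ (- (p - 1)) * m E.
    rewrite -lee_fin EFinM -!fmeasE//; apply: density_measure_le; rewrite ?powR_ge0//.
    move=> y [_ /=]; rewrite /sg indicE; case: (boolP (y \in _)) => [/set_mem/= wy|_]; last first.
      by rewrite mulr0 ltNge (ltW v0).
    rewrite mulr1 conj gtr0_norm// => hy.
    rewrite powRN in hy; set c := w y `^ _ in hy; have c0 : 0 < c by exact: powR_gt0.
    have -> : w y = c `^ (p - 1) by rewrite -powRrM mulVf ?powRr1 ?(ltW wy)// gt_eqF.
    rewrite powRN -[leRHS]mul1r ler_pdivlMr ?powR_gt0// -powRM ?(ltW c0) ?(ltW v0)//.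
    have := @le_powR2 R (p - 1) (c * (2 ^+ k * u)) 1 (ltW p10); rewrite powR1; apply.
      by rewrite mulr_ge0 ?ltW.
    by rewrite -ler_pdivlMl// mulr1 ltW.
  have := KP x r E r0 mE (@subIsetl _ _ _); rewrite -/mb -/W.
  have [mE0|mE0] := eqVneq (m E) 0.
    by move=> _; rewrite mE0 !mulr_ge0 ?exprn_ge0 ?(ltW z0) ?(ltW K10) ?(ltW B0).
  have {}mE0 : 0 < m E by rewrite lt0r mE0 fmeas_ge0.
  set a := m E / mb => h; have a0 : 0 < a by rewrite divr_gt0.
  have aE : m E = a * mb by rewrite /a divfK// gt_eqF.
  rewrite aE [leRHS]mulrAC ler_pM2r//.
  have zE : z ^+ k = (2 ^+ k) `^ (- ((p - 1) / (q - 1))).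
    by rewrite -(powR_mulrn k (ltW z0)) -(powR_mulrn k (ler0n R 2)) /z powRAC.
  have h2 : a `^ (q - 1) <= K * (2 ^+ k) `^ (- (p - 1)).
    have := le_trans h (ler_wpM2l (ltW K0) nE).
    rewrite powRM ?exprn_ge0 ?(ltW u0)// (powRN u) up aE -(mulr_powRB1 (ltW a0)); last lra.
    have -> : K * ((2 ^+ k) `^ (- (p - 1)) * (mb / W)^-1 * (a * mb)) =
      a * (K * (2 ^+ k) `^ (- (p - 1))) * W by field; rewrite !gt_eqF.
    by rewrite (ler_pM2r W0) ler_pM2l.
  have := le_powR_inv q10 (ltW a0) _ h2; rewrite mulr_ge0 ?powR_ge0 ?(ltW K0)// => /(_ isT).
  rewrite powRM ?powR_ge0 ?(ltW K0)// -/K1 -powRrM zE.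
  by rewrite mulNr.
have hz : 0 <= z < 2^-1 by rewrite (ltW z0).
have := layer_bound fmu msg mB sg0 u0 (mulr_ge0 (ltW K10) (ltW B0)) hz key.
rewrite -/mb => hint.
have int0 : (0 <= \int[mu]_(y in ball x r) (sg y)%:E)%E.
  by apply: integral_ge0 => y _; rewrite lee_fin.
have avg : ((mb^-1)%:E * \int[mu]_(y in ball x r) (sg y)%:E <= (u * C1)%:E)%E.
  rewrite lee_pdivrMl// -EFinM; apply: le_trans hint _; rewrite lee_fin.
  by rewrite le_eqVlt; apply/orP; left; apply/eqP; rewrite /C1; field; lra.
have mi0 : (0 <= (mb^-1)%:E)%E by rewrite lee_fin invr_ge0 ltW.
apply: (@le_trans _ _ ((mb^-1)%:E * W%:E * ((u * C1)%:E `^ (p - 1)))%E).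
  apply: lee_wpmul2l; first by rewrite mule_ge0// lee_fin ltW.
  by apply: le_poweR2; [exact: ltW|exact: mule_ge0|exact: avg].
rewrite poweR_EFin -!EFinM lee_fin powRM ?(ltW u0) ?(ltW C10)// up.
by rewrite le_eqVlt; apply/orP; left; apply/eqP; field; rewrite !gt_eqF.
Qed.

End RestrictedImpliesMuckenhoupt.

(** * From a restricted condition to the boundedness of the maximal operator *)

Section Sufficiency.
Context {R : realType} {disp : measure_display} {T : measurableType disp}.
Variables (mu : {measure set T -> \bar R}) (d : T -> T -> R) (L A Delta : R).
Variable x0 : T.
Hypothesis H : dilation_structure mu d L A Delta.
Variable w : T -> R.
Hypothesis mw : measurable_fun setT w.
Hypothesis w0 : {ae mu, forall x, 0 < w x}.

Local Notation nu := (density_measure mu mw).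
Local Notation leb := (@lebesgue_measure R).

Hypothesis fnu : finite_total nu.

Local Notation ball := (qball d).
Local Notation m := (fmeas mu).
Local Notation n := (fmeas nu).
Local Notation M := (maximal mu d).
Local Notation dist := (distribution mu w).

Implicit Types (x y : T) (r t : R) (f : T -> R).

Let fmu := ds_finite H.
Let A0 := ds_A0 H.
Let L0 := ds_L0 H.

Variables (q q' : R).
Hypotheses (q1 : 1 < q) (qq' : q < q').
Hypothesis restricted : restricted_Muckenhoupt mu nu d q.

(** If the mean of [f] over a ball exceeds [t] then, for some [k], the layer
    where [f] exceeds [2 ^ k * (t / 2)] fills a proportion of the ball that is
    not much smaller than [2 ^ (- k)]. The loss, any power of [2 ^ k] that is
    larger than the first, is paid by passing from [q] to a larger exponent. *)
Lemma large_average_layer : exists2 C, 0 < C & forall f x r t,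
  measurable_fun setT f -> 0 < r -> 0 < t ->
  (t%:E < average mu (ball x r) (fun y => `|f y|%:E))%E ->
  exists k : nat, n (ball x (L * r)) <=
    C * (2 `^ ((q + q') / 2)) ^+ k *
      n ([set y | 2 ^+ k * (t / 2) < `|f y|] `&` ball x r).
Proof.
have [K K0 KP] := restricted; have hq1 := q1; have hqq := qq'.
pose q2 := (q + q') / 2; have q20 : q < q2 by rewrite /q2; lra.
pose z : R := 2 `^ (- (q2 / q)).
have z0 : 0 < z by rewrite powR_gt0.
have z2 : z < 2^-1.
  rewrite /z powRN ltf_pV2 ?posrE ?powR_gt0// -[ltLHS]powRr1//.
  rewrite /powR gt_eqF// ltr_expR ltr_pM2r ?ln_gt0 ?ltr1n//.
  by rewrite ltr_pdivlMr//; lra.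
pose c := (1 - 2 * z) / 2; have c0 : 0 < c by rewrite /c; lra.
have q0 : 0 < q by lra.
exists (K * (A / c) `^ q); first by rewrite mulr_gt0// powR_gt0// divr_gt0.
move=> f x r t mf r0 t0 avg; apply/not_existsP => no.
have mB := ds_measurable H x r0; have B0 := ball_gt0 H x r0.
have Lr0 : 0 < L * r by rewrite mulr_gt0.
have mLB := ds_measurable H x Lr0; have LB0 := ball_gt0 H x Lr0.
have mf' : measurable_fun setT (fun y => `|f y|) by exact: measurableT_comp.
have small k : m (ball x r `&` [set y | 2 ^+ k * (t / 2) < `|f y|]) <=
    c * m (ball x r) * z ^+ k.
  rewrite leNgt; apply/negP => big; apply: (no k).
  set E := _ `&` _ in big; rewrite setIC -/E.
  have mE : measurable E.
    apply: measurableI => //.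
    rewrite (_ : [set _ | _] = (fun y => `|f y|) @^-1` `]2 ^+ k * (t / 2), +oo[).
      by rewrite -[X in measurable X]setTI; exact: mf'.
    by apply/seteqP; split => y /=; rewrite in_itv/= andbT.
  have EL : E `<=` ball x (L * r).
    by apply: subset_trans (ball_dilate H r0); exact: subIsetl.
  have := KP x (L * r) E Lr0 mE EL.
  set a := m E / m (ball x (L * r)) => h.
  have ha : c / A * z ^+ k <= a.
    rewrite ler_pdivlMr//; apply: le_trans (ltW big).
    have := ds_doubling H x r0; rewrite -(ler_pM2l (_ : 0 < c / A * z ^+ k)); last first.
      by rewrite mulr_gt0 ?exprn_gt0// divr_gt0.
    move=> /le_trans; apply; rewrite le_eqVlt; apply/orP; left; apply/eqP.
    by field; rewrite gt_eqF.
  have c1 : 0 < c / A * z ^+ k by rewrite mulr_gt0 ?exprn_gt0// divr_gt0.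
  have := le_powR2 (ltW q0) (ltW c1) ha => h2.
  have aq0 : 0 < (c / A * z ^+ k) `^ q by exact: powR_gt0.
  have h3 : (c / A * z ^+ k) `^ q * n (ball x (L * r)) <= K * n E.
    by apply: le_trans h; rewrite ler_wpM2r ?fmeas_ge0.
  have e : (c / A * z ^+ k) `^ q * ((A / c) `^ q * (2 `^ q2) ^+ k) = 1.
    have cA0 : 0 <= c / A by apply: divr_ge0; exact: ltW.
    have Ac0 : 0 <= A / c by apply: divr_ge0; exact: ltW.
    rewrite (powRM _ cA0 (exprn_ge0 k (ltW z0))).
    have -> : (z ^+ k) `^ q = ((2 `^ q2) ^+ k)^-1.
      rewrite -(powR_mulrn k (ltW z0)) powRAC /z -(powRrM 2 _ q) mulNr divfK ?gt_eqF//.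
      by rewrite powRN powR_mulrn ?invr_ge0 ?powR_ge0// exprVn.
    rewrite mulrACA mulVf ?expf_neq0 ?gt_eqF ?powR_gt0// mulr1 -(powRM _ cA0 Ac0).
    by rewrite mulrA divfK ?gt_eqF// divff ?gt_eqF// powR1.
  rewrite -(ler_pM2l aq0); apply: le_trans h3 _.
  have -> : (c / A * z ^+ k) `^ q * (K * (A / c) `^ q * (2 `^ q2) ^+ k * n E) =
     ((c / A * z ^+ k) `^ q * ((A / c) `^ q * (2 `^ q2) ^+ k)) * (K * n E) by ring.
  by rewrite e mul1r.
have hz : 0 <= z < 2^-1 by rewrite (ltW z0).
have t20 : 0 < t / 2 by lra.
have := layer_bound fmu mf' mB (fun y => normr_ge0 (f y)) t20
  (mulr_ge0 (ltW c0) (ltW B0)) hz small.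
move: avg; rewrite (average_ball H)// lte_pdivlMl// -EFinM => /lt_le_trans h /h.
rewrite lte_fin ltNge => /negP; apply; rewrite le_eqVlt; apply/orP; left; apply/eqP.
by rewrite /c; field; lra.
Qed.

(** The balls of large mean are distributed over the layers and the Vitali
    lemma is applied in each layer separately; the difference between [q'] and
    the exponent of [large_average_layer] makes the sum over the layers
    converge. *)
Lemma maximal_distribution_le : exists2 C, 1 <= C & forall f t S,
  measurable_fun setT f -> 0 < t -> 0 <= S ->
  (forall k : nat, (2 `^ q') ^+ k * dist (EFin \o f) (2 ^+ k * (t / 2)) <= S) ->
  dist (M f) t <= C * S.
Proof.
have [C C0 CP] := large_average_layer; have hq1 := q1; have hqq := qq'.
pose q2 := (q + q') / 2.
pose z : R := 2 `^ (q2 - q').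
have z0 : 0 < z by rewrite powR_gt0.
have z1 : z < 1.
  rewrite /z /powR gt_eqF// expR_lt1 pmulr_llt0 ?ln_gt0 ?ltr1n//.
  by rewrite /q2; lra.
exists (Num.max 1 (C / (1 - z))); first by rewrite le_max lexx.
move=> f t S mf t0 S0 hS.
pose E k := [set y | 2 ^+ k * (t / 2) < `|f y|].
have mf' : measurable_fun setT (fun y => `|f y|) by exact: measurableT_comp.
have mE k : measurable (E k).
  rewrite (_ : E k = (fun y => `|f y|) @^-1` `]2 ^+ k * (t / 2), +oo[).
    by rewrite -[X in measurable X]setTI; exact: mf'.
  by apply/seteqP; split => y /=; rewrite in_itv/= andbT.
pose P k x r := 0 < r <= Delta /\ n (ball x (L * r)) <= C * (2 `^ q2) ^+ k * n (E k `&` ball x r).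
have cov k : exists V : set T, [/\ measurable V, forall x r, P k x r -> ball x r `<=` V &
    n V <= C * (2 `^ q2) ^+ k * n (E k)].
  have [|c [rho [D [DP tD DU]]]] := vitali_covering x0 H (P := P k); first by move=> x r [].
  have rho0 i : D i -> 0 < rho i by move=> /DP[/andP[]].
  have mLB i : D i -> measurable (ball (c i) (L * rho i)).
    by move=> Di; apply: (measurable_dilate H); exact: rho0.
  exists (\bigcup_(i in D) ball (c i) (L * rho i)); split.
  - exact: bigcup_measurable.
  - by move=> x r /DU[i Di sub]; apply: subset_trans sub _; exact: bigcup_sup Di.
  - apply: (@le_fmeas_bigcup _ _ _ _ _ _ _ (fun i => ball (c i) (rho i))) => //.
    + by rewrite mulr_ge0 ?exprn_ge0 ?powR_ge0// ltW.
    + by move=> i Di; apply: (ds_measurable H); exact: rho0.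
    + by move=> i /DP[].
have [V VP] := choice cov.
have mV k : measurable (V k) by have [] := VP k.
have mVU : measurable (\bigcup_k V k) by exact: bigcupT_measurable.
have sub : [set x | (t%:E < `|M f x|)%E] `<=` \bigcup_k V k.
  move=> x /=; rewrite gee0_abs ?(maximal_ge0 H)//.
  move=> /ereal_sup_gt[_ [B [[y [r [r0 BE]]] Bx] <-]] avg.
  pose r' := Num.min r Delta.
  have r'0 : 0 < r' by rewrite lt_min r0 (ds_Delta H).
  have BE' : B = ball y r'.
    rewrite BE /r'; case: (leP r Delta) => // Dr.
    by rewrite !(ds_diameter H)// ltW.
  rewrite BE' in avg Bx; have [k hk] := CP f y r' t mf r'0 t0 avg.
  exists k => //; have [_ h _] := VP k; apply: (h y r') => //.
  by split => //; rewrite r'0 ge_min lexx orbT.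
apply: le_trans (distribution_le w0 fnu mVU sub) _.
apply: (@le_trans _ _ (C / (1 - z) * S)); last by rewrite ler_wpM2r// le_max lexx orbT.
rewrite -lee_fin -fmeasE//; apply: le_trans (generalized_Boole_inequality nu mV mVU) _.
apply: (@le_trans _ _ (\sum_(k <oo) (C * S * z ^+ k)%:E)%E).
  apply: lee_nneseries => // k _; rewrite fmeasE// lee_fin.
  have [_ _ h] := VP k; apply: le_trans h _.
  have -> : n (E k) = dist (EFin \o f) (2 ^+ k * (t / 2)).
    by rewrite (distribution_measurable mw w0).
  have -> : (2 `^ q2) ^+ k = z ^+ k * (2 `^ q') ^+ k.
    rewrite -exprMn /z -powRD; first by rewrite subrK.
    by apply/implyP => _; rewrite pnatr_eq0.
  have -> : C * S * z ^+ k = C * z ^+ k * S by ring.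
  rewrite [C * (_ * _)]mulrA -[leLHS]mulrA.
  apply: ler_wpM2l; last exact: hS.
  by rewrite mulr_ge0 ?exprn_ge0 ?(ltW z0)// ltW.
rewrite mulrAC; apply: geometric_eseries_le; first by rewrite mulr_ge0// ltW.
by rewrite (ltW z0).
Qed.

Lemma measurable_scaled_integrand (f : T -> \bar R) (sigma s c : R) : 0 < c ->
  measurable_fun (`]0, +oo[%classic : set R)
    (fun t => (dist f (c * t) `^ sigma * t `^ (s - 1))%:E).
Proof.
move=> c0; apply/measurable_EFinP; apply: measurable_funM; last first.
  by apply: measurable_funTS; exact: measurable_powR.
apply: (@measurableT_comp _ _ _ _ _ _ (fun u : R => u `^ sigma)).
  exact: measurable_powR.
apply: nonincreasing_measurable => // t t' tt'.
by apply: (distribution_nonincreasing w0 fnu); rewrite ler_pM2l.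
Qed.

(** Marcinkiewicz interpolation on the Lorentz scale, with constants uniform
    in the exponents that stay away from [q']. *)
Lemma maximal_lorentz (r0 s : R) : 1 < s -> q' < r0 -> exists2 C, 0 < C &
  forall r f, r0 <= r -> measurable_fun setT f ->
  (lorentz_norm mu w r s (M f) <= C%:E * lorentz_norm mu w r s (EFin \o f))%E.
Proof.
move=> s1 qr0; have [C C1 CP] := maximal_distribution_le.
have hq1 := q1; have hqq := qq'; have s0 : 0 < s by lra.
have r00 : 0 < r0 by lra.
pose z : R := 2 `^ (s * (q' / r0) - s).
have z0 : 0 < z by rewrite powR_gt0.
have z1 : z < 1.
  rewrite /z /powR gt_eqF// expR_lt1 pmulr_llt0 ?ln_gt0 ?ltr1n//.
  by rewrite subr_lt0 gtr_pMr// ltr_pdivrMr// mul1r.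
pose D := 2 `^ s / (1 - z); have D0 : 0 < D by rewrite divr_gt0 ?powR_gt0// subr_gt0.
exists (C * Num.max 1 D); first by rewrite mulr_gt0// ?lt_max ?ltr01//; lra.
move=> r f r0r mf; have rp : 0 < r by lra.
pose sigma := s / r; have sg0 : 0 < sigma by rewrite divr_gt0.
pose F := EFin \o f : T -> \bar R.
pose b k t := (2 `^ q') ^+ k * dist F (2 ^+ k * (t / 2)).
have b0 k t : 0 <= b k t.
  by rewrite mulr_ge0 ?exprn_ge0 ?powR_ge0//; exact: (distribution_ge0 mw w0).
have C0 : 0 < C by lra.
have pt t : 0 < t -> ((dist (M f) t `^ sigma)%:E <=
    (C `^ sigma)%:E * \sum_(k <oo) (b k t `^ sigma)%:E)%E.
  move=> t0; have Cs0 : 0 < C `^ sigma by exact: powR_gt0.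
  have bs0 k : (0 <= (b k t `^ sigma)%:E)%E by rewrite lee_fin powR_ge0.
  have := @nneseries_ge0 R (fun k => (b k t `^ sigma)%:E) xpredT 0 (fun k _ _ => bs0 k).
  have bk k : ((b k t `^ sigma)%:E <= \sum_(k <oo) (b k t `^ sigma)%:E)%E.
    have h := @nneseries_lim_ge _ (fun k => (b k t `^ sigma)%:E) xpredT 0 k.+1.
    apply: le_trans (h _); last by move=> *; exact: bs0.
    by rewrite big_nat_recr//= leeDr// sume_ge0.
  move: bk; case: (\sum_(k <oo) _)%E => [S| |] bk //.
    rewrite lee_fin => S0; rewrite -EFinM lee_fin.
    have bkS k : b k t <= S `^ sigma^-1.
      by apply: le_powR_inv => //; rewrite -lee_fin.
    have := CP f t _ mf t0 (powR_ge0 _ _) bkS.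
    move=> /(le_powR2 (ltW sg0) (distribution_ge0 mw w0 _ _)).
    by rewrite powRM ?powR_ge0 ?(ltW C0)// -[X in _ <= _ * X]powRrM mulVf ?gt_eqF// powRr1.
  by move=> _; rewrite mulry gtr0_sg// mul1e leey.
have int : (lorentz_integral mu w sigma s (M f) <=
    (C `^ sigma * D)%:E * lorentz_integral mu w sigma s F)%E.
  pose h k t := (b k t `^ sigma * t `^ (s - 1))%:E : \bar R.
  have h0 k t : (0 <= h k t)%E by rewrite lee_fin mulr_ge0 ?powR_ge0.
  have hE k t : h k t = ((((2 `^ q') ^+ k) `^ sigma)%:E *
      (dist F ((2 ^+ k / 2) * t)%R `^ sigma * t `^ (s - 1))%:E)%E.
    rewrite /h /b (_ : 2 ^+ k * (t / 2) = 2 ^+ k / 2 * t); last by ring.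
    rewrite powRM ?exprn_ge0 ?powR_ge0//; last exact: (distribution_ge0 mw w0).
    by rewrite -EFinM mulrA.
  have ck0 k : 0 < 2 ^+ k / 2 :> R by rewrite divr_gt0// exprn_gt0.
  have mh k : measurable_fun (`]0, +oo[%classic : set R) (h k).
    apply: (eq_measurable_fun (fun t => (((2 `^ q') ^+ k) `^ sigma)%:E *
      (dist F ((2 ^+ k / 2) * t)%R `^ sigma * t `^ (s - 1))%:E)%E).
      by move=> t _; rewrite hE.
    by apply: measurable_funeM; exact: measurable_scaled_integrand.
  apply: (@le_trans _ _ (\int[leb]_(t in `]0%R, +oo[)
      ((C `^ sigma)%:E * \sum_(k <oo) h k t))%E).
    apply: le_lower_integral => t; first by move=> _; rewrite lee_fin mulr_ge0 ?powR_ge0.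
    rewrite /= in_itv/= andbT => t0; rewrite EFinM.
    have ts0 : (0 <= (t `^ (s - 1))%:E)%E by rewrite lee_fin powR_ge0.
    apply: le_trans (lee_wpmul2r ts0 (pt t t0)) _.
    rewrite -muleA; apply: lee_wpmul2l; first by rewrite lee_fin powR_ge0.
    rewrite muleC -nneseriesZl; last by move=> k _; rewrite lee_fin powR_ge0.
    by apply: lee_nneseries => k _; [move=> _; rewrite mule_ge0// lee_fin powR_ge0|rewrite muleC].
  rewrite ge0_integralZl_EFin ?powR_ge0//; last 2 first.
  - by move=> t _; apply: nneseries_ge0 => k _ _.
  - by apply: ge0_emeasurable_sum => [k t _ _|k _]; [exact: h0|exact: mh].
  rewrite EFinM -muleA; apply: lee_wpmul2l; first by rewrite lee_fin powR_ge0.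
  rewrite integral_nneseries//.
  have I0 : (0 <= lorentz_integral mu w sigma s F)%E by exact: lorentz_integral_ge0.
  have term k : (\int[leb]_(t in `]0%R, +oo[) h k t <=
      (2 `^ s * z ^+ k)%:E * lorentz_integral mu w sigma s F)%E.
    pose g t := (dist F ((2 ^+ k / 2) * t)%R `^ sigma * t `^ (s - 1))%:E : \bar R.
    have g0 t : `]0%R, +oo[%classic t -> (0 <= g t)%E.
      by move=> _; rewrite lee_fin mulr_ge0 ?powR_ge0.
    have mg : measurable_fun (`]0, +oo[%classic : set R) g.
      exact: measurable_scaled_integrand.
    have cc0 : 0 <= ((2 `^ q') ^+ k) `^ sigma by exact: powR_ge0.
    have hint := ge0_integralZl_EFin leb (measurable_itv _) g0 mg cc0.
    rewrite (_ : (\int[leb]_(t in `]0%R, +oo[) h k t =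
      \int[leb]_(t in `]0%R, +oo[) ((((2 `^ q') ^+ k) `^ sigma)%:E * g t))%E); last first.
      by apply: eq_integral => t _; exact: hE.
    rewrite hint.
    rewrite (lorentz_integral_scale w0 fnu _ _ _ (ck0 k)) muleA -EFinM.
    apply: lee_wpmul2r => //; rewrite lee_fin.
    rewrite powRM ?exprn_ge0 ?invr_ge0//.
    have -> : 2^-1 `^ (- s) = 2 `^ s :> R.
      by rewrite -(powR_inv1 (ler0n R 2)) -powRrM mulN1r opprK.
    rewrite mulrA [leLHS]mulrC ler_wpM2l ?powR_ge0//.
    rewrite -!powR_mulrn ?powR_ge0// -!powRrM -powRD; last by apply/implyP => _; rewrite pnatr_eq0.
    apply: ler_powR; first lra.
    rewrite mulrBl mulrAC -/sigma.
    have k0 : 0 <= k%:R :> R by [].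
    have : q' * sigma <= s * (q' / r0).
      rewrite /sigma mulrCA ler_pM2l// ler_pM2l; last lra.
      by rewrite lef_pV2 ?posrE.
    by move=> /(ler_wpM2r k0); rewrite mulrN (mulrC k%:R s); lra.
  apply: (@le_trans _ _ (\sum_(k <oo) (2 `^ s * z ^+ k)%:E * lorentz_integral mu w sigma s F)%E).
    by apply: lee_nneseries => k _; [move=> _; exact: integral_ge0|exact: term].
  move: I0; case: (lorentz_integral mu w sigma s F) => [I| |] //.
  - rewrite lee_fin => I0.
    under eq_eseriesr do rewrite -EFinM mulrAC.
    apply: le_trans (geometric_eseries_le _ _) _; first by rewrite mulr_ge0 ?powR_ge0.
      by rewrite (ltW z0).
    by rewrite -EFinM lee_fin /D mulrAC.
  - by move=> _; rewrite gt0_muley ?leey// lte_fin.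
have sE0 : (0 <= s%:E)%E by rewrite lee_fin ltW.
have I0 : (0 <= lorentz_integral mu w sigma s F)%E by exact: lorentz_integral_ge0.
have I0' : (0 <= lorentz_integral mu w sigma s (M f))%E by exact: lorentz_integral_ge0.
rewrite !(lorentz_normE w0 fnu) -/sigma -/F.
move: (lorentz_integral mu w sigma s F) (lorentz_integral mu w sigma s (M f)) int I0 I0'.
move=> I I' int I0 I0'.
apply: (@le_trans _ _ (((C `^ sigma * D)%:E * (s%:E * I)) `^ s^-1)%E).
  apply: le_poweR2; [by rewrite invr_ge0 ltW|exact: mule_ge0|].
  by rewrite muleCA; apply: (lee_wpmul2l sE0).
have CD0 : 0 <= C `^ sigma * D by rewrite mulr_ge0 ?powR_ge0 ?ltW.
have CD0' : (0 <= (C `^ sigma * D)%:E)%E by rewrite lee_fin.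
rewrite (@poweRM _ _ _ s^-1 CD0' (mule_ge0 sE0 I0)) poweR_EFin.
apply: lee_wpmul2r; first exact: poweR_ge0.
rewrite lee_fin powRM ?powR_ge0 ?(ltW D0)// -powRrM.
have si1 : s^-1 <= 1 by rewrite invf_le1// ltW.
apply: ler_pM; rewrite ?powR_ge0//.
  rewrite /sigma mulrAC divff ?gt_eqF// mul1r; apply: ler1_powR => //.
  by rewrite invf_le1//; lra.
apply: (@le_trans _ _ (Num.max 1 D `^ s^-1)).
  by apply: le_powR2; rewrite ?invr_ge0 ?(ltW s0) ?(ltW D0)// le_max lexx orbT.
by apply: ler1_powR => //; rewrite le_max lexx.
Qed.

End Sufficiency.

Section GrandBoundedness.
Context {R : realType} {disp : measure_display} {T : measurableType disp}.
Variables (mu : {measure set T -> \bar R}) (d : T -> T -> R) (L A Delta : R).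
Variable x0 : T.
Hypothesis H : dilation_structure mu d L A Delta.
Variable w : T -> R.
Hypothesis mw : measurable_fun setT w.
Hypothesis w0 : {ae mu, forall x, 0 < w x}.

Local Notation nu := (density_measure mu mw).
Local Notation leb := (@lebesgue_measure R).

Hypothesis fnu : finite_total nu.

Local Notation dist := (distribution mu w).

Lemma le_lorentz_exponent (r r' s : R) (f : T -> \bar R) : 1 < r -> r <= r' -> 1 < s ->
  (lorentz_norm mu w r s f <=
   (Num.max 1 (fmeas nu setT))%:E * lorentz_norm mu w r' s f)%E.
Proof.
move=> r1 rr s1; set W := Num.max 1 _.
have s0 : 0 < s by lra.
have W1 : 1 <= W by rewrite le_max lexx.
have W0 : 0 < W by lra.
have r0 : 0 < r by lra.
have r'0 : 0 < r' by lra.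
pose e := s / r - s / r'.
have rVr : r'^-1 <= r^-1 by rewrite lef_pV2 ?posrE.
have e0 : 0 <= e by rewrite /e subr_ge0 ler_pM2l.
have int : (lorentz_integral mu w (s / r) s f <=
    (W `^ e)%:E * lorentz_integral mu w (s / r') s f)%E.
  rewrite /lorentz_integral -ge0_integralZl_EFin ?powR_ge0//.
  - apply: le_lower_integral => t _; first exact: lorentz_integrand_ge0.
    rewrite -EFinM lee_fin mulrA ler_wpM2r ?powR_ge0//.
    have := distribution_ge0 mw w0 f t; rewrite le_eqVlt => /predU1P[<-|d0].
      by rewrite powR0 ?mulr_ge0 ?powR_ge0// gt_eqF// divr_gt0.
    have -> : s / r = e + s / r' by rewrite /e subrK.
    rewrite powRD; last by apply/implyP => _; rewrite gt_eqF.
    rewrite ler_wpM2r ?powR_ge0//; apply: le_powR2 => //; first exact: ltW.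
    by apply: (le_trans (distribution_le w0 fnu measurableT (@subsetT _ _)));
      rewrite le_max lexx orbT.
  - by move=> t _; exact: lorentz_integrand_ge0.
  - exact: (measurable_lorentz_integrand w0 fnu).
have I0 : (0 <= lorentz_integral mu w (s / r') s f)%E by exact: lorentz_integral_ge0.
have I0' : (0 <= lorentz_integral mu w (s / r) s f)%E by exact: lorentz_integral_ge0.
rewrite !(lorentz_normE w0 fnu).
move: (lorentz_integral mu w (s / r') s f) (lorentz_integral mu w (s / r) s f) int I0 I0'.
move=> I I' int I0 I0'; have sE0 : (0 <= s%:E)%E by rewrite lee_fin ltW.
have We0 : (0 <= (W `^ e)%:E)%E by rewrite lee_fin powR_ge0.
apply: (@le_trans _ _ (((W `^ e)%:E * (s%:E * I)) `^ s^-1)%E).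
  apply: le_poweR2; [by rewrite invr_ge0 ltW|exact: mule_ge0|].
  by rewrite muleCA; apply: (lee_wpmul2l sE0).
rewrite (@poweRM _ _ _ s^-1 We0 (mule_ge0 sE0 I0)) poweR_EFin.
apply: lee_wpmul2r; first exact: poweR_ge0.
rewrite lee_fin -powRrM; apply: ler1_powR => //.
have -> : e / s = r^-1 - r'^-1 by rewrite /e; field; rewrite !gt_eqF.
have : r^-1 <= 1 by rewrite invf_le1//; lra.
have : 0 < r'^-1 by rewrite invr_gt0.
by lra.
Qed.

Variables (p q s theta : R).
Hypotheses (q1 : 1 < q) (qp : q < p) (s1 : 1 < s) (theta0 : 0 < theta).

(** For small [e] the maximal operator is bounded on the Lorentz space of
    exponent [p - e], uniformly in [e]; the remaining exponents are compared
    with the smallest good one by the embedding over a finite measure. *)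
Theorem restricted_implies_bounded : restricted_Muckenhoupt mu nu d q ->
  bounded_in_grand_lorentz mu w p s theta (maximal mu d).
Proof.
move=> restr; have hq1 := q1; have hqp := qp; have hs1 := s1; have htheta := theta0.
have p1 : 1 < p by lra.
pose q' := (q + p) / 2; pose r0 := (q' + p) / 2.
have qq' : q < q' by rewrite /q'; lra.
have q'r0 : q' < r0 by rewrite /r0 /q'; lra.
have r0p : r0 < p by rewrite /r0 /q'; lra.
have r01 : 1 < r0 by lra.
have [C C0 CP] := maximal_lorentz x0 H w0 fnu q1 qq' restr s1 q'r0.
pose W := Num.max 1 (fmeas nu setT).
have W0 : 0 < W by rewrite lt_max ltr01.
pose e0 := p - r0; have e00 : 0 < e0 by rewrite /e0; lra.
have e0p : e0 < p - 1 by rewrite /e0; lra.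
pose c0 := e0 `^ (theta / r0); have c00 : 0 < c0 by exact: powR_gt0.
pose D := p `^ theta * (W * (C / c0)).
have D0 : 0 < D by rewrite !mulr_gt0 ?powR_gt0 ?invr_gt0//; lra.
exists (Num.max C D) => f mf _.
have N0 : (0 <= grand_lorentz_norm mu w p s theta (EFin \o f))%E.
  exact: (grand_ge0 w0 fnu).
apply: grand_le => e ee ep pe.
have [small|large] := leP r0 (p - e).
  apply: (@le_trans _ _ (C%:E * grand_lorentz_norm mu w p s theta (EFin \o f))%E); last first.
    by apply: lee_wpmul2r => //; rewrite lee_fin le_max lexx.
  have h0 : (0 <= (e `^ (theta / (p - e)))%:E)%E by rewrite lee_fin powR_ge0.
  apply: (le_trans (lee_wpmul2l h0 (CP (p - e) f small mf))).
  rewrite muleCA; apply: lee_wpmul2l; first by rewrite lee_fin ltW.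
  exact: grand_ge.
apply: (@le_trans _ _ (D%:E * grand_lorentz_norm mu w p s theta (EFin \o f))%E); last first.
  by apply: lee_wpmul2r => //; rewrite lee_fin le_max lexx orbT.
have L0 g r : (0 <= lorentz_norm mu w r s g)%E by exact: (lorentz_norm_ge0 w0 fnu).
apply: (@le_trans _ _ ((p `^ theta)%:E * lorentz_norm mu w (p - e) s (maximal mu d f))%E).
  apply: lee_wpmul2r => //; rewrite lee_fin.
  exact: grand_weight_le.
rewrite /D (EFinM (p `^ theta)) -muleA; apply: lee_wpmul2l; first by rewrite lee_fin powR_ge0.
apply: (le_trans (le_lorentz_exponent _ pe (ltW large) s1)).
rewrite -/W EFinM -muleA; apply: lee_wpmul2l; first by rewrite lee_fin ltW.
apply: (le_trans (CP r0 f (lexx _) mf)).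
rewrite EFinM -muleA; apply: lee_wpmul2l; first by rewrite lee_fin ltW.
rewrite -lee_pdivrMl ?invr_gt0// invrK.
have := @grand_ge R disp T mu w p s theta (EFin \o f) e0 e00 e0p.
by rewrite (_ : p - e0 = r0) // /e0; ring.
Qed.

End GrandBoundedness.

(** * The dual weight and the theorem *)

Section DualWeight.
Context {R : realType} {disp : measure_display} {T : measurableType disp}.
Variables (mu : {measure set T -> \bar R}) (w : T -> R) (p : R).
Hypothesis mw : measurable_fun setT w.
Hypothesis w0 : {ae mu, forall x, 0 < w x}.
Hypothesis p1 : 1 < p.

Definition dual_weight (x : T) : R := w x `^ (1 - conjugate_exponent p).

Lemma dual_weight_exponent : 1 - conjugate_exponent p = - (p - 1)^-1.
Proof.
by have hp := p1; rewrite /conjugate_exponent; field; rewrite subr_eq0 gt_eqF.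
Qed.

Lemma measurable_dual_weight : measurable_fun setT dual_weight.
Proof.
apply: (@measurableT_comp _ _ _ _ _ _ (fun u : R => u `^ (1 - conjugate_exponent p))).
  exact: measurable_powR.
exact: mw.
Qed.

Local Notation nu := (density_measure mu mw).
Local Notation sg := (density_measure mu measurable_dual_weight).

Hypotheses (fmu : finite_total mu) (fnu : finite_total nu) (fsg : finite_total sg).

(** Hoelder's inequality for indicators, up to a constant. At every point
    either [w] is at least [v] or the dual weight is at least [v] to the power
    [- 1 / (p - 1)]; choosing [v] as twice the mean of [w] over [E], the points
    of the first kind fill at most half of [E]. *)
Lemma dual_weight_holder E : measurable E ->
  fmeas mu E `^ p <= 2 `^ p * fmeas nu E * fmeas sg E `^ (p - 1).
Proof.
move=> mE; have hp := p1; have p0 : 0 < p by lra.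
have p10 : 0 < p - 1 by lra.
have [E0|E0] := eqVneq (fmeas mu E) 0.
  by rewrite E0 powR0 ?gt_eqF// !mulr_ge0 ?powR_ge0 ?fmeas_ge0.
have {}E0 : 0 < fmeas mu E by rewrite lt0r E0 fmeas_ge0.
have nE0 : 0 < fmeas nu E.
  rewrite lt0r fmeas_ge0 andbT; apply/eqP => nE.
  have : nu E = 0%E by rewrite fmeasE// nE.
  move=> /(density_measure_eq0 _ mE) h.
  suff : fmeas mu E = 0 by move=> e; rewrite e ltxx in E0.
  rewrite /fmeas h//; apply: filterS w0 => x wx; first by rewrite gt_eqF.
pose v := 2 * fmeas nu E / fmeas mu E.
have v0 : 0 < v by rewrite divr_gt0// mulr_gt0.
pose E1 := E `&` [set x | v <= w x]; pose E2 := E `&` [set x | 0 < w x < v].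
pose E3 := E `&` [set x | w x <= 0].
have mI (i : interval R) : measurable (w @^-1` [set` i]).
  by rewrite -[X in measurable X]setTI; exact: mw.
have mE1 : measurable E1.
  apply: measurableI => //; rewrite (_ : [set _ | _] = w @^-1` `[v, +oo[).
    exact: mI.
  by apply/seteqP; split => x /=; rewrite in_itv/= andbT.
have mE2 : measurable E2.
  apply: measurableI => //; rewrite (_ : [set _ | _] = w @^-1` `]0, v[).
    exact: mI.
  by apply/seteqP; split => x /=; rewrite in_itv.
have mE3 : measurable E3.
  apply: measurableI => //; rewrite (_ : [set _ | _] = w @^-1` `]-oo, 0]).
    exact: mI.
  by apply/seteqP; split => x /=; rewrite in_itv.
have E30 : mu E3 = 0%E.
  have [N [mN N0 hN]] := w0; apply/eqP; rewrite -measure_le0 -N0.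
  apply: le_measure; rewrite ?inE// => x [_ /= wx]; apply: hN => /=.
  by apply/negP; rewrite -leNgt.
have cover : fmeas mu E <= fmeas mu E1 + fmeas mu E2.
  rewrite -lee_fin EFinD -!fmeasE//.
  have mE12 := measurableU _ _ mE1 mE2.
  apply: (@le_trans _ _ (mu ((E1 `|` E2) `|` E3))).
    apply: le_measure; rewrite ?inE//; first exact: measurableU.
    move=> x Ex; have [wx|wx] := leP (w x) 0; first by right.
    by left; have [vw|wv] := leP v (w x); [left|right; split => //=; rewrite wx].
  apply: (le_trans (measureU2 _ mE12 mE3)); rewrite -[leRHS]adde0.
  apply: leeD; first exact: measureU2.
  by rewrite le_eqVlt; apply/orP; left; apply/eqP; exact: E30.
have b1 : v * fmeas mu E1 <= fmeas nu E.
  apply: (@le_trans _ _ (fmeas nu E1)); last by apply: le_fmeas => //; exact: subIsetl.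
  rewrite -lee_fin EFinM -!fmeasE//; apply: density_measure_ge => //; first exact: ltW.
  by move=> x [_ /= vx]; apply: le_trans vx (ler_norm _).
pose c := v `^ (p - 1)^-1; have c0 : 0 < c by exact: powR_gt0.
have b2 : c^-1 * fmeas mu E2 <= fmeas sg E.
  apply: (@le_trans _ _ (fmeas sg E2)); last by apply: le_fmeas => //; exact: subIsetl.
  rewrite -lee_fin EFinM -!fmeasE//; apply: density_measure_ge => //; first by rewrite invr_ge0 ltW.
  move=> x [_ /= /andP[wx wv]]; rewrite ger0_norm ?powR_ge0// /dual_weight dual_weight_exponent.
  rewrite powRN lef_pV2 ?posrE ?powR_gt0//.
  by apply: le_powR2; [rewrite invr_ge0 ltW|exact: ltW|exact: ltW].
have half : fmeas mu E1 <= fmeas mu E / 2.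
  rewrite -(ler_pM2l v0); apply: le_trans b1 _; rewrite le_eqVlt; apply/orP; left.
  by apply/eqP; rewrite /v; field; rewrite gt_eqF.
have main : fmeas mu E / 2 <= c * fmeas sg E.
  by rewrite -ler_pdivrMl//; apply: le_trans b2; rewrite ler_pM2l ?invr_gt0//; lra.
have h20 : 0 <= fmeas mu E / 2 by lra.
have := le_powR2 (ltW p10) h20 main.
rewrite (@powRM _ c) ?fmeas_ge0 ?(ltW c0)// {1}/c -powRrM mulVf ?gt_eqF// powRr1 ?(ltW v0)//.
move=> h; have -> : fmeas mu E `^ p = 2 `^ p * (fmeas mu E / 2) `^ p.
  by rewrite -powRM// mulrCA divff// mulr1.
rewrite -mulrA ler_pM2l ?powR_gt0// -(mulr_powRB1 h20 p0).
apply: le_trans (ler_wpM2l h20 h) _; rewrite le_eqVlt; apply/orP; left.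
by apply/eqP; rewrite /v; field; rewrite gt_eqF.
Qed.

End DualWeight.

Section DualPair.
Context {R : realType} {disp : measure_display} {T : measurableType disp}.
Variables (mu : {measure set T -> \bar R}) (d : T -> T -> R) (L A Delta : R).
Variable x0 : T.
Hypothesis H : dilation_structure mu d L A Delta.
Hypothesis dense : continuous_dense_L1 mu d.
Variables (w : T -> R) (p : R).
Hypothesis mw : measurable_fun setT w.
Hypothesis w0 : {ae mu, forall x, 0 < w x}.
Hypothesis p1 : 1 < p.

Local Notation nu := (density_measure mu mw).
Local Notation sg := (density_measure mu (measurable_dual_weight p mw)).
Local Notation ball := (qball d).

Hypothesis fnu : finite_total nu.

Lemma Muckenhoupt_dual_bound : Muckenhoupt mu d p w -> finite_total sg /\
  exists2 K, 0 < K & forall x r, 0 < r ->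
    fmeas nu (ball x r) * fmeas sg (ball x r) `^ (p - 1) <= K * fmeas mu (ball x r) `^ p.
Proof.
rewrite /Muckenhoupt; set S := ereal_sup _ => Sfin.
have hp := p1; have p10 : 0 < p - 1 by lra.
have ub x r : 0 < r -> ((fmeas mu (ball x r))^-1%:E * (fmeas nu (ball x r))%:E *
    ((fmeas mu (ball x r))^-1%:E * sg (ball x r)) `^ (p - 1) <= S)%E.
  move=> r0; have mB := ds_measurable H x r0; have B0 := ball_gt0 H x r0.
  apply: ereal_sup_ubound; exists (ball x r); first by exists x, r.
  rewrite !(average_ball H)//; congr (_ * _ * (_ * _) `^ _)%E.
    by rewrite -[LHS]/(wmeasure mu w _) (wmeasureE mw w0 mB) (fmeasE fnu mB).
  by apply: eq_integral => y _; rewrite gee0_abs// lee_fin powR_ge0.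
have fin x r : 0 < r -> (sg (ball x r) < +oo)%E.
  move=> r0; have B0 := ball_gt0 H x r0; have W0 := weight_ball_gt0 H w0 fnu x r0.
  rewrite ltey; apply/eqP => so; have := le_lt_trans (ub x r r0) Sfin.
  rewrite so gt0_muley ?lte_fin ?invr_gt0// poweRyr ?gt_eqF//.
  by rewrite gt0_muley ?ltxx// -EFinM lte_fin mulr_gt0// invr_gt0.
have fsg : finite_total sg.
  by rewrite /finite_total -(ds_diameter H x0 (lexx Delta)); exact: fin (ds_Delta H).
split => //; exists (Num.max 1 (fine S)); first by rewrite lt_max ltr01.
move=> x r r0; have mB := ds_measurable H x r0; have B0 := ball_gt0 H x r0.
have : (((fmeas mu (ball x r))^-1 * fmeas nu (ball x r) *
    ((fmeas mu (ball x r))^-1 * fmeas sg (ball x r)) `^ (p - 1))%:E <= S)%E.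
  by have := ub x r r0; rewrite (fmeasE fsg mB).
have S0 : S \is a fin_num.
  rewrite fin_numElt Sfin andbT; apply: lt_le_trans (ub x r r0).
  apply: (@lt_le_trans _ _ 0%E); first by rewrite ltNyr.
  by rewrite mule_ge0 ?poweR_ge0// -EFinM lee_fin mulr_ge0 ?invr_ge0 ?fmeas_ge0.
rewrite -(fineK S0) lee_fin => h.
have {}h := le_trans h (_ : fine S <= Num.max 1 (fine S)).
move: h; rewrite le_max lexx orbT => /(_ isT).
have mi0 : 0 <= (fmeas mu (ball x r))^-1 by rewrite invr_ge0 ltW.
rewrite powRM ?fmeas_ge0// -[X in X `^ _ * _](powR_inv1 (ltW B0)) -powRrM mulN1r powRN.
set a := fmeas mu _; set X := fmeas nu _ * _ => h.
have ap0 : 0 < a `^ (p - 1) by exact: powR_gt0.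
rewrite -(mulr_powRB1 (ltW B0)); last lra.
rewrite -/a -ler_pdivrMr ?mulr_gt0//; apply: le_trans h.
by rewrite le_eqVlt; apply/orP; left; apply/eqP; rewrite /X; field; rewrite !gt_eqF.
Qed.

Theorem Muckenhoupt_implies_restricted : Muckenhoupt mu d p w ->
  exists2 q, 1 < q < p & restricted_Muckenhoupt mu nu d q.
Proof.
move=> /Muckenhoupt_dual_bound[fsg [K K0 Ap]].
have C0 : 0 < 2 `^ p :> R by exact: powR_gt0.
apply: (self_improvement x0 H dense fnu fsg p1 C0 K0 _ _ Ap).
- by move=> E mE; exact: density_measure_dominated.
- by move=> E mE; exact: (dual_weight_holder w0 p1 (ds_finite H) fnu fsg).
Qed.

End DualPair.

Unset Implicit Arguments.

Theorem theorem6p1 (R : realType) (disp : measure_display)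
    (T : measurableType disp) (mu : {measure set T -> \bar R})
    (d : T -> T -> R) (w : T -> R) (p s theta : R)
    (hX : homogeneous_type mu d) (hbounded : qbounded d)
    (hw : weight mu d w) (hw_int : mu.-integrable setT (EFin \o w))
    (hp : 1 < p) (hs : 1 < s) (htheta : 0 < theta) :
  bounded_in_grand_lorentz mu w p s theta (maximal mu d) <->
  Muckenhoupt mu d p w.
Proof.
have [x0 _] := hbounded; have [w0 _] := hw.
have mw : measurable_fun setT w by apply/measurable_EFinP; exact: measurable_int hw_int.
have [L [A [Delta H]]] := homogeneous_dilation hX hbounded hw_int w0.
have dense := ht_dense hX.
have fnu : finite_total (density_measure mu mw) by case/integrableP: hw_int.
split=> [[C bounded]|Ap].
- have C1 : 1 <= Num.max C 1 by rewrite le_max lexx orbT.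
  have bounded' f : measurable_fun setT f ->
      (grand_lorentz_norm mu w p s theta (EFin \o f) < +oo)%E ->
      (grand_lorentz_norm mu w p s theta (maximal mu d f) <=
       (Num.max C 1)%:E * grand_lorentz_norm mu w p s theta (EFin \o f))%E.
    move=> mf fin; apply: le_trans (bounded f mf fin) _; apply: lee_wpmul2r.
      exact: (grand_ge0 w0 fnu).
    by rewrite lee_fin le_max lexx.
  have [q /andP[q1 qp]] :=
    bounded_restricted_Muckenhoupt x0 H dense w0 fnu hp hs htheta C1 bounded'.
  exact: (restricted_implies_Muckenhoupt H w0 fnu q1 qp).
- have [q /andP[q1 qp]] := Muckenhoupt_implies_restricted x0 H dense w0 hp fnu Ap.
  exact: (restricted_implies_bounded x0 H w0 fnu q1 qp hs htheta).
Qed.
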